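(* Suppose that the matrix $P^{(-)}$ is primitive and that $2\rho>1$. Then $$(2\rho)^{-n}A_nP_{\mathcal{H}_n}\longrightarrow -Q_\infty\qquad\text{as } n\to\infty$$ in the strong resolvent sense, as self-adjoint operators on $\mathcal{H}$.
   Context: Setting. $S$ is a finite set (with all subsets measurable), $\mu$ is a probability measure on $S$ with $\mu(x)>0$ for every $x\in S$, $(E,\mathcal{E},\nu)$ is a probability space, and $\phi:S\times S\times E\to S$ is a measurable map, symmetric in its first two arguments, under which the image of $\mu\otimes\mu\otimes\nu$ is $\mu$. Tree. $\Gamma_\infty=\bigcup_{k\ge 0}\{0,1\}^k$ is the vertex set of the infinite rooted binary tree; $G_n=\{0,1\}^n$, $\Gamma_n=\bigcup_{k=0}^nG_k$, $\Gamma_{-1}=\varnothing$; $u$ has daughters $u0,u1$. Let $(\xi_u)$, $(\epsilon_u)$, $u\in\Gamma_\infty$, be the coordinate maps on $S^{\Gamma_\infty}\times E^{\Gamma_\infty}$, $\Omega=\{\omega:\xi_u(\omega)=\phi(\xi_{u0}(\omega),\xi_{u1}(\omega),\epsilon_u(\omega))\ \forall u\in\Gamma_\infty\}$, $\mathcal{F}$ the restriction to $\Omega$ of the product $\sigma$-algebra, and $m$ the unique probability measure on $(\Omega,\mathcal{F})$ such that for each $n$ the joint law of $(\xi_u)_{u\in G_n}$ and $(\epsilon_u)_{u\in\Gamma_{n-1}}$ is $\bigotimes_{G_n}\mu\otimes\bigotimes_{\Gamma_{n-1}}\nu$. Spaces and operators. $\mathcal{H}=L^2(\Omega,\mathcal{F},m)$,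 and $\mathcal{H}_n\subseteq\mathcal{H}$ is the closed subspace of random variables measurable with respect to $(\xi_u)_{u\in G_n}$ and $(\epsilon_u)_{u\in\Gamma_{n-1}}$; $\mathcal{H}_n\subseteq\mathcal{H}_{n+1}$, and $P_{\mathcal{H}_n}$ is the orthogonal projection onto $\mathcal{H}_n$. Naturally $\mathcal{H}_n\cong\bigotimes_{G_n}L^2(S,\mu)\otimes\bigotimes_{\Gamma_{n-1}}L^2(E,\nu)$. For a linear operator $L$ on $L^2(S,\mu)$ and $u\in G_n$, $L^{(u)}$ is the operator on $\mathcal{H}_n$ corresponding to $L$ acting on the factor $L^2(S,\mu)$ indexed by $u$ and the identity on all other factors. $P_{\mathbf{1}^\perp}$ is the orthogonal projection of $L^2(S,\mu)$ onto the orthogonal complement of the constants, and $A_n=\sum_{u\in G_n}P_{\mathbf{1}^\perp}^{(u)}$ on $\mathcal{H}_n$. Matrix. $P^{(2)}((x,x'),(y,y'))=\sum_{x_1\in S}\mu(x_1)\,\nu\{z:\phi(x,x_1,z)=y,\ \phi(x',x_1,z)=y'\}$ on $S^2$; $S^{\nearrow}$ is the diagonal of $S^2$; $P^{(-)}$ is the restriction of $P^{(2)}$ to $S^2\setminus S^{\nearrow}$; $\rho$ is its largest (Perron-Frobenius) eigenvalue. Eigenvectors. When $P^{(-)}$ is primitive, let $\theta$ be the positive right eigenvector ($P^{(-)}\theta=\rho\theta$) and $\kappa$ the positive left eigenvector ($\kappa P^{(-)}=\rho\kappa$), normalized by $\sum_{(x,x')\in S^2\setminus S^{\nearrow}}\theta(x,x')\kappa(x,x')=1$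 and $\sum_{(x,x')\in S^2\setminus S^{\nearrow}}\theta(x,x')\mu(x)\mu(x')=1$. Then $\kappa$ is symmetric. The operator $Q_\infty$. $Q$ is the symmetric operator on $L^2(S,\mu)$ with $$(f,Qg)_{L^2(S,\mu)}=-\tfrac12\sum_{(x,x')\in S^2\setminus S^{\nearrow}}(f(x')-f(x))(g(x')-g(x))\kappa(x,x').$$ Put $Q_n=(2\rho)^{-n}\sum_{u\in G_n}Q^{(u)}$ on $\mathcal{H}_n$ and $\mathfrak{E}_n(f,g)=-(f,Q_ng)$ for $f,g\in\mathcal{H}_n$. These forms are consistent ($\mathfrak{E}_k=\mathfrak{E}_n$ on $\mathcal{H}_k$ for $k\le n$), so they define a form $\mathfrak{E}$ on the dense subspace $\bigcup_n\mathcal{H}_n$ of $\mathcal{H}$, which is closable when $2\rho>1$. $Q_\infty$ is the self-adjoint operator on $\mathcal{H}$ such that $-Q_\infty$ is the non-negative self-adjoint operator associated with the closure of $\mathfrak{E}$. Strong resolvent convergence of non-negative self-adjoint operators $T_n$ to $T$ means $(\alpha+T_n)^{-1}h\to(\alpha+T)^{-1}h$ in norm for every $h\in\mathcal{H}$ and every $\alpha>0$ (equivalently, on the complexification, convergence of resolvents at all non-real points). *)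

(* Defs.v *)
From HB Require Import structures.
From mathcomp Require Import all_boot all_order all_algebra.
From mathcomp Require Import all_classical all_reals all_analysis.

Set Implicit Arguments.
Unset Strict Implicit.
Unset Printing Implicit Defensive.
Import Order.TTheory GRing.Theory Num.Theory.
Import numFieldNormedType.Exports.
Local Open Scope classical_set_scope.
Local Open Scope ring_scope.

Section Hilbert.
Context {R : realType} {V : lmodType R} (ip : V -> V -> R).

Definition hnorm (f : V) : R := Num.sqrt (ip f f).

Definition orthogonal_compl (M : set V) : set V :=
  [set f | forall g, M g -> ip f g = 0].

Definition oproj (M : set V) (f : V) : V :=
  xget 0 [set p | M p /\ orthogonal_compl M (f - p)].

(* A possibly unbounded linear operator is given by its graph: T (f, h) means
   that f belongs to the domain of T and T f = h. *)
Definition dom (T : set (V * V)) : set V := [set f | exists h, T (f, h)].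

Definition opp_op (T : set (V * V)) : set (V * V) :=
  [set fh | T (fh.1, - fh.2)].

Definition densely (D : set V) : Prop :=
  forall f (e : R), 0 < e -> exists2 g, D g & hnorm (f - g) < e.

Definition adjoint (T : set (V * V)) : set (V * V) :=
  [set gk | forall f h, T (f, h) -> ip h gk.1 = ip f gk.2].

(* The graph of an adjoint is a linear subspace, single-valued when dom T is
   dense; so linearity and single-valuedness of T need not be stated. *)
Definition self_adjoint (T : set (V * V)) : Prop :=
  densely (dom T) /\ T = adjoint T.

Definition nonneg_op (T : set (V * V)) : Prop :=
  forall f h, T (f, h) -> 0 <= ip f h.

(* (alpha + T)^-1 h; the default value 0 is never used when T is non-negative
   and self-adjoint and alpha > 0, since alpha + T is then a bijection from
   dom T onto the (complete) space. *)
Definition resolvent (T : set (V * V)) (alpha : R) (h : V) : V :=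
  xget 0 [set f | T (f, h - alpha *: f)].

Definition strong_resolvent_cvg (T_ : nat -> set (V * V)) (T : set (V * V)) :=
  [/\ forall n, self_adjoint (T_ n) /\ nonneg_op (T_ n),
      self_adjoint T /\ nonneg_op T &
      forall (alpha : R) (h : V), 0 < alpha ->
        (fun n => hnorm (resolvent (T_ n) alpha h - resolvent T alpha h))
          @ \oo --> (0 : R)].

(* Symmetric non-negative bilinear forms; fval is relevant on fdom only. *)
Record form := Form { fdom : set V; fval : V -> V -> R }.

Definition form_approx (e : form) (u : nat -> V) (f : V) : Prop :=
  [/\ forall k, fdom e (u k),
      (fun k => hnorm (u k - f)) @ \oo --> (0 : R) &
      forall eps : R, 0 < eps -> exists N, forall k l, (N <= k)%N -> (N <= l)%N ->
        fval e (u k - u l) (u k - u l) < eps].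

(* The limit defining the closure does not depend on the approximating
   sequences exactly when the form is closable. *)
Definition form_closure (e : form) : form :=
  Form [set f | exists u, form_approx e u f]
       (fun f g => xget 0 [set v : R | exists u w,
          [/\ form_approx e u f, form_approx e w g &
              (fun k => fval e (u k) (w k)) @ \oo --> v]]).

Definition form_op (e : form) : set (V * V) :=
  [set fh | fdom e fh.1 /\ forall g, fdom e g -> fval e fh.1 g = ip fh.2 g].

End Hilbert.

Section L2.
Context d (T : measurableType d) (R : realType) (m : {measure set T -> \bar R}).

(* LspaceType carries no vector-space structure, so L2 is built as the quotient
   of the module of square-integrable functions by the almost everywhere null
   ones. *)
Definition ae0 : {pred LfunType m (lee1n 2)} :=
  fun f => `[< (f : T -> R) = cst 0 %[ae m] >].

Lemma ae0P (f : LfunType m (lee1n 2)) :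
  reflect ((f : T -> R) = cst 0 %[ae m]) (f \in ae0).
Proof. exact: asboolP. Qed.

Lemma ae0_zmod_closed : zmod_closed ae0.
Proof.
split=> [|f g /ae0P f0 /ae0P g0]; first by apply/ae0P; exact: aeW.
apply/ae0P; apply: filterS2 f0 g0 => x /(_ I) fx /(_ I) gx _.
rewrite -[LHS]/(f x - g x) fx gx; exact: subrr.
Qed.

HB.instance Definition _ :=
  GRing.isZmodClosed.Build (LfunType m (lee1n 2)) ae0 ae0_zmod_closed.

Lemma ae0Z (a : R) f : f \in ae0 -> a *: f \in ae0.
Proof.
move=> /ae0P f0; apply/ae0P; apply: filterS f0 => x /(_ I) fx _.
rewrite -[LHS]/(a *: (f x : R)) fx; exact: scaler0.
Qed.

Definition L2 : Type := Quotient.quot ae0.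
HB.instance Definition _ := Choice.on L2.
HB.instance Definition _ := GRing.Zmodule.on L2.

Definition L2_class (f : LfunType m (lee1n 2)) : L2 :=
  \pi_(Quotient.quot ae0)%qT f.
Definition L2_repr (f : L2) : LfunType m (lee1n 2) :=
  @generic_quotient.repr _ (Quotient.quot ae0) f.

Lemma L2_reprK f : L2_class (L2_repr f) = f.
Proof. exact: generic_quotient.reprK. Qed.

Lemma L2_class_eq f g : (L2_class f = L2_class g) <-> (f - g \in ae0).
Proof.
rewrite Quotient.idealrBE; split=> [fg|/eqP]; last exact.
by apply/eqP.
Qed.

Lemma L2_classD f g : L2_class (f + g) = L2_class f + L2_class g.
Proof. exact: Quotient.pi_add. Qed.

Definition L2_scale (a : R) (f : L2) : L2 := L2_class (a *: L2_repr f).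

Lemma L2_scale_class a f : L2_scale a (L2_class f) = L2_class (a *: f).
Proof.
apply/L2_class_eq; rewrite -scalerBr; apply: ae0Z.
by apply/L2_class_eq; exact: L2_reprK.
Qed.

Lemma L2_scaleA a b f : L2_scale a (L2_scale b f) = L2_scale (a * b) f.
Proof. by rewrite -[f]L2_reprK !L2_scale_class scalerA. Qed.

Lemma L2_scale1 : left_id 1 L2_scale.
Proof. by move=> f; rewrite -[f]L2_reprK L2_scale_class scale1r. Qed.

Lemma L2_scaleDr : right_distributive L2_scale +%R.
Proof.
move=> a f g; rewrite -[f]L2_reprK -[g]L2_reprK.
by rewrite !(L2_scale_class, =^~ L2_classD) scalerDr.
Qed.

Lemma L2_scaleDl f : {morph L2_scale^~ f : a b / a + b}.
Proof.
move=> a b; rewrite -[f]L2_reprK.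
by rewrite !(L2_scale_class, =^~ L2_classD) scalerDl.
Qed.

HB.instance Definition _ := GRing.Zmodule_isLmodule.Build R L2
  L2_scaleA L2_scale1 L2_scaleDr L2_scaleDl.

Definition L2_ip (f g : L2) : R := \int[m]_x (L2_repr f x * L2_repr g x).

Definition represents (f : T -> R) (h : L2) : Prop :=
  f = L2_repr h %[ae m].

Lemma represents_class (f : LfunType m (lee1n 2)) :
  represents (f : T -> R) (L2_class f).
Proof.
have /L2_class_eq/ae0P : L2_class f = L2_class (L2_repr (L2_class f)).
  by rewrite L2_reprK.
by apply: filterS => x /(_ I) /eqP; rewrite subr_eq0 => /eqP.
Qed.

End L2.
Arguments L2_ip {d T R} m f g.

(* Vertices of the binary tree are words; the daughters of u are rcons u b. *)
Notation node := (seq bool).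

Record setting (R : realType) (S : finType) (d : measure_display)
    (E : measurableType d) := Setting {
  mu : S -> R;
  nu : probability E R;
  phi : S -> S -> E -> S;
  mu_gt0 : forall x, 0 < mu x;
  mu_sum1 : \sum_x mu x = 1;
  phiC : forall x x' z, phi x x' z = phi x' x z;
  (* S carries the discrete sigma-algebra and is finite *)
  phi_measurable : forall x x' y, measurable [set z | phi x x' z = y];
  (* mu is the image of mu (x) mu (x) nu under phi *)
  phi_image : forall y,
    \sum_x \sum_x' mu x * mu x' * fine (nu [set z | phi x x' z = y]) = mu y
}.

Section Tree.
Context {R : realType} {S : finType} {d : measure_display}
  {E : measurableType d} (M : setting R S E).

Record tree_space := TreeSpace {
  xi : node -> S;
  eps : node -> E;
  xi_phi : forall u, xi u = phi M (xi (rcons u false)) (xi (rcons u true)) (eps u)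
}.

Definition coords (w : tree_space) : (node -> S) * (node -> E) := (xi w, eps w).

(* The sigma-algebra generated by the coordinates (xi_u)_(u in I) and
   (eps_u)_(u in J) on the whole product space. *)
Definition coord_sigma (I J : set node) : set (set ((node -> S) * (node -> E))) :=
  <<s [set A | (exists u (B : set S), I u /\ A = [set w | B (w.1 u)]) \/
               (exists u (B : set E),
                  [/\ J u, measurable B & A = [set w | B (w.2 u)]])] >>.

(* For I = J = setT, the restriction to tree_space of the product
   sigma-algebra. *)
Definition tree_sigma (I J : set node) : set (set tree_space) :=
  preimage_set_system setT coords (coord_sigma I J).

Lemma tree_sigma_algebra I J : sigma_algebra setT (tree_sigma I J).
Proof. exact/sigma_algebra_preimage/smallest_sigma_algebra. Qed.

Lemma phi_surj y : exists t : S * S * E, phi M t.1.1 t.1.2 t.2 = y.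
Proof.
apply: contrapT => /forallNP noy.
have := mu_gt0 M y; rewrite -phi_image big1 ?ltxx// => x _.
rewrite big1// => x' _.
rewrite (_ : [set z | _] = set0) ?measure0 ?mulr0//.
by rewrite -subset0 => z /= xx'z; apply: (noy (x, x', z)).
Qed.

Lemma tree_space_inhabited : exists _ : tree_space, True.
Proof.
have [x0 _] : exists x0 : S, True.
  apply: contrapT => /forallNP noS.
  have := mu_sum1 M; rewrite big1 => [/eqP|x _]; first by rewrite eq_sym oner_eq0.
  by case: (noS x).
have [split splitE] := choice phi_surj.
pose step (x : S) (b : bool) := if b then (split x).1.2 else (split x).1.1.
have H u : foldl step x0 u =
    phi M (foldl step x0 (rcons u false)) (foldl step x0 (rcons u true))
      (split (foldl step x0 u)).2.
  by rewrite !foldl_rcons /= splitE.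
by exists (TreeSpace H).
Qed.

HB.instance Definition _ := gen_eqMixin tree_space.
HB.instance Definition _ := gen_choiceMixin tree_space.
HB.instance Definition _ :=
  isPointed.Build tree_space (projT1 (cid tree_space_inhabited)).

Lemma tree_sigmaC A : tree_sigma setT setT A -> tree_sigma setT setT (~` A).
Proof.
by have [_ sC _] := tree_sigma_algebra setT setT; rewrite -setTD; exact: sC.
Qed.

Lemma tree_display : measure_display. Proof. exact: default_measure_display. Qed.

HB.instance Definition _ := @isMeasurable.Build tree_display tree_space
  (tree_sigma setT setT)
  (let: And3 s0 _ _ := tree_sigma_algebra setT setT in s0)
  tree_sigmaC
  (let: And3 _ _ sU := tree_sigma_algebra setT setT in sU).

(* Product law, stated on measurable rectangles, which determine it. *)
Definition tree_law (m : probability tree_space R) : Prop :=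
  forall n (A : node -> {set S}) (B : node -> set E),
    (forall u, measurable (B u)) ->
    m [set w | (forall u, size u = n -> xi w u \in A u) /\
               (forall u, (size u < n)%N -> B u (eps w u))] =
    ((\prod_(u : n.-tuple bool) \sum_(x in A u) mu M x) *
     \prod_(k < n) \prod_(u : k.-tuple bool) fine (nu M (B u)))%:E.

Definition P2 (p q : S * S) : R :=
  \sum_x1 mu M x1 *
    fine (nu M [set z | phi M p.1 x1 z = q.1 /\ phi M p.2 x1 z = q.2]).

End Tree.
Arguments tree_space {R S d E} M.
Arguments tree_sigma {R S d E} M I J.
Arguments coords {R S d E M} w.

Definition offdiag (S : finType) : finType := {p : S * S | p.1 != p.2}.

(* Indexed by the enumeration of S^2 minus the diagonal. *)
Definition Pminus {R : realType} {S : finType} {d : measure_display}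
    {E : measurableType d} (M : setting R S E) : 'M[R]_#|offdiag S| :=
  \matrix_(i, j) P2 M (val (enum_val i)) (val (enum_val j)).

Definition primitive {R : realType} {n : nat} (A : 'M[R]_n) : Prop :=
  (forall i j, 0 <= A i j) /\
  exists2 k, (0 < k)%N & forall i j, 0 < (A ^+ k) i j.

(* By Perron-Frobenius the largest real eigenvalue of a non-negative matrix is
   also its spectral radius. *)
Definition largest_eigenvalue {R : realType} {n : nat} (A : 'M[R]_n) (a : R) :=
  eigenvalue A a /\ forall b, eigenvalue A b -> b <= a.

Section Operators.
Context {R : realType} {S : finType} {d : measure_display}
  {E : measurableType d} (M : setting R S E) (m : probability (tree_space M) R).

Local Notation H := (L2 m).

Definition S_ip (f g : S -> R) : R := \sum_x mu M x * (f x * g x).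

Definition P1perp : (S -> R) -> (S -> R) :=
  oproj S_ip (orthogonal_compl S_ip [set f | exists c, f = cst c]).

Definition Hn (n : nat) : set H :=
  [set h | exists f : tree_space M -> R,
     represents f h /\
     forall B, measurable B ->
       tree_sigma M [set u | size u = n] [set u | (size u < n)%N] (f @^-1` B)].

(* Under the identification of Hn with functions F of the coordinates
   (xi_u)_(size u = n), (eps_u)_(size u < n), the operator L acts on the
   variable xi_u, the others being frozen. *)
Definition lift_fun (L : (S -> R) -> (S -> R)) (u : node)
    (F : (node -> S) * (node -> E) -> R) (w : (node -> S) * (node -> E)) : R :=
  L (fun y => F ((fun v => if v == u then y else w.1 v), w.2)) (w.1 u).

(* Well defined on Hn n when u has length n: F is determined by f almost
   everywhere. *)
Definition lift_op (n : nat) (L : (S -> R) -> (S -> R)) (u : node) (f : H) : H :=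
  xget 0 [set g | exists F : (node -> S) * (node -> E) -> R,
    [/\ forall B, measurable B ->
          coord_sigma [set u | size u = n] [set u | (size u < n)%N] (F @^-1` B),
        represents (F \o coords) f &
        represents (lift_fun L u F \o coords) g]].

Definition An (n : nat) (f : H) : H :=
  \sum_(u : n.-tuple bool) lift_op n P1perp u f.

Definition scaled_An (rho : R) (n : nat) : set (H * H) :=
  [set fg | fg.2 = (2 * rho) ^- n *: An n (oproj (L2_ip m) (Hn n) fg.1)].

Section Q.
Variables (kappa : offdiag S -> R) (rho : R).

(* The unique h such that (f, h) = -(1/2) sum ... for all f; S_ip is definite
   since mu > 0. *)
Definition Qop (g : S -> R) : S -> R :=
  xget 0 [set h | forall f, S_ip f h =
    - (2^-1 * \sum_(p : offdiag S)
        (f (val p).2 - f (val p).1) * (g (val p).2 - g (val p).1) * kappa p)].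

Definition Qn (n : nat) (f : H) : H :=
  (2 * rho) ^- n *: \sum_(u : n.-tuple bool) lift_op n Qop u f.

(* The forms -(f, Q_n g) agree on the increasing spaces Hn, so any n with
   f, g in Hn n may be used. *)
Definition tree_form : form :=
  Form (\bigcup_n Hn n)
       (fun f g => xget 0 [set v : R | exists n,
          [/\ Hn n f, Hn n g & v = - L2_ip m f (Qn n g)]]).

Definition Qinf : set (H * H) :=
  opp_op (form_op (L2_ip m) (form_closure (L2_ip m) tree_form)).

End Q.
End Operators.
Arguments scaled_An {R S d E M} m rho n.
Arguments Qinf {R S d E M} m kappa rho.

(* Main.v *)
(* For a weight a on the off-diagonal pairs let K_a be the operator on L2(S, mu)
   with form (f, g) |-> 1/2 sum_p a(p) (f(p.1) - f(p.2)) (g(p.1) - g(p.2)), and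
   let B_n(a) be (2 rho)^-n times the sum over u in G_n of K_a acting on xi_u.
   Then (2 rho)^-n A_n = B_n(mu x mu) and - Q_n = B_n(kappa).  For f in Hn n and
   a' = rho^-1 a P2, the difference B_(n+1)(a) f - B_n(a') f is a sum over u in
   G_n of mutually orthogonal vectors, is itself orthogonal to Hn n, and has
   squared norm O((2 rho)^-n E(f, f)).  Since the iterates of a |-> a' starting
   at mu x mu converge to kappa (Perron-Frobenius), summing these orthogonal
   increments gives, for f in Hn n,
     limsup_N |(2 rho)^-N A_N f + Q_n f|^2 <= C (2 rho)^-n E(f, f).
   This bound makes E closable.  It also shows that the Galerkin solutions f_n
   in Hn n of alpha (f_n, g) + E(f_n, g) = (h, g), which converge to
   (alpha - Q_oo)^-1 h, almost solve the resolvent equation of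
   (2 rho)^-N A_N P_N for large N. *)
Require Import Defs.
From mathcomp Require Import all_boot all_order all_algebra.
From mathcomp Require Import all_classical all_reals all_analysis.
From mathcomp Require Import measurable_realfun ring lra.
Import Order.TTheory GRing.Theory Num.Theory.
Import numFieldNormedType.Exports.
Local Open Scope classical_set_scope.
Local Open Scope ring_scope.

Set Implicit Arguments.
Unset Strict Implicit.
Unset Printing Implicit Defensive.

(** * Forms on Hilbert spaces *)

(** For [f] in a fixed [Hn n] the vectors (2 rho)^-N A_N f do converge, to - Q_oo f, which would
    suffice if the union of the [Hn n] were known to be a core of Q_oo. By construction it is only a
    core of the form. Hence the detour through equations inside [Hn n]: there alpha f_n + L_n f_n,
    with L_n = - Q_n, is exactly the projection of [h], and E(f_n, f_n) <= |h|^2 / alpha, so the two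
    errors, the distance from [h] to [Hn n] and C (2 rho)^-n E(f_n, f_n), both vanish. Orthogonality
    of the increments has one source. If the value at one daughter of u is replaced, the sibling and
    eps_u being kept, the pair (old value, new value) at u is drawn by P2. Averaged given xi_u, K_a
    at one daughter becomes rho K_a' at u; two daughters and a factor (2 rho)^-1 give K_a'. The
    diagonal is absorbing for P2 and carries no energy, which leaves P^(-). No conditional
    expectation is formed: phi(., ., eps_u) has finitely many values, so the operators are finite
    kernels applied to functions independent of the data at u and its daughters. *)

Lemma quadratic_ge0 (R : realType) (a b c : R) : 0 <= c ->
  (forall t, 0 <= a + t * b *+ 2 + t ^+ 2 * c) -> b ^+ 2 <= a * c.
Proof.
rewrite le_eqVlt => /orP[/eqP <-|c0] H.
  have [->|b0] := eqVneq b 0; first by rewrite expr0n mulr0.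
  have /= := H (- (a + 1) / (b *+ 2)).
  have -> : a + - (a + 1) / (b *+ 2) * b *+ 2 + (- (a + 1) / (b *+ 2)) ^+ 2 * 0 = -1.
    by field; rewrite b0.
  by lra.
have := H (- b / c).
have -> : a + - b / c * b *+ 2 + (- b / c) ^+ 2 * c = a - b ^+ 2 / c.
  by field; rewrite gt_eqF.
by rewrite subr_ge0 ler_pdivrMr.
Qed.

(** For the non-negative sequences to which it is applied this is convergence to 0, without absolute
    values or filters. *)
Definition small {R : realType} (x : nat -> R) : Prop :=
  forall e, 0 < e -> exists N, forall k, (N <= k)%N -> x k < e.

Section sform.
Context {R : realType} {V : lmodType R}.
Implicit Types (D : set V) (e : V -> V -> R).

(** All laws are relative to [D], since a form given by [xget] takes default values outside its
    domain. Inner products, closures of forms and the forms [ip f (L g)] of symmetric non-negative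
    operators are all treated through this one predicate. *)
Record sform D e : Prop := Sform {
  sf0 : D 0;
  sfD : forall f g, D f -> D g -> D (f + g);
  sfZ : forall a f, D f -> D (a *: f);
  sfC : forall f g, D f -> D g -> e f g = e g f;
  sfDl : forall f g h, D f -> D g -> D h -> e (f + g) h = e f h + e g h;
  sfZl : forall a f h, D f -> D h -> e (a *: f) h = a * e f h;
  sf_ge0 : forall f, D f -> 0 <= e f f }.

Variables (D : set V) (e : V -> V -> R).
Hypothesis F : sform D e.

Lemma sfN f : D f -> D (- f).
Proof. by move=> Df; rewrite -scaleN1r; exact: (sfZ F). Qed.

Lemma sfB f g : D f -> D g -> D (f - g).
Proof. by move=> Df Dg; apply: (sfD F) => //; exact: sfN. Qed.

Lemma sfDr f g h : D f -> D g -> D h -> e h (f + g) = e h f + e h g.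
Proof.
move=> *; rewrite (sfC F) ?(sfDl F)//; last exact: (sfD F).
by rewrite (sfC F) // [e g h](sfC F).
Qed.

Lemma sfZr a f h : D f -> D h -> e h (a *: f) = a * e h f.
Proof.
by move=> *; rewrite (sfC F) ?(sfZl F)// ?[e f h](sfC F)//; exact: (sfZ F).
Qed.

Lemma sfNl f h : D f -> D h -> e (- f) h = - e f h.
Proof. by move=> *; rewrite -scaleN1r (sfZl F)// mulN1r. Qed.

Lemma sfNr f h : D f -> D h -> e h (- f) = - e h f.
Proof. by move=> *; rewrite -scaleN1r sfZr// mulN1r. Qed.

Lemma sfBl f g h : D f -> D g -> D h -> e (f - g) h = e f h - e g h.
Proof. by move=> *; rewrite (sfDl F) ?sfNl//; exact: sfN. Qed.

Lemma sfBr f g h : D f -> D g -> D h -> e h (f - g) = e h f - e h g.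
Proof. by move=> *; rewrite sfDr ?sfNr//; exact: sfN. Qed.

Lemma sf0l f : D f -> e 0 f = 0.
Proof. by move=> Df; rewrite -(scale0r 0) (sfZl F) ?mul0r//; exact: (sf0 F). Qed.

Lemma sf_sqrD f g : D f -> D g -> e (f + g) (f + g) = e f f + e f g *+ 2 + e g g.
Proof.
move=> Df Dg; have Dfg := sfD F Df Dg.
by rewrite (sfDl F)// !sfDr// (sfC F Dg Df); ring.
Qed.

Lemma sf_sqrB f g : D f -> D g -> e (f - g) (f - g) = e f f - e f g *+ 2 + e g g.
Proof.
move=> Df Dg; rewrite sf_sqrD ?sfNr ?sfNl//; last exact: sfN.
- by rewrite opprK mulNrn.
- exact: sfN.
Qed.

Lemma sf_sqrN f : D f -> e (- f) (- f) = e f f.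
Proof. by move=> Df; rewrite sfNl ?sfNr ?opprK//; exact: sfN. Qed.

Lemma sf_sym f g : D f -> D g -> e (f - g) (f - g) = e (g - f) (g - f).
Proof. by move=> Df Dg; rewrite -sf_sqrN ?opprB//; exact: sfB. Qed.

Lemma sf_sqrZ a f : D f -> e (a *: f) (a *: f) = a ^+ 2 * e f f.
Proof. by move=> Df; rewrite (sfZl F) ?sfZr ?mulrA ?expr2//; exact: (sfZ F). Qed.

Lemma cauchy_schwarz f g : D f -> D g -> e f g ^+ 2 <= e f f * e g g.
Proof.
move=> Df Dg; apply: quadratic_ge0; first exact: (sf_ge0 F).
move=> t; have Dt := sfZ F t Dg.
have := sf_ge0 F (sfD F Df Dt); rewrite sf_sqrD// sf_sqrZ// sfZr//.
Qed.

Lemma sf_sqrD_le f g : D f -> D g ->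
  e (f + g) (f + g) <= 2 * e f f + 2 * e g g.
Proof.
move=> Df Dg; have := sf_ge0 F (sfB Df Dg).
by rewrite sf_sqrB// sf_sqrD//; lra.
Qed.

Lemma sf_sqrB_le f g h : D f -> D g -> D h ->
  e (f - h) (f - h) <= 2 * e (f - g) (f - g) + 2 * e (g - h) (g - h).
Proof.
move=> Df Dg Dh; have -> : f - h = (f - g) + (g - h) by rewrite addrA subrK.
by apply: sf_sqrD_le; exact: sfB.
Qed.

End sform.

Section complete.
Context {R : realType} {V : lmodType R}.
Implicit Types (D : set V) (e : V -> V -> R).

Definition cauchy_seq e (u : nat -> V) : Prop :=
  forall eps, 0 < eps -> exists N, forall k l, (N <= k)%N -> (N <= l)%N ->
    e (u k - u l) (u k - u l) < eps.

Definition complete_form D e : Prop := forall u, (forall k, D (u k)) ->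
  cauchy_seq e u -> exists2 f, D f & small (fun k => e (u k - f) (u k - f)).

Variables (D : set V) (e : V -> V -> R).
Hypothesis F : sform D e.
Hypothesis De : complete_form D e.

(** The direct method: [J] is bounded below by [- C], and the parallelogram identity at midpoints
    makes a minimizing sequence Cauchy for [e]; its limit represents [l]. *)
Lemma riesz (l : V -> R) (C : R) : 0 <= C ->
  (forall f g, D f -> D g -> l (f + g) = l f + l g) ->
  (forall a f, D f -> l (a *: f) = a * l f) ->
  (forall g, D g -> l g ^+ 2 <= C * e g g) ->
  exists2 f, D f & forall g, D g -> e f g = l g.
Proof.
move=> C0 lD lZ lC.
pose J f := e f f - l f *+ 2.
have J_ge f : D f -> - C <= J f.
  move=> Df; rewrite /J; have := lC _ Df; have e0 := sf_ge0 F Df => H.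
  rewrite leNgt; apply/negP => A.
  have B : C + e f f < l f *+ 2 by rewrite -subr_gt0; lra.
  have : (C + e f f) ^+ 2 < (l f *+ 2) ^+ 2.
    by rewrite ltr_pXn2r// ?nnegrE; [exact: addr_ge0|apply: ltW; apply: le_lt_trans B; exact: addr_ge0].
  have : 0 <= (C - e f f) ^+ 2 by exact: sqr_ge0.
  by nra.
pose I := inf [set J f | f in D].
have I_inf : has_inf [set J f | f in D].
  split; first by exists (J 0), 0 => //; exact: (sf0 F).
  by exists (- C) => _ [f Df <-]; exact: J_ge.
have I_le f : D f -> I <= J f.
  by move=> Df; apply: ge_inf; [exact: I_inf.2|exists f].
have uP n : exists f, D f /\ J f < I + n.+1%:R^-1.
  have [|_ [f Df <-] Jf] := @inf_adherent _ _ n.+1%:R^-1 _ I_inf.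
    by rewrite invr_gt0.
  by exists f.
have [u uJ] := choice uP.
have Du n : D (u n) := (uJ n).1.
have Ju n : J (u n) - I < n.+1%:R^-1 by rewrite ltrBlDl (uJ n).2.
have invn eps : 0 < eps -> exists N, forall n, (N <= n)%N -> n.+1%:R^-1 < eps :> R.
  move=> e0; exists (Num.truncn eps^-1) => n Nn; rewrite invf_plt ?posrE//.
  by apply: lt_le_trans (truncnS_gt _) _; rewrite ler_nat.
have u_cauchy : cauchy_seq e u.
  move=> eps e0; have [N NP] := invn (eps / 4) ltac:(by rewrite divr_gt0).
  exists N => k m Nk Nm.
  have := I_le (2^-1 *: (u k + u m)) (sfZ F _ (sfD F (Du k) (Du m))).
  rewrite /J (sf_sqrZ F)//; last exact: (sfD F).
  rewrite lZ ?lD//; last exact: (sfD F).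
  rewrite (sf_sqrB F)// (sf_sqrD F)//.
  have := Ju k; have := Ju m; have := NP _ Nk; have := NP _ Nm; rewrite /J.
  move: (e (u k) (u k)) => a; have -> : 2^-1 ^+ 2 = 4^-1 :> R by field.
  move: (m.+1%:R^-1) (k.+1%:R^-1) => x y; by lra.
have [f Df fP] := De Du u_cauchy.
exists f => // g Dg.
(* The discriminant of [t |-> J (u n + t g) - I >= 0]: the Euler equation holds at [u n] up to its
   distance from the infimum, so it passes to the limit directly. *)
have key n : (e (u n) g - l g) ^+ 2 <= (J (u n) - I) * e g g.
  apply: quadratic_ge0; first exact: (sf_ge0 F).
  move=> t; have := I_le _ (sfD F (Du n) (sfZ F t Dg)).
  rewrite /J (sf_sqrD F)//; last exact: (sfZ F).
  rewrite (sf_sqrZ F)// (sfZr F)// lD ?lZ//; last exact: (sfZ F).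
  by lra.
apply/eqP; rewrite -subr_eq0 -sqrf_eq0 eq_le sqr_ge0 andbT.
apply/ler_addgt0Pr => eps e0; rewrite add0r.
have G1 : 0 < e g g + 1 by rewrite ltr_wpDl// (sf_ge0 F).
have d0 : 0 < eps / (4 * (e g g + 1)) by rewrite divr_gt0 ?mulr_gt0.
have [N1 H1] := fP _ d0; have [N2 H2] := invn _ d0.
pose n := maxn N1 N2.
have {}H1 := H1 n (leq_maxl _ _).
have {}H2 : J (u n) - I < eps / (4 * (e g g + 1)).
  exact: lt_trans (Ju n) (H2 _ (leq_maxr _ _)).
have CS := cauchy_schwarz F (sfB F (Du n) Df) Dg.
have Hk := key n.
rewrite (sfBl F)// in CS.
have E4 : eps / (4 * (e g g + 1)) * (4 * (e g g + 1)) = eps.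
  by rewrite divfK// gt_eqF// mulr_gt0.
have g0 := sf_ge0 F Dg.
set d := eps / _ in H1 H2 E4 d0.
have I1 : e (u n - f) (u n - f) * e g g <= d * e g g by rewrite ler_wpM2r// ltW.
have I2 : (J (u n) - I) * e g g <= d * e g g by rewrite ler_wpM2r// ltW.
have := sqr_ge0 ((e (u n) g - l g) + (e (u n) g - e f g)).
move: CS Hk I1 I2; set x := J _ - I; set y := e (u n - f) _.
by nra.
Qed.

End complete.

Section hilbert.
Context {R : realType} {V : lmodType R} (ip : V -> V -> R).

Record hilbert : Prop := Hilbert {
  hil_form : sform setT ip;
  hil_def : forall f, ip f f = 0 -> f = 0;
  hil_complete : complete_form setT ip }.

Definition closed_set (D : set V) : Prop := forall u f,
  (forall k, D (u k)) -> small (fun k => ip (u k - f) (u k - f)) -> D f.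

Hypothesis H : hilbert.
Let F : sform setT ip := hil_form H.

Lemma ip_eq f g : (forall h, ip f h = ip g h) -> f = g.
Proof.
move=> fg; apply/eqP; rewrite -subr_eq0; apply/eqP; apply: (hil_def H).
by rewrite (sfBl F)// fg subrr.
Qed.

(** The bound on [B] makes [a ip + B] comparable with [ip] on [D], so completeness of the space
    passes to [D] with the new form. Used three times: with [B = 0] for projections, on [D n] for
    Galerkin problems, and on the whole space for resolvents of bounded operators. *)
Lemma solve (D : set V) (B : V -> V -> R) (C a : R) (h : V) :
  sform D B -> closed_set D -> (forall g, D g -> B g g <= C * ip g g) -> 0 < a ->
  exists2 f, D f & forall g, D g -> a * ip f g + B f g = ip h g.
Proof.
move=> BF cD BC a0.
have FD : sform D (fun f g => a * ip f g + B f g).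
  case: (BF) => B0 BD BZ Bs BDl BZl Bge; split => //.
  - by move=> f g Df Dg; rewrite (sfC F)// Bs.
  - by move=> f g k Df Dg Dk; rewrite (sfDl F)// BDl//; ring.
  - by move=> b f k Df Dk; rewrite (sfZl F)// BZl//; ring.
  - by move=> f Df; rewrite addr_ge0 ?mulr_ge0 ?(ltW a0) ?Bge ?(sf_ge0 F).
have [] := @riesz _ _ D _ FD _ (ip h) (ip h h / a).
- move=> u Du u_cauchy.
  have uc : cauchy_seq ip u.
    move=> e e0; have [N NP] := u_cauchy (a * e) ltac:(by rewrite mulr_gt0).
    exists N => k l Nk Nl; rewrite -(ltr_pM2l a0); apply: le_lt_trans (NP k l Nk Nl).
    by rewrite lerDl (sf_ge0 BF)//; exact: (sfB BF).
  have [f _ fP] := hil_complete H (fun k => I) uc.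
  have Df : D f by exact: cD fP.
  exists f => // e e0.
  have aC : 0 < a + `|C| by rewrite ltr_wpDr.
  have [N NP] := fP (e / (a + `|C|)) ltac:(by rewrite divr_gt0).
  exists N => k Nk; have := NP _ Nk; rewrite ltr_pdivlMr//; apply: le_lt_trans.
  rewrite mulrDr mulrC lerD2l; apply: le_trans (BC _ (sfB BF (Du k) Df)) _.
  by rewrite mulrC ler_wpM2l ?(sf_ge0 F)// ler_norm.
- by rewrite divr_ge0 ?(sf_ge0 F)// ltW.
- by move=> *; rewrite (sfDr F).
- by move=> *; rewrite (sfZr F).
- move=> g Dg; apply: le_trans (cauchy_schwarz F I I) _.
  rewrite -mulrA ler_wpM2l ?(sf_ge0 F)// -ler_pdivrMl ?invr_gt0// invrK.
  by rewrite lerDl (sf_ge0 BF).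
- by move=> f Df fP; exists f.
Qed.

Lemma oprojP (D : set V) (B : V -> V -> R) (h : V) : sform D B -> closed_set D ->
  D (oproj ip D h) /\ forall g, D g -> ip (h - oproj ip D h) g = 0.
Proof.
move=> BF cD.
(* The projection solves the variational problem of the zero form; [BF] supplies the linear
   structure of [D]. *)
have Z : sform D (fun _ _ => 0).
  by case: BF => *; split => // *; rewrite ?addr0 ?mulr0.
have [|f Df fP] := solve (C := 0) h Z cD _ ltr01.
  by move=> g _; rewrite mul0r.
rewrite /oproj; apply: (@xgetPex _ 0 [set p | D p /\ orthogonal_compl ip D (h - p)]).
exists f; split => // g Dg; rewrite (sfBl F)//.
by have := fP g Dg; rewrite mul1r addr0 => ->; rewrite subrr.
Qed.

Lemma best_approx (D : set V) (h p g : V) : (forall k, D k -> ip (h - p) k = 0) ->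
  D (p - g) -> ip (h - p) (h - p) <= ip (h - g) (h - g).
Proof.
move=> hp Dpg; have -> : h - g = (h - p) + (p - g) by rewrite addrA subrK.
by rewrite [leRHS](sf_sqrD F)// (hp _ Dpg) mul0rn addr0 lerDl (sf_ge0 F).
Qed.

Lemma small_eq u f g : small (fun k => ip (u k - f) (u k - f)) ->
  small (fun k => ip (u k - g) (u k - g)) -> f = g.
Proof.
move=> uf ug; apply/eqP; rewrite -subr_eq0; apply/eqP; apply: (hil_def H).
apply/eqP; rewrite eq_le (sf_ge0 F)// andbT; apply/ler_addgt0Pr => e e0.
have [N1 H1] := uf _ (divr_gt0 e0 (ltr0n _ 4)).
have [N2 H2] := ug _ (divr_gt0 e0 (ltr0n _ 4)).
have {}H1 := H1 (maxn N1 N2) (leq_maxl _ _).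
have {}H2 := H2 (maxn N1 N2) (leq_maxr _ _).
rewrite add0r; apply: le_trans (sf_sqrB_le F (g := u (maxn N1 N2)) I I I) _.
by rewrite (sf_sym F I (I : setT (u _))); lra.
Qed.

Lemma hnorm_cvg0 (u : nat -> V) :
  (fun k => hnorm ip (u k)) @ \oo --> (0 : R) <-> small (fun k => ip (u k) (u k)).
Proof.
split=> [/cvgr0Pnorm_lt uc e e0|us].
  have [N _ NP] := uc (Num.sqrt e) ltac:(by rewrite sqrtr_gt0).
  exists N => k Nk; have := NP k Nk.
  by rewrite ger0_norm ?sqrtr_ge0// ltr_sqrt.
apply/cvgr0Pnorm_lt => e e0.
have [N NP] := us (e ^+ 2) ltac:(by rewrite exprn_gt0).
exists N => // k /= Nk; rewrite ger0_norm ?sqrtr_ge0//.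
rewrite -(@ger0_norm _ e) ?ltW// -sqrtr_sqr ltr_sqrt ?NP// exprn_gt0//.
Qed.

End hilbert.

(** * Closability and the closure of a form *)

Section form_limit.
Context {R : realType} {V : lmodType R} (ip : V -> V -> R).
Hypothesis H : hilbert ip.
Let F : sform setT ip := hil_form H.
Variable fm : @Defs.form R V.
Local Notation e := (fval fm).
Local Notation DD := (fdom fm).
Hypothesis eF : sform DD e.
Hypothesis e_bnd : forall h, DD h ->
  exists2 c, 0 <= c & forall g, DD g -> e h g ^+ 2 <= c * ip g g.

Lemma form_approxP u f : form_approx ip fm u f <->
  [/\ forall k, DD (u k), small (fun k => ip (u k - f) (u k - f)) & cauchy_seq e u].
Proof. by split=> -[Du uf uc]; split => //; apply/hnorm_cvg0. Qed.

Lemma cauchy_seq_bounded u : (forall k, DD (u k)) -> cauchy_seq e u ->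
  exists2 M, 0 < M & exists N, forall k, (N <= k)%N -> e (u k) (u k) <= M.
Proof.
move=> Du uc; have [N NP] := uc 1 ltr01.
exists (2 * e (u N) (u N) + 2).
  by rewrite ltr_wpDl// mulr_ge0// (sf_ge0 eF).
exists N => k Nk; have -> : u k = (u k - u N) + u N by rewrite subrK.
apply: le_trans (sf_sqrD_le eF (sfB eF (Du _) (Du _)) (Du _)) _.
by have := NP k N Nk (leqnn _); lra.
Qed.

(** Write [e (u k) (u k) = e (u k) (u l) + e (u k) (u k - u l)]. For fixed [k] the first term is
    small for large [l] by [e_bnd] at [u k], the second by the Cauchy property and the bound [M] on
    the energies. *)
Lemma form_closable u : form_approx ip fm u 0 -> small (fun k => e (u k) (u k)).
Proof.
move=> /form_approxP[Du u0 uc] eps eps0.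
have [M M0 [N1 N1P]] := cauchy_seq_bounded Du uc.
have [N2 N2P] := uc (eps ^+ 2 / (16 * M)) ltac:(by rewrite divr_gt0 ?exprn_gt0 ?mulr_gt0).
exists (maxn N1 N2) => k; rewrite geq_max => /andP[N1k N2k].
have [c c0 cP] := e_bnd (Du k).
have [N3 N3P] := u0 (eps ^+ 2 / (16 * (c + 1))) ltac:(by rewrite divr_gt0 ?exprn_gt0 ?mulr_gt0// ltr_wpDl).
pose l := maxn N2 N3.
have {}N3P := N3P l (leq_maxr _ _); rewrite subr0 in N3P.
have {}N2P := N2P k l N2k (leq_maxl _ _).
have {cP}B1 := cP _ (Du l).
have B2 := cauchy_schwarz eF (Du k) (sfB eF (Du k) (Du l)).
have {N1P}B3 := N1P k N1k.
have half (x : R) : x ^+ 2 <= eps ^+ 2 / 16 -> x <= eps / 4.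
  move=> xe; rewrite leNgt; apply/negP => ex.
  have : (eps / 4) ^+ 2 < x ^+ 2.
    by rewrite ltr_pXn2r// ?nnegrE ?divr_ge0 ?ltW//; apply: lt_trans ex; rewrite divr_gt0.
  by nra.
have E1 : e (u k) (u l) <= eps / 4.
  apply: half; apply: (le_trans B1).
  move: N3P; rewrite -(ltr_pM2l (_ : 0 < c + 1)) ?ltr_wpDl//.
  have -> : (c + 1) * (eps ^+ 2 / (16 * (c + 1))) = eps ^+ 2 / 16.
    by field; rewrite gt_eqF// ltr_wpDl.
  by have := sf_ge0 F (I : setT (u l)); nra.
have E2 : e (u k) (u k - u l) <= eps / 4.
  apply: half; apply: (le_trans B2).
  have D0 := sf_ge0 eF (sfB eF (Du k) (Du l)).
  apply: (@le_trans _ _ (M * e (u k - u l) (u k - u l))); first by rewrite ler_wpM2r.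
  move: N2P; rewrite -(ltr_pM2l M0).
  have -> : M * (eps ^+ 2 / (16 * M)) = eps ^+ 2 / 16 by field; rewrite gt_eqF.
  by move/ltW.
by move: E2; rewrite (sfBr eF)//; lra.
Qed.

Lemma form_approxB u w f g : form_approx ip fm u f -> form_approx ip fm w g ->
  form_approx ip fm (fun k => u k - w k) (f - g).
Proof.
move=> /form_approxP[Du uf uc] /form_approxP[Dw wg wc].
apply/form_approxP; split.
- by move=> k; exact: (sfB eF).
- move=> eps e0.
  have [N1 H1] := uf _ (divr_gt0 e0 (ltr0n _ 4)).
  have [N2 H2] := wg _ (divr_gt0 e0 (ltr0n _ 4)).
  exists (maxn N1 N2) => k; rewrite geq_max => /andP[/H1{}H1 /H2{}H2].
  have -> : u k - w k - (f - g) = (u k - f) + - (w k - g) by rewrite !opprB addrACA [RHS]addrACA; congr (_ + _); rewrite addrC.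
  apply: le_lt_trans (sf_sqrD_le F I I) _; rewrite (sf_sqrN F)//; lra.
- move=> eps e0.
  have [N1 H1] := uc _ (divr_gt0 e0 (ltr0n _ 4)).
  have [N2 H2] := wc _ (divr_gt0 e0 (ltr0n _ 4)).
  exists (maxn N1 N2) => k l; rewrite !geq_max => /andP[k1 k2] /andP[l1 l2].
  have {}H1 := H1 _ _ k1 l1; have {}H2 := H2 _ _ k2 l2.
  have -> : u k - w k - (u l - w l) = (u k - u l) + - (w k - w l) by rewrite !opprB addrACA [RHS]addrACA; congr (_ + _); rewrite addrC.
  apply: le_lt_trans (sf_sqrD_le eF (sfB eF _ _) (sfN eF (sfB eF _ _))) _ => //.
  rewrite (sf_sqrN eF)//; [lra|exact: (sfB eF)].
Qed.

Lemma form_approxZ u f a : form_approx ip fm u f ->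
  form_approx ip fm (fun k => a *: u k) (a *: f).
Proof.
have a1 : 0 < a ^+ 2 + 1 by rewrite ltr_wpDl// sqr_ge0.
have H1 (x eps : R) : 0 <= x -> x < eps / (a ^+ 2 + 1) -> a ^+ 2 * x < eps.
  by move=> x0; rewrite ltr_pdivlMr//; nra.
move=> /form_approxP[Du uf uc]; apply/form_approxP; split.
- by move=> k; exact: (sfZ eF).
- move=> eps e0; have [N NP] := uf _ (divr_gt0 e0 a1).
  exists N => k /NP xe; rewrite -scalerBr (sf_sqrZ F)//.
  by apply: H1 xe; exact: (sf_ge0 F).
- move=> eps e0; have [N NP] := uc _ (divr_gt0 e0 a1).
  exists N => k l Nk Nl; rewrite -scalerBr (sf_sqrZ eF)//; last exact: (sfB eF).
  by apply: H1 (NP _ _ Nk Nl); apply: (sf_ge0 eF); exact: (sfB eF).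
Qed.

Lemma form_approx0 : form_approx ip fm (fun=> 0) 0.
Proof.
have D0 := sf0 eF.
by apply/form_approxP; split => // [|eps e0]; [move=> eps e0|]; exists 0%N => *;
  rewrite subr0 ?(sf0l F)// (sf0l eF).
Qed.

Lemma form_approxD u w f g : form_approx ip fm u f -> form_approx ip fm w g ->
  form_approx ip fm (fun k => u k + w k) (f + g).
Proof.
move=> uf wg; have := form_approxB uf (form_approxB form_approx0 wg).
by rewrite sub0r opprK; under eq_fun do rewrite sub0r opprK.
Qed.

Lemma form_cvg0 (a b : nat -> V) (M : R) : (forall k, DD (a k)) -> (forall k, DD (b k)) ->
  small (fun k => e (a k) (a k)) -> 0 < M ->
  (exists N, forall k, (N <= k)%N -> e (b k) (b k) <= M) ->
  (fun k => e (a k) (b k)) @ \oo --> (0 : R).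
Proof.
move=> Da Db a0 M0 [N1 N1P]; apply/cvgr0Pnorm_lt => eps e0.
have [N2 N2P] := a0 (eps ^+ 2 / M) ltac:(by rewrite divr_gt0 ?exprn_gt0).
exists (maxn N1 N2) => // k /=; rewrite geq_max => /andP[/N1P bM /N2P].
rewrite ltr_pdivlMr// => ae.
rewrite -(@ltr_pXn2r _ 2)// ?nnegrE ?ltW// real_normK ?num_real//.
apply: le_lt_trans (cauchy_schwarz eF (Da k) (Db k)) _; apply: le_lt_trans ae.
by rewrite ler_wpM2l// (sf_ge0 eF).
Qed.

Lemma form_limit_unique u u' w w' f g (v : R) : form_approx ip fm u f ->
  form_approx ip fm u' f -> form_approx ip fm w g -> form_approx ip fm w' g ->
  (fun k => e (u k) (w k)) @ \oo --> v -> (fun k => e (u' k) (w' k)) @ \oo --> v.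
Proof.
move=> uf uf' wg wg' uv.
have [[Du _ uc] [Du' _ _] [Dw _ _] [Dw' _ wc']] := And4 uf uf' wg wg'.
have D1 : small (fun k => e (u' k - u k) (u' k - u k)).
  by apply: form_closable; rewrite -[0](subrr f); exact: form_approxB.
have D2 : small (fun k => e (w' k - w k) (w' k - w k)).
  by apply: form_closable; rewrite -[0](subrr g); exact: form_approxB.
have [M1 M10 B1] := cauchy_seq_bounded Du uc.
have [M2 M20 B2] := cauchy_seq_bounded Dw' wc'.
have c1 : (fun k => e (u' k - u k) (w' k)) @ \oo --> (0 : R).
  by apply: (form_cvg0 _ _ D1 M20 B2) => // k; exact: (sfB eF).
have c2 : (fun k => e (w' k - w k) (u k)) @ \oo --> (0 : R).
  by apply: (form_cvg0 _ _ D2 M10 B1) => // k; exact: (sfB eF).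
have -> : (fun k => e (u' k) (w' k)) =
    (fun k => e (u k) (w k) + e (u' k - u k) (w' k) + e (w' k - w k) (u k)).
  apply/funext => k.
  rewrite !(sfBl eF)// (sfC eF (Dw' k) (Du k)) (sfC eF (Dw k) (Du k)); ring.
by rewrite -[v]addr0 -[v + 0]addr0; exact: cvgD (cvgD uv c1) c2.
Qed.

Lemma form_limit_exists u w f g : form_approx ip fm u f -> form_approx ip fm w g ->
  exists v : R, (fun k => e (u k) (w k)) @ \oo --> v.
Proof.
move=> [Du _ uc] [Dw _ wc].
have [M1 M10 [N1 B1]] := cauchy_seq_bounded Du uc.
have [M2 M20 [N2 B2]] := cauchy_seq_bounded Dw wc.
suff : cvg ((fun k => e (u k) (w k)) @ \oo) by move=> /cvg_ex.
apply: cauchy_cvg; apply/cauchy_exP => eps e0.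
have [N3 B3] := uc (eps ^+ 2 / (9 * M2)) ltac:(by rewrite divr_gt0 ?exprn_gt0 ?mulr_gt0).
have [N4 B4] := wc (eps ^+ 2 / (9 * M1)) ltac:(by rewrite divr_gt0 ?exprn_gt0 ?mulr_gt0).
pose N := maxn (maxn N1 N2) (maxn N3 N4).
have third (x y M : R) : 0 < M -> x ^+ 2 <= y * M -> y < eps ^+ 2 / (9 * M) -> `|x| <= eps / 3.
  move=> M0 xy ye; have e3 : 0 <= eps / 3 by rewrite divr_ge0// ltW.
  rewrite -(@ler_pXn2r _ 2)// ?nnegrE// real_normK ?num_real//.
  apply: (le_trans xy); move: ye; rewrite -(ltr_pM2r M0) => /ltW.
  by have -> : eps ^+ 2 / (9 * M) * M = (eps / 3) ^+ 2 by field; rewrite gt_eqF.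
exists (e (u N) (w N)); exists N => // k /= Nk.
have := leqnn N; rewrite {1}/N !geq_max => /andP[/andP[N1N N2N] /andP[N3N N4N]].
have := Nk; rewrite {1}/N !geq_max => /andP[/andP[N1k N2k] /andP[N3k N4k]].
rewrite /ball /=.
have -> : e (u N) (w N) - e (u k) (w k) = e (u N - u k) (w N) + e (w N - w k) (u k).
  rewrite !(sfBl eF)// (sfC eF (Dw N) (Du k)) (sfC eF (Dw k) (Du k)); ring.
apply: le_lt_trans (ler_normD _ _) _.
have T1 : `|e (u N - u k) (w N)| <= eps / 3.
  apply: third (B3 _ _ N3N N3k) => //.
  apply: le_trans (cauchy_schwarz eF (sfB eF _ _) _) _ => //.
  by rewrite ler_wpM2l ?B2// (sf_ge0 eF)//; exact: (sfB eF).
have T2 : `|e (w N - w k) (u k)| <= eps / 3.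
  apply: third (B4 _ _ N4N N4k) => //.
  apply: le_trans (cauchy_schwarz eF (sfB eF _ _) _) _ => //.
  by rewrite ler_wpM2l ?B1// (sf_ge0 eF)//; exact: (sfB eF).
lra.
Qed.

Local Notation cl := (form_closure ip fm).

(** Frees the value from the choice made by [xget]: it can be computed along any approximating
    sequences, so every law of the closure is a law of [e] passed to the limit. *)
Lemma form_closureP u w f g (v : R) : form_approx ip fm u f -> form_approx ip fm w g ->
  (fun k => e (u k) (w k)) @ \oo --> v <-> fval cl f g = v.
Proof.
move=> uf wg.
have P (v' : R) : (fun k => e (u k) (w k)) @ \oo --> v' -> fval cl f g = v'.
  move=> uv; rewrite /=; apply: xget_unique => [|v'' [u' [w' [uf' wg' uv']]]].
    by exists u, w.
  have := form_limit_unique uf uf' wg wg' uv.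
  by move=> c; rewrite -(cvg_lim (@Rhausdorff R) c) -(cvg_lim (@Rhausdorff R) uv').
split=> [/P//|<-].
by have [v' uv'] := form_limit_exists uf wg; rewrite (P _ uv').
Qed.

Arguments form_closureP {u w f g v}.

Lemma form_closure_sform : sform (fdom cl) (fval cl).
Proof.
split.
- by exists (fun=> 0); exact: form_approx0.
- by move=> f g [u uf] [w wg]; eexists; exact: form_approxD uf wg.
- by move=> a f [u uf]; eexists; exact: form_approxZ uf.
- move=> f g [u uf] [w wg].
  have /(form_closureP uf wg) c := erefl (fval cl f g).
  apply/esym/(form_closureP wg uf).
  by under eq_fun do rewrite (sfC eF (let: And3 d _ _ := wg in d _) (let: And3 d _ _ := uf in d _)).
- move=> f g h [u uf] [w wg] [z zh].
  have [[Du _ _] [Dw _ _] [Dz _ _]] := And3 uf wg zh.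
  apply/(form_closureP (form_approxD uf wg) zh).
  under eq_fun do rewrite (sfDl eF (Du _) (Dw _) (Dz _)).
  by apply: cvgD; [exact/(form_closureP uf zh)|exact/(form_closureP wg zh)].
- move=> a f h [u uf] [z zh].
  have [[Du _ _] [Dz _ _]] := (conj uf zh).
  apply/(form_closureP (form_approxZ a uf) zh).
  under eq_fun do rewrite (sfZl eF a (Du _) (Dz _)).
  by apply: cvgMr; exact/(form_closureP uf zh).
- move=> f [u uf].
  have /(form_closureP uf uf) c := erefl (fval cl f f).
  rewrite -(cvg_lim (@Rhausdorff R) c); apply: limr_ge; first exact: cvgP c.
  by apply: nearW => k; apply: (sf_ge0 eF); case: uf.
Qed.

End form_limit.

(** * Galerkin approximation of resolvents *)

Section operators.
Context {R : realType} {V : lmodType R} (ip : V -> V -> R).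
Hypothesis H : hilbert ip.
Let F : sform setT ip := hil_form H.
Implicit Type T : set (V * V).

Lemma resolventE T (a : R) (f h : V) : 0 < a ->
  (forall g k g' k', T (g, k) -> T (g', k') -> 0 <= ip (g - g') (k - k')) ->
  T (f, h - a *: f) -> resolvent T a h = f.
Proof.
move=> a0 mono Tf; apply: xget_unique => // g Tg.
have := mono _ _ _ _ Tg Tf.
have -> : h - a *: g - (h - a *: f) = - a *: (g - f).
  by rewrite opprB addrC addrA subrK scaleNr scalerBr opprB.
rewrite (sfZr F)// mulNr oppr_ge0 pmulr_rle0// => le0.
apply/eqP; rewrite -subr_eq0; apply/eqP; apply: (hil_def H).
by apply/eqP; rewrite eq_le le0 (sf_ge0 F).
Qed.

(** Given [(g, k)] in the adjoint, surjectivity of [1 + T] yields [f] with [T f = k + g - f].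
    Testing against [f'] with [T f' = h - f'], for every [h], gives [f = g], so [(g, k)] is in
    [T]. *)
Lemma symmetric_self_adjoint T : densely ip (dom T) ->
  (forall f h g k, T (f, h) -> T (g, k) -> ip h g = ip f k) ->
  (forall h, exists f, T (f, h - f)) -> self_adjoint ip T.
Proof.
move=> dT sT oT; split => //; apply/seteqP; split=> [[g k] Tgk f h Tfh|[g k] /= Tgk].
  exact: sT Tfh Tgk.
have [f Tf] := oT (k + g).
suff fg : f = g by move: Tf; rewrite {1 2}fg addrK -fg.
apply: (ip_eq H) => h; have [f' Tf'] := oT h.
have := sT _ _ _ _ Tf' Tf; have := Tgk _ _ Tf'.
rewrite !(sfBl F)// !(sfBr F)// (sfDr F)//.
rewrite ![ip f' _](sfC F)// ![ip h _](sfC F)//; lra.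
Qed.

Lemma adjoint_form_bounded (A : V -> V) (C : R) (h : V) :
  sform setT (fun f g => ip f (A g)) -> (forall f, ip f (A f) <= C * ip f f) ->
  forall a, 0 < a -> exists f, A f = h - a *: f.
Proof.
move=> AF AC a a0.
have [//|f _ fP] := solve H h AF _ (fun g _ => AC g) a0.
exists f; apply: (ip_eq H) => g.
rewrite (sfBl F)// (sfZl F)// -(fP g I) addrAC subrr add0r.
by rewrite (sfC AF)// (sfC F).
Qed.

End operators.

Lemma small_cvg (R : realType) (x y : nat -> R) (v : R) :
  (forall k, `|x k - v| ^+ 2 <= y k) -> small y -> x @ \oo --> v.
Proof.
move=> xy ys; apply/cvgrPdist_lt => eps e0.
have [N NP] := ys (eps ^+ 2) ltac:(by rewrite exprn_gt0).
exists N => // k /= Nk; rewrite distrC -(@ltr_pXn2r _ 2)// ?nnegrE ?ltW//.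
exact: le_lt_trans (xy _) (NP _ Nk).
Qed.

Section galerkin.
Context {R : realType} {V : lmodType R} (ip : V -> V -> R).
Hypothesis H : hilbert ip.
Let F : sform setT ip := hil_form H.
(** In the application [D n] is [Hn n], [L n] is [level_op] with weight [kappa], [T n] is
    [scaled_An_op n] and [q] is [(2 * rho)^-1]. *)
Variables (D : nat -> set V) (L T : nat -> V -> V) (C q : R).
Hypothesis D_incr : forall n, D n `<=` D n.+1.
Hypothesis D_closed : forall n, closed_set ip (D n).
Hypothesis LD : forall n f, D n f -> D n (L n f).
Hypothesis LF : forall n, sform (D n) (fun f g => ip f (L n g)).
Hypothesis L_bounded : forall n, exists c, forall f, D n f -> ip f (L n f) <= c * ip f f.
Hypothesis TF : forall n, sform setT (fun f g => ip f (T n g)).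
Hypothesis T_bounded : forall n, exists c, forall f, ip f (T n f) <= c * ip f f.
Hypotheses (C0 : 0 <= C) (q0 : 0 <= q) (q1 : q < 1).
Hypothesis T_approx : forall n f, D n f -> forall eps, 0 < eps ->
  exists N0, forall N, (N0 <= N)%N ->
    ip (T N f - L n f) (T N f - L n f) <= C * q ^+ n * ip f (L n f) + eps.
Hypothesis D_dense : forall h eps, 0 < eps ->
  exists n p, D n p /\ ip (h - p) (h - p) < eps.
Variable fm : @Defs.form R V.
Hypothesis fdomE : fdom fm = \bigcup_n D n.
Hypothesis fvalE : forall n f g, D n f -> D n g -> fval fm f g = ip f (L n g).
Local Notation e := (fval fm).
Local Notation DD := (fdom fm).

Lemma D_le n k f : (n <= k)%N -> D n f -> D k f.
Proof.
by move=> /subnK <-; elim: (k - n)%N => // j IH /IH; rewrite addSn; exact: D_incr.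
Qed.

Lemma D_fdom n f : D n f -> DD f.
Proof. by move=> Df; rewrite fdomE; exists n. Qed.

Lemma galerkin_sform : sform DD e.
Proof.
have two f g : DD f -> DD g -> exists n, D n f /\ D n g.
  rewrite fdomE => -[n _ Df] [k _ Dg]; exists (maxn n k).
  by split; [apply: D_le Df; exact: leq_maxl|apply: D_le Dg; exact: leq_maxr].
have three f g h : DD f -> DD g -> DD h -> exists n, [/\ D n f, D n g & D n h].
  move=> Df Dg; have [n [{}Df {}Dg]] := two _ _ Df Dg.
  rewrite fdomE => -[k _ Dh]; exists (maxn n k).
  by split; [apply: D_le Df; exact: leq_maxl|apply: D_le Dg; exact: leq_maxl|apply: D_le Dh; exact: leq_maxr].
split.
- exact: D_fdom (sf0 (LF 0)).
- by move=> f g Df Dg; have [n [{}Df {}Dg]] := two _ _ Df Dg; exact: D_fdom (sfD (LF n) Df Dg).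
- by move=> a f; rewrite {1}fdomE => -[n _ Df]; exact: D_fdom (sfZ (LF n) a Df).
- move=> f g Df Dg; have [n [{}Df {}Dg]] := two _ _ Df Dg.
  by rewrite !(@fvalE n)// (sfC (LF n)).
- move=> f g h Df Dg Dh; have [n [{}Df {}Dg {}Dh]] := three _ _ _ Df Dg Dh.
  by rewrite !(@fvalE n)// ?(sfDl (LF n))//; exact: (sfD (LF n)).
- move=> a f g Df Dg; have [n [{}Df {}Dg]] := two _ _ Df Dg.
  by rewrite !(@fvalE n)// ?(sfZl (LF n))//; exact: (sfZ (LF n)).
- by move=> f; rewrite fdomE => -[n _ Df]; rewrite (@fvalE n)// (sf_ge0 (LF n)).
Qed.
Let eF := galerkin_sform.

(** If [h] is in [D n] and [j >= n], then [e h g = ip (L j h) g], so a bound on [L j h] uniform in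
    [j] suffices. Both [L n h] and [L j h] are close to the same [T N h] for large [N]; two uses of
    [|x + y|^2 <= 2 |x|^2 + 2 |y|^2] give the constant [c]. *)
Lemma galerkin_bounded h : DD h ->
  exists2 c, 0 <= c & forall g, DD g -> e h g ^+ 2 <= c * ip g g.
Proof.
rewrite {1}fdomE => -[n _ Dh].
have e0 : 0 <= e h h by apply: (sf_ge0 eF); exact: D_fdom Dh.
pose c := 2 * ip (L n h) (L n h) + 4 * (2 * C * e h h + 2).
have n0 : 0 <= ip (L n h) (L n h) by exact: (sf_ge0 F).
have Ce : 0 <= C * e h h by exact: mulr_ge0.
have c0 : 0 <= c by rewrite /c; lra.
exists c => // g; rewrite fdomE => -[k _ Dg].
pose j := maxn n k.
have Dhj : D j h by apply: D_le Dh; exact: leq_maxl.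
have Dgj : D j g by apply: D_le Dg; exact: leq_maxr.
rewrite (fvalE Dhj Dgj) (sfC (LF j))//.
apply: le_trans (cauchy_schwarz F I I) _; rewrite mulrC ler_wpM2r ?(sf_ge0 F)//.
have [N1 H1] := T_approx Dh ltr01; have [N2 H2] := T_approx Dhj ltr01.
have {}H1 := H1 _ (leq_maxl N1 N2); have {}H2 := H2 _ (leq_maxr N1 N2).
rewrite -(fvalE Dh Dh) in H1; rewrite -(fvalE Dhj Dhj) in H2.
have A1 := sf_sqrD_le F (I : setT (L n h)) (I : setT (L j h - L n h)).
rewrite [X in ip X X]addrC subrK in A1.
have A2 := sf_sqrB_le F (g := T (maxn N1 N2) h) (I : setT (L j h)) I (I : setT (L n h)).
rewrite (sf_sym F (I : setT (L j h)) (I : setT (T _ h))) in A2.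
have Q m : C * q ^+ m * e h h <= C * e h h.
  by rewrite ler_wpM2r// ler_piMr// exprn_ile1// ltW.
have := Q n; have := Q j; rewrite /c; lra.
Qed.
Let e_bnd := galerkin_bounded.

Section solution.
Variables (a : R) (h : V).
Hypothesis a0 : 0 < a.

Lemma galerkin_exists : exists G : nat -> V, (forall n, D n (G n)) /\
  forall n g, D n g -> a * ip (G n) g + e (G n) g = ip h g.
Proof.
have P n : exists f, D n f /\ forall g, D n g -> a * ip f g + e f g = ip h g.
  have [c cP] := L_bounded n.
  have [f Df fP] := solve H h (LF n) (@D_closed n) cP a0.
  by exists f; split => // g Dg; rewrite (@fvalE n)// fP.
have [G GP] := choice P; exists G.
by split=> n; have [] := GP n.
Qed.

Variable G : nat -> V.
Hypothesis DG : forall n, D n (G n).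
Hypothesis GP : forall n g, D n g -> a * ip (G n) g + e (G n) g = ip h g.

Let DDG n : DD (G n) := D_fdom (DG n).

(** Galerkin orthogonality: [G n] is the projection of [G k] on [D n] for the form [a ip + e], and
    the identity is Pythagoras. *)
Lemma galerkin_energy n k : (n <= k)%N ->
  a * ip (G k - G n) (G k - G n) + e (G k - G n) (G k - G n) = ip h (G k) - ip h (G n).
Proof.
move=> nk; have DGn : D k (G n) by exact: D_le nk (DG n).
rewrite (sf_sqrB F)// (sf_sqrB eF)//.
have := GP (DG n); have := GP (DG k); have := GP DGn.
lra.
Qed.

Lemma galerkin_le n : ip h (G n) <= ip h h / a.
Proof.
have := GP (DG n); have := sf_ge0 eF (DDG n); have := sf_ge0 F (I : setT (G n)).
have := cauchy_schwarz F (I : setT h) (I : setT (G n)); have := sf_ge0 F (I : setT h).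
rewrite ler_pdivlMr//.
move: (ip h h) (ip h (G n)) (ip (G n) (G n)) (e _ _) => hh x y z hh0 CS y0 z0 E.
have x0 : 0 <= x by rewrite -E addr_ge0// mulr_ge0// ltW.
have := x0; rewrite le_eqVlt => /orP[/eqP <-|xpos]; first by rewrite mul0r.
rewrite -(ler_pM2l xpos).
have : a * x ^+ 2 <= hh * (a * y) by rewrite [leRHS]mulrCA ler_pM2l.
have : hh * (a * y) <= hh * x by rewrite ler_wpM2l//; lra.
nra.
Qed.

(** By [galerkin_energy] the increments of [ip h (G n)] are the squared distances in question; this
    sequence is nondecreasing and bounded, hence Cauchy. *)
Lemma galerkin_cauchy eps : 0 < eps -> exists N, forall n k, (N <= n)%N -> (N <= k)%N ->
  a * ip (G n - G k) (G n - G k) + e (G n - G k) (G n - G k) < eps.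
Proof.
move=> e0; pose s n := ip h (G n).
have s_nd : nondecreasing_seq s.
  move=> n k nk; rewrite -subr_ge0 -galerkin_energy//.
  by rewrite addr_ge0 ?mulr_ge0 ?(ltW a0) ?(sf_ge0 F)// (sf_ge0 eF)//; exact: (sfB eF).
have sc : cvgn s.
  apply: nondecreasing_is_cvgn => //.
  by exists (ip h h / a) => _ [n _ <-]; exact: galerkin_le.
have [N _ NP] := (cvgrPdist_lt _ _).1 sc _ (divr_gt0 e0 (ltr0n _ 2)).
have sle n : s n <= limn s by exact: nondecreasing_cvgn_le.
exists N => n k Nn Nk.
wlog nk : n k Nn Nk / (k <= n)%N => [W|].
  have [/W|/ltnW/W] := leqP k n; first exact.
  by rewrite (sf_sym F)// (sf_sym eF)//; exact.
rewrite galerkin_energy// -/(s n) -/(s k).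
by have := NP _ Nk; rewrite /= ger0_norm ?subr_ge0//; have := sle n; lra.
Qed.

Lemma galerkin_limit : exists f,
  [/\ form_approx ip fm G f & form_op ip (form_closure ip fm) (f, h - a *: f)].
Proof.
have Gc : cauchy_seq ip G.
  move=> eps e0; have [N NP] := galerkin_cauchy (mulr_gt0 a0 e0).
  exists N => k l Nk Nl; rewrite -(ltr_pM2l a0); apply: le_lt_trans (NP _ _ Nk Nl).
  by rewrite lerDl (sf_ge0 eF)//; exact: (sfB eF).
have Ge : cauchy_seq e G.
  move=> eps /galerkin_cauchy[N NP].
  exists N => k l Nk Nl; apply: le_lt_trans (NP _ _ Nk Nl).
  by rewrite lerDr mulr_ge0 ?(sf_ge0 F)// ltW.
have [f _ Gf] := hil_complete H (fun k => I) Gc.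
have Gaf : form_approx ip fm G f by apply/form_approxP.
exists f; split => //; split=> [|g [w wg]]; first by exists G.
have [Dw wgs wc] := (form_approxP _ _ _ _).1 wg.
apply/(form_closureP H eF e_bnd _ Gaf wg).
have lim2 : (fun k => ip (h - a *: f) (w k)) @ \oo --> ip (h - a *: f) g.
  apply: (@small_cvg _ _ (fun k => ip (h - a *: f) (h - a *: f) * ip (w k - g) (w k - g))).
    move=> k; rewrite real_normK ?num_real// -(sfBr F)//; exact: (cauchy_schwarz F I I).
  move=> eps e0.
  have p1 : 0 < ip (h - a *: f) (h - a *: f) + 1 by rewrite ltr_wpDl// (sf_ge0 F).
  have [N NP] := wgs _ (divr_gt0 e0 p1).
  exists N => k /NP; rewrite ltr_pdivlMr//.
  by have := sf_ge0 F (I : setT (w k - g)); nra.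
rewrite -[X in _ --> X]add0r.
have -> : (fun k => e (G k) (w k)) =
   (fun k => (e (G k) (w k) - ip (h - a *: f) (w k)) + ip (h - a *: f) (w k)).
  by apply/funext => k; rewrite subrK.
apply: cvgD lim2.
have [M M0 [N1 B1]] := cauchy_seq_bounded eF Dw wc.
have [N2 B2] : exists N, forall k, (N <= k)%N -> ip (w k) (w k) <= 2 * ip g g + 2.
  have [N NP] := wgs 1 ltr01; exists N => k /NP.
  have := sf_sqrD_le F (I : setT (w k - g)) (I : setT g); rewrite subrK; lra.
apply/cvgr0Pnorm_lt => eps e0.
pose d := eps / 3.
have d0 : 0 < d by rewrite divr_gt0.
have [N3 B3] := Ge (d ^+ 2 / M) ltac:(by rewrite divr_gt0 ?exprn_gt0).
have g0 : 0 < 2 * ip g g + 2 by rewrite ltr_wpDl// mulr_ge0// (sf_ge0 F).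
have [N4 B4] := Gf (d ^+ 2 / (a ^+ 2 * (2 * ip g g + 2)))
  ltac:(by rewrite divr_gt0 ?exprn_gt0// mulr_gt0// exprn_gt0).
exists (maxn (maxn N1 N2) (maxn N3 N4)) => // k /=.
rewrite !geq_max => /andP[/andP[/B1{}B1 /B2{}B2] /andP[N3k N4k]].
(* The level [j] of [w k] is not controlled by [k], so the Galerkin equation is tested with [w k] at
   a level [n >= j], and [G n] is compared with [G k] by the Cauchy property. *)
have [j Dwj] : exists j, D j (w k) by have := Dw k; rewrite fdomE => -[j _]; exists j.
pose n := maxn (maxn N3 N4) j.
have Dwn : D n (w k) by apply: D_le Dwj; exact: leq_maxr.
have N3n : (N3 <= n)%N by rewrite /n !leq_max leqnn.
have N4n : (N4 <= n)%N by rewrite /n !leq_max leqnn orbT.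
have -> : e (G k) (w k) - ip (h - a *: f) (w k) =
    e (G k - G n) (w k) - a * ip (G n - f) (w k).
  rewrite (sfBl eF)// !(sfBl F)// (sfZl F)//.
  by have := GP Dwn; lra.
have root (x : R) : x ^+ 2 <= d ^+ 2 -> `|x| <= d.
  by move=> xd; rewrite -(@ler_pXn2r _ 2)// ?nnegrE// ?(ltW d0)// real_normK ?num_real.
have E1 : `|e (G k - G n) (w k)| <= d.
  apply: root; apply: le_trans (cauchy_schwarz eF (sfB eF (DDG k) (DDG n)) (Dw k)) _.
  have := B3 _ _ N3k N3n; rewrite ltr_pdivlMr// => /ltW; apply: le_trans.
  by rewrite ler_wpM2l// (sf_ge0 eF)//; exact: (sfB eF).
have E2 : `|a * ip (G n - f) (w k)| <= d.
  apply: root; rewrite exprMn.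
  have := B4 _ N4n; rewrite ltr_pdivlMr ?mulr_gt0 ?exprn_gt0// => /ltW; apply: le_trans.
  rewrite [leRHS]mulrCA ler_wpM2l ?sqr_ge0//; apply: le_trans (cauchy_schwarz F I I) _.
  by rewrite ler_wpM2l// (sf_ge0 F).
by apply: le_lt_trans (ler_normB _ _) _; rewrite /d in d0 E1 E2; lra.
Qed.

(** Since [T N] is non-negative, [a |r - f| <= |w|], where [w] is the residual of [f = G n] in the
    equation that [r] solves. The residual splits into the one for [L n] and the error
    [T N f - L n f], whose energy term is bounded by [galerkin_le]. *)
Lemma galerkin_residual n eps : 0 < eps -> exists N0, forall N r, (N0 <= N)%N ->
  T N r = h - a *: r ->
  a ^+ 2 * ip (r - G n) (r - G n) <= 2 * ip (h - (a *: G n + L n (G n))) (h - (a *: G n + L n (G n)))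
    + 2 * (C * q ^+ n * (ip h h / a)) + eps.
Proof.
move=> e0; have [N0 NP] := T_approx (DG n) (divr_gt0 e0 (ltr0n _ 2)).
exists N0 => N r /NP{}NP Tr.
pose f := G n; pose d := r - f; pose w := h - (a *: f + T N f).
have E1 : ip d (T N d) = ip d (T N r) - ip d (T N f) := sfBr (TF N) I I I.
have dd : 0 <= ip d (T N d) by exact: (sf_ge0 (TF N)).
have dw : a * ip d d <= ip d w.
  have E2 : ip d d = ip d r - ip d f by rewrite {2}/d (sfBr F).
  have E3 : ip d w = ip d h - (a * ip d f + ip d (T N f)).
    by rewrite /w (sfBr F)// (sfDr F)// (sfZr F).
  have E4 : ip d (T N r) = ip d h - a * ip d r by rewrite Tr (sfBr F)// (sfZr F).
  by rewrite E3 E2; rewrite E4 in E1; lra.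
have aw : a ^+ 2 * ip d d <= ip w w.
  have := cauchy_schwarz F (I : setT d) (I : setT w).
  have := sf_ge0 F (I : setT d); have := sf_ge0 F (I : setT w).
  move: (ip d d) (ip w w) (ip d w) dw => x ww y xy w0.
  rewrite le_eqVlt => /orP[/eqP <-|x0]; first by rewrite mulr0.
  move=> yw; rewrite -(ler_pM2l x0); apply: le_trans yw.
  have -> : x * (a ^+ 2 * x) = (a * x) ^+ 2 by ring.
  rewrite ler_pXn2r// nnegrE; [by rewrite mulr_ge0// ltW|].
  by apply: le_trans xy; rewrite mulr_ge0// ltW.
apply: (le_trans aw).
have -> : w = (h - (a *: f + L n f)) + - (T N f - L n f).
  by rewrite /w opprB !opprD !addrA subrK.
apply: le_trans (sf_sqrD_le F I I) _; rewrite (sf_sqrN F)//.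
have fL : ip f (L n f) <= ip h h / a.
  apply: le_trans (galerkin_le n); rewrite -(GP (DG n)) -/f (fvalE (DG n) (DG n)).
  by rewrite lerDr mulr_ge0 ?(sf_ge0 F)// ltW.
have : C * q ^+ n * ip f (L n f) <= C * q ^+ n * (ip h h / a).
  by rewrite ler_wpM2l// mulr_ge0// exprn_ge0.
by move: NP; rewrite -/f; lra.
Qed.

(** Thus [a *: G n + L n (G n)], which lies in [D n] by [LD], is the projection of [h] on [D n], and
    the residual has the length of the distance from [h] to [D n]. *)
Lemma galerkin_orth n g : D n g -> ip (h - (a *: G n + L n (G n))) g = 0.
Proof.
move=> Dg; have := GP Dg; rewrite (fvalE (DG n) Dg) (sfC (LF n))//.
by rewrite (sfBl F)// (sfDl F)// (sfZl F)// [ip (L n _) g](sfC F)//; lra.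
Qed.

Lemma resolvent_cvg (r : nat -> V) f : (forall N, T N (r N) = h - a *: r N) ->
  form_approx ip fm G f -> small (fun N => ip (r N - f) (r N - f)).
Proof.
move=> Tr /form_approxP[_ Gf _] eps e0.
have a20 : 0 < a ^+ 2 by rewrite exprn_gt0.
(* The terms of [galerkin_residual] add up to less than [5 * d], hence [|r N - G n|^2 < 5/16 eps];
   with [eps / 8] for [|G n - f|^2] the total stays below [14/16 eps]. *)
pose d := a ^+ 2 * eps / 16.
have d0 : 0 < d by rewrite divr_gt0 ?mulr_gt0.
have [N1 [p [Dp hp]]] := D_dense h d0.
have [N2 B2] := Gf (eps / 8) ltac:(by rewrite divr_gt0).
have [N3 B3] : exists N, forall n, (N <= n)%N -> C * q ^+ n * (ip h h / a) < d.
  have : (fun n => C * (ip h h / a) * q ^+ n) @ \oo --> C * (ip h h / a) * 0.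
    by apply: cvgMr; apply: cvg_expr; rewrite ger0_norm.
  rewrite mulr0 => /cvgr0Pnorm_lt /(_ _ d0)[N _ NP]; exists N => n Nn.
  have := NP n Nn; rewrite /= ger0_norm; first by rewrite mulrAC.
  by rewrite mulr_ge0 ?exprn_ge0// mulr_ge0// divr_ge0 ?(sf_ge0 F)// ltW.
pose n := maxn N1 (maxn N2 N3).
have {}Dp : D n p by apply: D_le Dp; exact: leq_maxl.
have {}B2 := B2 n; rewrite /= !leq_max leqnn orbT in B2; have {}B2 := B2 isT.
have {}B3 := B3 n; rewrite /= !leq_max leqnn !orbT in B3; have {}B3 := B3 isT.
have [N0 NP] := galerkin_residual n d0.
exists N0 => N N0N; have {}NP := NP N (r N) N0N (Tr N).
have BA : ip (h - (a *: G n + L n (G n))) (h - (a *: G n + L n (G n))) < d.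
  apply: le_lt_trans hp; apply: (best_approx H (D := D n)); first exact: galerkin_orth.
  have nG := DG n; apply: (sfB (LF n)) => //; apply: (sfD (LF n)); [exact: (sfZ (LF n))|exact: LD].
apply: le_lt_trans (sf_sqrB_le F (g := G n) I I I) _.
suff : ip (r N - G n) (r N - G n) < 5 / 16 * eps by lra.
rewrite -(ltr_pM2l a20); apply: le_lt_trans NP _.
rewrite /d in BA B3 *; lra.
Qed.

End solution.

Let cF := form_closure_sform H eF e_bnd.
Local Notation Tinf := (form_op ip (form_closure ip fm)).

Lemma form_op_exists a h : 0 < a -> exists f, Tinf (f, h - a *: f).
Proof.
move=> a0; have [G [DG GP]] := galerkin_exists h a0.
by have [f [_ fP]] := galerkin_limit a0 DG GP; exists f.
Qed.

Lemma form_op_monotone g k g' k' : Tinf (g, k) -> Tinf (g', k') ->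
  0 <= ip (g - g') (k - k').
Proof.
move=> [/= Dg gP] [/= Dg' gP']; have Dgg := sfB cF Dg Dg'.
rewrite (sfC F)// (sfBl F)// -gP// -gP'//.
by have := sf_ge0 cF Dgg; rewrite (sfBl cF Dg Dg' Dgg).
Qed.

Lemma form_op_nonneg : nonneg_op ip Tinf.
Proof.
move=> f k [/= Df fP]; rewrite (sfC F)// -fP//; exact: (sf_ge0 cF).
Qed.

Lemma fdom_closure f : DD f -> fdom (form_closure ip fm) f.
Proof.
move=> Df; exists (fun=> f); apply/form_approxP; split => // [eps e0|eps e0]; exists 0%N => *.
  by rewrite subrr (sf0l F).
by rewrite subrr (sf0l eF)//; exact: (sf0 eF).
Qed.

(** For [p] in the form domain and [T] the operator of the closure, [g = a (a + T)^-1 p] satisfies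
    [4 a |p - g|^2 <= b], where [b] is the energy of [p]. So [g] tends to [p] as [a] grows, and the
    form domain is dense by [D_dense]. *)
Lemma form_op_dense : densely ip (dom Tinf).
Proof.
move=> f eps e0.
have e20 : 0 < eps ^+ 2 / 4 by rewrite divr_gt0 ?exprn_gt0.
have [n [p [Dp fp]]] := D_dense f e20.
have {Dp}Dp : fdom (form_closure ip fm) p by apply: fdom_closure; exact: D_fdom Dp.
set b := fval (form_closure ip fm) p p.
have b0 : 0 <= b by exact: (sf_ge0 cF).
pose a := (b + 1) / (eps ^+ 2).
have a0 : 0 < a by rewrite divr_gt0 ?exprn_gt0// ltr_wpDl.
have [g /= [Dg gP]] := form_op_exists (a *: p) a0.
exists g; first by exists (a *: p - a *: g).
rewrite /hnorm -(@ger0_norm _ eps) ?ltW// -sqrtr_sqr ltr_sqrt ?exprn_gt0//.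
pose d := p - g; have Dd : fdom (form_closure ip fm) d by exact: (sfB cF).
have E : fval (form_closure ip fm) g d = a * ip d d.
  by rewrite gP//= -scalerBr (sfZl F).
have dE : fval (form_closure ip fm) g d =
    fval (form_closure ip fm) p d - fval (form_closure ip fm) d d.
  by rewrite {4}/d (sfBl cF)// opprB addrC subrK.
have pd : 4 * a * ip d d <= b.
  have := cauchy_schwarz cF Dp Dd; have := sf_ge0 cF Dd; rewrite -/b.
  move: dE; rewrite E; move: (fval _ p d) (fval _ d d) => x y xy y0 CS.
  have : x <= b / 4 + y.
    rewrite leNgt; apply/negP => lt.
    have by0 : 0 <= b / 4 + y by rewrite addr_ge0// divr_ge0.
    have : (b / 4 + y) ^+ 2 < x ^+ 2 by rewrite ltr_pXn2r// nnegrE// ltW// (le_lt_trans by0).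
    by have := sqr_ge0 (b / 4 - y); nra.
  by lra.
apply: le_lt_trans (sf_sqrB_le F (g := p) I I I) _; rewrite -/d.
have : 4 * ip d d < eps ^+ 2.
  rewrite -(ltr_pM2l a0); have -> : a * eps ^+ 2 = b + 1.
    by rewrite /a divfK// gt_eqF// exprn_gt0.
  by move: pd; lra.
by move: fp; lra.
Qed.

Lemma form_op_self_adjoint : self_adjoint ip Tinf.
Proof.
apply: (symmetric_self_adjoint H) form_op_dense _ _ => [f h g k [/= Df fP] [/= Dg gP]|h].
  by rewrite -fP// (sfC F)// -gP//; exact: (sfC cF Df Dg).
by have [f fP] := form_op_exists h ltr01; exists f; rewrite -{2}(scale1r f).
Qed.

Theorem galerkin_strong_resolvent :
  strong_resolvent_cvg ip (fun N => [set fg | fg.2 = T N fg.1]) Tinf.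
Proof.
have Tsol N h a : 0 < a -> exists f, T N f = h - a *: f.
  by move=> a0; have [c cP] := T_bounded N; exact: (adjoint_form_bounded H h (TF N) cP a0).
split => [N||a h a0].
- split=> [|f k /= ->]; last exact: (sf_ge0 (TF N)).
  apply: (symmetric_self_adjoint H) => [f eps e0|f h g k /= -> ->|h].
  + exists f; first by exists (T N f).
    by rewrite subrr /hnorm (sf0l F)// sqrtr0.
  + by rewrite (sfC F)// (sfC (TF N)).
  + by have [f fP] := Tsol N h 1 ltr01; exists f; rewrite /= fP scale1r.
- by split; [exact: form_op_self_adjoint|exact: form_op_nonneg].
- have [G [DG GP]] := galerkin_exists h a0.
  have [f [Gf fP]] := galerkin_limit a0 DG GP.
  rewrite (resolventE H a0 form_op_monotone fP).
  have [r rP] := choice (fun N => Tsol N h a a0).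
  have rE N : resolvent [set fg | fg.2 = T N fg.1] a h = r N.
    apply: (resolventE H a0) => [g k g' k' /= -> ->|]; last by rewrite /= rP.
    have := sf_ge0 (TF N) (I : setT (g - g')).
    by rewrite (sfBr (TF N))// (sfBr F).
  under eq_fun do rewrite rE.
  by apply/hnorm_cvg0; exact: resolvent_cvg rP Gf.
Qed.

End galerkin.

(** * The Hilbert space L2 *)

Section L2_hilbert.
Context d (T : measurableType d) (R : realType) (m : {measure set T -> \bar R}).
Implicit Types (f g : T -> R) (h k : L2 m).

Definition sqint f : Prop :=
  measurable_fun setT f /\ (\int[m]_x ((f x) ^+ 2)%:E < +oo)%E.

Lemma sqintP f : sqint f <-> f \in Lfun m 2%:E.
Proof.
have E : (\int[m]_x (`|f x| `^ 2)%:E = \int[m]_x ((f x) ^+ 2)%:E)%E.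
  by apply: eq_integral => x _; rewrite powR_mulrn// real_normK ?num_real.
split=> [[mf fi]|].
  rewrite inE; apply/andP; split; rewrite inE//= /finite_norm unlock.
  rewrite (_ : (fun _ => _) = (fun x => (`|f x| `^ 2)%:E)) ?E; last exact/funext.
  by apply: poweR_lty.
move=> fL; split; first by move: fL; rewrite inE => /andP[]; rewrite !inE.
have /integrableP[_] := Lfun2_integrable_sqr fL.
congr (_ < _)%E; apply: eq_integral => x _ /=.
by rewrite ger0_norm ?sqr_ge0.
Qed.

Lemma sqintM f g : sqint f -> sqint g -> m.-integrable setT (fun x => (f x * g x)%:E).
Proof. by move=> /sqintP fL /sqintP gL; apply/Lfun1_integrable/Lfun2_mul_Lfun1. Qed.

Lemma sqint_repr h : sqint (L2_repr h).
Proof. exact/sqintP/LfunP. Qed.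

Lemma sqintD f g : sqint f -> sqint g -> sqint (fun x => f x + g x).
Proof.
move=> /sqintP fL /sqintP gL; apply/sqintP.
have := LfunP (Lfun_Sub (lee1n 2) fL + Lfun_Sub (lee1n 2) gL : LfunType m (lee1n 2)).
exact.
Qed.

Lemma sqintZ a f : sqint f -> sqint (fun x => a * f x).
Proof.
move=> /sqintP fL; apply/sqintP.
have := LfunP (a *: Lfun_Sub (lee1n 2) fL : LfunType m (lee1n 2)).
exact.
Qed.

Lemma sqint0 : sqint (fun=> 0).
Proof. by apply/sqintP; have := LfunP (0 : LfunType m (lee1n 2)); exact. Qed.

Lemma sqint_sum (I : Type) (r : seq I) (F : I -> T -> R) :
  (forall i, sqint (F i)) -> sqint (fun x => \sum_(i <- r) F i x).
Proof.
move=> Fi; elim: r => [|i r IH].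
  by under eq_fun do rewrite big_nil; exact: sqint0.
by under eq_fun do rewrite big_cons; exact: sqintD.
Qed.

Lemma sqint_le f g : measurable_fun setT f -> sqint g ->
  (forall x, f x ^+ 2 <= g x ^+ 2) -> sqint f.
Proof.
move=> mf [mg gi] fg; split => //; apply: le_lt_trans gi.
apply: ge0_le_integral => //; try by move=> x _; rewrite lee_fin ?sqr_ge0.
all: by apply/measurable_EFinP; exact: measurable_funX.
Qed.

Lemma represents_ex f : sqint f -> exists h, represents f h.
Proof.
move=> /sqintP fL; exists (L2_class (Lfun_Sub (lee1n 2) fL : LfunType m (lee1n 2))).
exact: (represents_class (Lfun_Sub (lee1n 2) fL)).
Qed.

Lemma represents_repr h : represents (L2_repr h : T -> R) h.
Proof. by apply: filterS filterT => x. Qed.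

Lemma represents_sqint f h : measurable_fun setT f -> represents f h -> sqint f.
Proof.
move=> mf fh; split => //; have [mh hi] := sqint_repr h.
apply: le_lt_trans hi; rewrite le_eqVlt; apply/orP; left; apply/eqP.
apply: ge0_ae_eq_integral => //; try by move=> x _; rewrite lee_fin ?sqr_ge0.
- by apply/measurable_EFinP; exact: measurable_funX.
- by apply/measurable_EFinP; exact: measurable_funX.
- by apply: filterS fh => x /(_ I) -> _.
Qed.

Lemma represents_unique f g h k : represents f h -> represents g k ->
  f = g %[ae m] -> h = k.
Proof.
move=> fh gk fg; rewrite -(L2_reprK h) -(L2_reprK k); apply/L2_class_eq/ae0P.
apply: filterS3 fh gk fg => x /(_ I) fh /(_ I) gk /(_ I) fg _.
by rewrite -[LHS]/(L2_repr h x - L2_repr k x) -fh -gk fg subrr.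
Qed.

Lemma represents_eq f g h k : represents f h -> represents g k -> f =1 g -> h = k.
Proof.
by move=> fh gk /funext fg; apply: (represents_unique fh gk); rewrite fg; exact: aeW.
Qed.

Lemma representsD f g h k : represents f h -> represents g k ->
  represents (fun x => f x + g x) (h + k).
Proof.
move=> fh gk; have := represents_class (L2_repr h + L2_repr k).
rewrite L2_classD !L2_reprK; apply: filterS3 fh gk => x /(_ I) fh /(_ I) gk /(_ I) <- _.
by rewrite fh gk.
Qed.

Lemma representsZ a f h : represents f h -> represents (fun x => a * f x) (a *: h).
Proof.
move=> fh; have := represents_class (a *: L2_repr h).
rewrite -L2_scale_class L2_reprK; apply: filterS2 fh => x /(_ I) fh /(_ I) <- _.
by rewrite fh.
Qed.

Lemma represents0 : represents (fun=> 0) (0 : L2 m).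
Proof.
have := representsZ 0 (represents_repr (0 : L2 m)); rewrite scale0r.
by under eq_fun do rewrite mul0r.
Qed.

Lemma representsB f g h k : represents f h -> represents g k ->
  represents (fun x => f x - g x) (h - k).
Proof.
move=> fh gk; have := representsD fh (representsZ (-1) gk).
by rewrite scaleN1r; under eq_fun do rewrite mulN1r.
Qed.

Lemma L2_ipE f g h k : measurable_fun setT f -> measurable_fun setT g ->
  represents f h -> represents g k -> L2_ip m h k = \int[m]_x (f x * g x).
Proof.
move=> mf mg fh gk; rewrite /L2_ip /Rintegral; congr fine.
have [mh _] := sqint_repr h; have [mk _] := sqint_repr k.
apply: ae_eq_integral => //.
- by apply/measurable_EFinP; exact: measurable_funM.
- by apply/measurable_EFinP; exact: measurable_funM.
- by apply: filterS2 fh gk => x /(_ I) -> /(_ I) -> _.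
Qed.

Lemma L2_ip_sform : sform setT (L2_ip m).
Proof.
have mr h := (sqint_repr h).1.
split => //.
- by move=> f g _ _; rewrite /L2_ip; under eq_Rintegral do rewrite mulrC.
- move=> f g h _ _ _.
  rewrite (L2_ipE (sqintD (sqint_repr f) (sqint_repr g)).1 (mr h)
    (representsD (represents_repr f) (represents_repr g)) (represents_repr h)).
  under eq_Rintegral do rewrite mulrDl.
  by rewrite RintegralD//; apply: sqintM; exact: sqint_repr.
- move=> a f h _ _.
  rewrite (L2_ipE (sqintZ a (sqint_repr f)).1 (mr h)
    (representsZ a (represents_repr f)) (represents_repr h)).
  under eq_Rintegral do rewrite -mulrA.
  by rewrite RintegralZl//; apply: sqintM; exact: sqint_repr.
- by move=> f _; apply: Rintegral_ge0 => x _; rewrite -expr2 sqr_ge0.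
Qed.

Lemma L2_ip_norm f h : measurable_fun setT f -> represents f h ->
  ((L2_ip m h h)%:E = \int[m]_x ((f x) ^+ 2)%:E)%E.
Proof.
move=> mf fh; rewrite (L2_ipE mf mf fh fh) /Rintegral.
have [_ fi] := represents_sqint mf fh.
rewrite fineK; first by apply: eq_integral => x _; rewrite expr2.
rewrite ge0_fin_numE.
  by move: fi; under eq_integral do rewrite expr2.
by apply: integral_ge0 => x _; rewrite lee_fin -expr2 sqr_ge0.
Qed.

Lemma L2_ip_def h : L2_ip m h h = 0 -> h = 0.
Proof.
move=> h0; have [mh _] := sqint_repr h.
have := L2_ip_norm mh (represents_repr h); rewrite h0 => /esym i0.
apply: (represents_unique (represents_repr h) represents0).
have := @ae_eq_integral_abs _ _ _ m setT measurableT (fun x => ((L2_repr h x) ^+ 2)%:E).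
case=> [|H _].
  by apply/measurable_EFinP; exact: measurable_funX.
have {H} : ae_eq m setT (fun x => ((L2_repr h x) ^+ 2)%:E) (cst 0%E).
  apply: H; rewrite -[RHS]i0; apply: eq_integral => x _.
  by rewrite /= ger0_norm// sqr_ge0.
apply: filterS => x /(_ I) [] /eqP; rewrite sqrf_eq0 => /eqP -> _ //.
Qed.

End L2_hilbert.

(** * Completeness of L2 *)

Lemma geometric_half_le (R : realType) n : \sum_(0 <= k < n) (2^-1 : R) ^+ k <= 2.
Proof.
suff -> : \sum_(0 <= k < n) (2^-1 : R) ^+ k = 2 - 2 * 2^-1 ^+ n.
  by rewrite gerBl mulr_ge0// exprn_ge0.
elim: n => [|n IH]; first by rewrite big_geq// expr0 mulr1 subrr.
by rewrite big_nat_recr//= IH exprS; field.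
Qed.

(** The inequality [|x| <= 2^-k + 2^k x^2] turns weighted square summability of the increments into
    absolute summability, pointwise and without Minkowski's inequality. *)
Lemma cvgn_of_square_sums (R : realType) (s : nat -> R) (M : R) :
  (forall n, \sum_(0 <= k < n) 2 ^+ k * (s k.+1 - s k) ^+ 2 <= M) -> cvgn s.
Proof.
move=> sM.
have c : cvgn (series (telescope s)).
  apply: normed_cvg; apply: nondecreasing_is_cvgn.
    by apply: nondecreasing_series => k _ _ /=.
  exists (2 + M) => _ [n _ <-] /=.
  apply: le_trans (lerD (geometric_half_le R n) (sM n)).
  rewrite -big_split/= /series/=; apply: ler_sum => k _.
  rewrite /telescope; set x := s k.+1 - s k.
  have p0 : 0 < 2 ^+ k :> R by rewrite exprn_gt0.
  rewrite exprVn -[x ^+ 2]real_normK ?num_real//.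
  have n0 := normr_ge0 x; move: `|x| n0 => y y0.
  rewrite -(ler_pM2l p0) mulrDr mulfV ?gt_eqF//.
  have := sqr_ge0 (1 - 2 ^+ k * y); nra.
have -> : s = (fun n => series (telescope s) n + s 0%N).
  by apply/funext => n; rewrite telescopeK/= subrK.
by apply: is_cvgD c _; exact: is_cvg_cst.
Qed.

Section riesz_fischer.
Context d (T : measurableType d) (R : realType) (m : {measure set T -> \bar R}).

(** The weights [2^k] of [cvgn_of_square_sums] reduce the rate [4^-k] to [2^-k], still summable; the
    weighted sum [D] is therefore integrable, hence finite almost everywhere. *)
Lemma ae_cvg_of_sqint (g : nat -> T -> R) : (forall n, measurable_fun setT (g n)) ->
  (forall k, (\int[m]_x ((g k.+1 x - g k x) ^+ 2)%:E <= (4^-1 ^+ k)%:E)%E) ->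
  {ae m, forall x, cvgn (g ^~ x)}.
Proof.
move=> mg g4.
pose t k x := 2 ^+ k * (g k.+1 x - g k x) ^+ 2.
have mt k : measurable_fun setT (t k).
  by apply: measurable_funM => //; apply: measurable_funX; exact: measurable_funB.
have t0 k x : (0 <= (t k x)%:E)%E by rewrite lee_fin /t pmulr_rge0 ?exprn_gt0// sqr_ge0.
have mte k : measurable_fun setT (fun x => (t k x)%:E) by exact/measurable_EFinP.
have ti k : (\int[m]_x (t k x)%:E <= (2^-1 ^+ k)%:E)%E.
  under eq_integral do rewrite EFinM.
  rewrite ge0_integralZl//; first last.
  - by move=> x _; rewrite lee_fin sqr_ge0.
  - by apply/measurable_EFinP; apply: measurable_funX; exact: measurable_funB.
  apply: (@le_trans _ _ ((2 ^+ k)%:E * (4^-1 ^+ k)%:E)%E).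
    by rewrite lee_pmul2l// lte_fin exprn_gt0.
  rewrite -EFinM lee_fin -exprMn; have -> : 2 * 4^-1 = 2^-1 :> R by field.
  exact: lexx.
pose D x := (\sum_(0 <= k <oo) (t k x)%:E)%E.
have D0 x : (0 <= D x)%E by apply: nneseries_ge0.
have mD : measurable_fun setT D by apply: ge0_emeasurable_sum => // k x _ _.
have iD : (\int[m]_x D x < +oo)%E.
  rewrite integral_nneseries//.
  apply: (@le_lt_trans _ _ 2%:E); last exact: ltry.
  apply: lime_le; first by apply: is_cvg_nneseries => k _ _; exact: integral_ge0.
  apply: nearW => n; apply: (@le_trans _ _ (\sum_(0 <= k < n) (2^-1 ^+ k)%:E)%E).
    exact: lee_sum.
  by rewrite sumEFin lee_fin; exact: geometric_half_le.
have Di : m.-integrable setT D.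
  apply/integrableP; split => //.
  by under eq_integral => x _ do rewrite gee0_abs//.
apply: filterS (integrable_ae measurableT Di) => x /(_ I) Dx.
apply: (@cvgn_of_square_sums _ _ (fine (D x))) => n.
rewrite -lee_fin fineK// -sumEFin; apply: nneseries_lim_ge => k _ _; exact: t0.
Qed.

(** The limit is delivered as one functional [G] of the sequence of values at a point. Any
    invariance shared by all the [f n] is then inherited everywhere by the limit, which is what
    closedness of [Hn n] requires. *)
Lemma riesz_fischer (f : nat -> T -> R) (u : nat -> L2 m) :
  (forall n, measurable_fun setT (f n)) -> (forall n, represents (f n) (u n)) ->
  cauchy_seq (L2_ip m) u -> exists (G : (nat -> R) -> R) (h : L2 m),
    [/\ measurable_fun setT (fun x => G (f ^~ x)),
        represents (fun x => G (f ^~ x)) h &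
        small (fun k => L2_ip m (u k - h) (u k - h))].
Proof.
move=> mf fu uc.
have diff j l : ((L2_ip m (u j - u l) (u j - u l))%:E =
    \int[m]_x ((f j x - f l x) ^+ 2)%:E)%E.
  by apply: L2_ip_norm (representsB (fu j) (fu l)); exact: measurable_funB.
have p4 k : 0 < (4^-1 : R) ^+ k by rewrite exprn_gt0.
have [N NP] := choice (fun k => uc _ (p4 k)).
(* The maximum makes [n k] and [n k.+1] both exceed [N k]; adding [k] makes the indices tend to
   infinity. *)
pose n k := (k + \max_(i < k.+1) N i)%N.
have Nn i k : (i <= k)%N -> (N i <= n k)%N.
  move=> ik; apply: leq_trans (leq_addl _ _).
  by apply: (@leq_bigmax _ (fun i : 'I_k.+1 => N i) (Ordinal (ik : (i < k.+1)%N))).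
pose g k := f (n k).
have gae : {ae m, forall x, cvgn (g ^~ x)}.
  apply: ae_cvg_of_sqint => [k|k]; first exact: mf.
  by rewrite -diff lee_fin ltW// NP// Nn.
(* The upper limit exists and is measurable everywhere, and is the limit almost everywhere; [fine]
   sends infinite values to 0. *)
pose G (s : nat -> R) := fine (limn_esup (fun k => (s (n k))%:E)).
have mG : measurable_fun setT (fun x => G (f ^~ x)).
  apply: (measurableT_comp (fine_measurable measurableT)).
  by apply: measurable_fun_limn_esup => k; apply/measurable_EFinP; exact: mf.
have Gcvg x : cvgn (g ^~ x) -> (g ^~ x) @ \oo --> G (f ^~ x).
  move=> /cvg_ex[l gl].
  suff -> : G (f ^~ x) = l by [].
  rewrite /G (cvg_limn_einf_sup (_ : _ --> l%:E)).2//.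
  by apply: cvg_EFin gl; exact: nearW.
(* Fatou's lemma along the subsequence, shifted by [K] so that every integral satisfies the
   bound. *)
have bound eps k : (exists K, forall j, (K <= j)%N ->
    (\int[m]_x ((g j x - f k x) ^+ 2)%:E <= eps%:E)%E) ->
    (\int[m]_x ((G (f ^~ x) - f k x) ^+ 2)%:E <= eps%:E)%E.
  move=> [K KP].
  pose w j x := (((g (j + K)%N x - f k x) ^+ 2)%:E)%E.
  have mw j : measurable_fun setT (w j).
    by apply/measurable_EFinP; apply: measurable_funX; apply: measurable_funB; exact: mf.
  have -> : (\int[m]_x ((G (f ^~ x) - f k x) ^+ 2)%:E = \int[m]_x limn_einf (w ^~ x))%E.
    apply: ge0_ae_eq_integral => //.
    - by apply/measurable_EFinP; apply: measurable_funX; exact: measurable_funB.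
    - have -> : (fun x => limn_einf (w ^~ x)) =
          -%E \o (fun x => limn_esup ((fun j x => - w j x)%E ^~ x)) by [].
      apply: measurableT_comp => //; apply: measurable_fun_limn_esup => j.
      exact: measurableT_comp.
    - by move=> x _; rewrite lee_fin sqr_ge0.
    - move=> x _; rewrite limn_einf_lim; apply: lime_ge; first exact: is_cvg_einfs.
      apply: nearW => j; apply: le_ereal_inf_tmp => _ [i _ <-]; rewrite lee_fin sqr_ge0//.
    - apply: filterS gae => x /Gcvg gx _.
      apply/esym; apply: (cvg_limn_einf_sup (_ : _ --> _)).1.
      apply: cvg_EFin; first exact: nearW.
      rewrite /comp /=.
      have gK : (fun j => g (j + K)%N x) @ \oo --> G (f ^~ x) by have := gx; rewrite -(cvg_shiftn K).
      under eq_fun do rewrite expr2; rewrite expr2.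
      by apply: cvgM; apply: cvgB gK (cvg_cst _).
  apply: le_trans (fatou m measurableT mw _) _ => [j x _|]; first by rewrite lee_fin sqr_ge0.
  rewrite limn_einf_lim; apply: lime_le; first exact: is_cvg_einfs.
  apply: nearW => j; apply: ge_ereal_inf; exists (\int[m]_x w j x)%E; first by exists j => /=.
  by apply: KP; exact: leq_addl.
have close eps : 0 < eps -> exists K, forall k, (K <= k)%N ->
    (\int[m]_x ((G (f ^~ x) - f k x) ^+ 2)%:E <= eps%:E)%E.
  move=> e0; have [K KP] := uc _ e0; exists K => k Kk; apply: bound; exists K => j Kj.
  rewrite -diff lee_fin ltW// KP//.
  by rewrite (leq_trans Kj)// leq_addr.
have sG : sqint m (fun x => G (f ^~ x)).
  have [K /(_ _ (leqnn K)) KP] := close _ ltr01.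
  have -> : (fun x => G (f ^~ x)) = (fun x => (G (f ^~ x) - f K x) + f K x).
    by apply/funext => x; rewrite subrK.
  apply: sqintD; last exact: represents_sqint (fu K).
  by split; [exact: measurable_funB|apply: le_lt_trans KP (ltry _)].
have [h Gh] := represents_ex sG.
exists G, h; split => // eps e0.
have [K KP] := close (eps / 2) ltac:(by rewrite divr_gt0).
exists K => k /KP.
rewrite -(L2_ip_norm (measurable_funB mG (mf k)) (representsB Gh (fu k))) lee_fin.
rewrite (sf_sym (L2_ip_sform m) (I : setT h) (I : setT (u k))); lra.
Qed.

Lemma L2_hilbert : hilbert (L2_ip m).
Proof.
split; [exact: L2_ip_sform|exact: L2_ip_def|move=> u _ uc].
have mr k : measurable_fun setT (L2_repr (u k)) := (sqint_repr _).1.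
have [G [h [_ _ uh]]] := riesz_fischer mr (fun k => represents_repr (u k)) uc.
by exists h.
Qed.

End riesz_fischer.

(** * Configurations on the tree *)

Section tree_maps.
Context {R : realType} {S : finType} {d : measure_display}
  {E : measurableType d} (M : setting R S E).
Implicit Types (n : nat) (s : node -> S) (e : node -> E) (v u : node) (w : tree_space M).

(* A fixed section of phi extends values prescribed at generation n to the later
   generations. *)
Definition phi_preim (y : S) : S * S * E := projT1 (cid (phi_surj M y)).

Lemma phi_preimP y : phi M (phi_preim y).1.1 (phi_preim y).1.2 (phi_preim y).2 = y.
Proof. by rewrite /phi_preim; case: cid. Qed.

Definition branch (y : S) (b : bool) : S :=
  if b then (phi_preim y).1.2 else (phi_preim y).1.1.

Fixpoint eval_tree s e k v : S :=
  if k is k'.+1 then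
    phi M (eval_tree s e k' (rcons v false)) (eval_tree s e k' (rcons v true)) (e v)
  else s v.

Definition build_xi n s e v : S :=
  if (size v < n)%N then eval_tree s e (n - size v) v
  else foldl branch (s (take n v)) (drop n v).

Definition build_eps n s e v : E :=
  if (size v < n)%N then e v else (phi_preim (build_xi n s e v)).2.

Lemma build_xi_branch n s e v b : (n <= size v)%N ->
  build_xi n s e (rcons v b) = branch (build_xi n s e v) b.
Proof.
move=> nv; rewrite /build_xi size_rcons !ltnNge nv (leqW nv)/=.
by rewrite drop_rcons// -cats1 takel_cat// foldl_rcons.
Qed.

Lemma build_xi_eval n s e v : (size v <= n)%N ->
  build_xi n s e v = eval_tree s e (n - size v) v.
Proof.
rewrite /build_xi; case: ltngtP => // vn _.
by rewrite -vn take_size drop_size subnn.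
Qed.

Lemma build_xi_phi n s e v : build_xi n s e v =
  phi M (build_xi n s e (rcons v false)) (build_xi n s e (rcons v true)) (build_eps n s e v).
Proof.
rewrite /build_eps; have [vn|nv] := ltnP (size v) n.
  by rewrite !build_xi_eval ?size_rcons ?(ltnW vn)// -(subnSK vn).
by rewrite !build_xi_branch// phi_preimP.
Qed.

(** Makes the coordinates [xi_u] with [size u = n] and [eps_u] with [size u < n] free: any
    prescribed values are those of a point of the tree space. *)
Definition build n s e : tree_space M := TreeSpace (build_xi_phi n s e).

Lemma xi_build n s e v : size v = n -> xi (build n s e) v = s v.
Proof. by move=> vn; rewrite /= build_xi_eval ?vn// subnn. Qed.

Lemma eps_build n s e v : (size v < n)%N -> eps (build n s e) v = e v.
Proof. by move=> vn; rewrite /= /build_eps vn. Qed.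

Lemma tree_space_eq w w' : xi w = xi w' -> eps w = eps w' -> w = w'.
Proof.
case: w w' => x e p [x' e' p'] /= xx ee; rewrite xx ee in p *.
by congr TreeSpace; exact: Prop_irrelevance.
Qed.

Lemma eval_ext n s e s' e' : (forall v, size v = n -> s v = s' v) ->
  (forall v, (size v < n)%N -> e v = e' v) ->
  forall k v, (k + size v = n)%N -> eval_tree s e k v = eval_tree s' e' k v.
Proof.
move=> ss ee; elim=> [|k IH] v kv; first exact: ss.
by rewrite /= !IH ?size_rcons ?addnS -?kv// ee// -kv addSn ltnS leq_addl.
Qed.

Lemma build_ext n s e s' e' : (forall v, size v = n -> s v = s' v) ->
  (forall v, (size v < n)%N -> e v = e' v) -> build n s e = build n s' e'.
Proof.
move=> ss ee.
have xx : build_xi n s e = build_xi n s' e'.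
  apply/funext => v; rewrite /build_xi; have [vn|nv] := ltnP (size v) n.
    by apply: (eval_ext ss ee); rewrite subnK// ltnW.
  by rewrite ss// size_takel.
apply: tree_space_eq; first exact: xx.
apply/funext => v /=; rewrite /build_eps xx.
by have [vn|//] := ltnP (size v) n; rewrite ee.
Qed.

Lemma xi_eval n w v : (size v <= n)%N -> xi w v = eval_tree (xi w) (eps w) (n - size v) v.
Proof.
move=> /subnK; move: (n - size v)%N => k; elim: k v => [//|k IH] v kv /=.
by rewrite -!IH ?size_rcons ?addnS// -xi_phi.
Qed.

Definition agree n w w' : Prop := (forall v, size v = n -> xi w v = xi w' v) /\
  (forall v, (size v < n)%N -> eps w v = eps w' v).

Definition ret n w := build n (xi w) (eps w).

(** One value cannot be changed alone inside the tree space, because the values at the ancestors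
    depend on it; rebuilding from level [n] recomputes them. *)
Definition chg n u (y : S) w := build n (fun v => if v == u then y else xi w v) (eps w).

Lemma agree_ret n w : agree n (ret n w) w.
Proof. by split=> v vn; [rewrite xi_build|rewrite eps_build]. Qed.

Lemma agree_xi n w w' : agree n w w' -> forall v, (size v <= n)%N -> xi w v = xi w' v.
Proof.
move=> [xx ee] v vn; rewrite (xi_eval w vn) (xi_eval w' vn).
by apply: (eval_ext xx ee); rewrite subnK.
Qed.

Lemma agreeS n w w' : agree n.+1 w w' -> agree n w w'.
Proof.
move=> ww; split=> v vn; first by apply: (agree_xi ww); rewrite vn.
by apply: ww.2; exact: ltnW.
Qed.

(* f only depends on the xi_v with v of length n and the eps_v with v shorter. *)
Definition level n (T : Type) (f : tree_space M -> T) : Prop := forall w, f (ret n w) = f w.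

Lemma levelP n T (f : tree_space M -> T) :
  level n f <-> forall w w', agree n w w' -> f w = f w'.
Proof.
split=> [fn w w' [xx ee]|fn w]; last exact: fn (agree_ret n w).
by rewrite -fn -(fn w') /ret (build_ext xx ee).
Qed.

Lemma levelS n T (f : tree_space M -> T) : level n f -> level n.+1 f.
Proof. by move=> /levelP fn; apply/levelP => w w' /agreeS; exact: fn. Qed.

Lemma level_xi n u : size u = n -> level n (fun w => xi w u).
Proof. by move=> un; apply/levelP => w w' [xx _]; exact: xx. Qed.

Lemma xi_chg n u y w v : size v = n -> xi (chg n u y w) v = if v == u then y else xi w v.
Proof. by move=> vn; rewrite /chg xi_build. Qed.

Lemma eps_chg n u y w v : (size v < n)%N -> eps (chg n u y w) v = eps w v.
Proof. by move=> vn; rewrite /chg eps_build. Qed.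

Lemma agree_chg n u y w w' : agree n w w' -> agree n (chg n u y w) (chg n u y w').
Proof.
move=> [xx ee]; split=> v vn; first by rewrite !xi_chg// xx.
by rewrite !eps_chg// ee.
Qed.

Lemma level_chg n u y T (f : tree_space M -> T) : level n f ->
  level n (fun w => f (chg n u y w)).
Proof. by move=> /levelP fn; apply/levelP => w w' ww; apply: fn; exact: agree_chg. Qed.

Lemma chg_id n u w : agree n (chg n u (xi w u) w) w.
Proof. by split=> v vn; [rewrite xi_chg//; case: eqP => // ->|rewrite eps_chg]. Qed.

(* Changing the value at a daughter of u only changes the value at u among the
   coordinates of the level of u. *)
Lemma chg_daughter u b x w : agree (size u)
  (chg (size u).+1 (rcons u b) x w)
  (chg (size u) u (phi M x (xi w (rcons u (~~ b))) (eps w u)) w).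
Proof.
set n := size u; split=> v vn.
  rewrite [RHS]xi_chg//; have [->|vu] := eqVneq v u.
    rewrite xi_phi !xi_chg ?size_rcons// eps_chg// !eqseq_rcons eqxx/=.
    by case: b => //=; rewrite phiC.
  rewrite xi_phi !xi_chg ?size_rcons ?vn// eps_chg ?vn//.
  by rewrite !eqseq_rcons (negbTE vu)/= -xi_phi.
by rewrite !eps_chg// ltnW.
Qed.

End tree_maps.

Section tree_measurability.
Context {R : realType} {S : finType} {d : measure_display}
  {E : measurableType d} (M : setting R S E).
Implicit Types (n : nat) (v u : node) (w : tree_space M) (I J : set node).

Section sigma.
Context {X : Type} (A : set (set X)).
Hypothesis As : sigma_algebra setT A.

Lemma salg0 : A set0. Proof. by case: As. Qed.

Lemma salgC B : A B -> A (~` B).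
Proof. by case: As => _ AC _ /AC; rewrite setTD. Qed.

Lemma salg_bigcup F : (forall i : nat, A (F i)) -> A (\bigcup_i F i).
Proof. by case: As => _ _; exact. Qed.

Lemma salgT : A setT.
Proof. by rewrite -setC0; apply: salgC; exact: salg0. Qed.

Lemma salg_cst (Q : Prop) : A [set _ | Q].
Proof.
by have [q|nq] := pselect Q; [have := salgT|have := salg0]; congr A;
  apply/seteqP; split.
Qed.

Lemma salgU B C : A B -> A C -> A (B `|` C).
Proof.
move=> AB AC; rewrite -bigcup2E; apply: salg_bigcup => -[|[|i]] //=; exact: salg0.
Qed.

Lemma salgI B C : A B -> A C -> A (B `&` C).
Proof.
by move=> AB AC; rewrite -[B `&` C]setCK setCI; apply/salgC/salgU; exact: salgC.
Qed.

Lemma salg_ex (I : finType) (F : I -> set X) : (forall i, A (F i)) ->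
  A [set x | exists i, F i x].
Proof.
move=> AF; have -> : [set x | exists i, F i x] = \big[setU/set0]_(i : I) F i.
  rewrite -bigcup_seq; apply/seteqP; split=> x /=.
    by move=> [i Fi]; exists i => //=; rewrite mem_index_enum.
  by move=> [i _ Fi]; exists i.
by elim/big_ind: _ => //; [exact: salg0|exact: salgU].
Qed.

Lemma preimage_salg (Y : Type) (k : X -> Y) : sigma_algebra setT [set B | A (k @^-1` B)].
Proof.
split => /=; first by rewrite preimage_set0; exact: salg0.
  by move=> B; rewrite setTD preimage_setC; exact: salgC.
by move=> F AF; rewrite preimage_bigcup; exact: salg_bigcup.
Qed.

End sigma.

Lemma coord_sigma_salg I J : sigma_algebra setT (@coord_sigma S d E I J).
Proof. exact: smallest_sigma_algebra. Qed.

Lemma coord_sigma_xi I J u (B : set S) : I u ->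
  @coord_sigma S d E I J [set p | B (p.1 u)].
Proof. by move=> Iu; apply: sub_sigma_algebra; left; exists u, B. Qed.

Lemma coord_sigma_eps I J u (B : set E) : J u -> measurable B ->
  @coord_sigma S d E I J [set p | B (p.2 u)].
Proof. by move=> Ju mB; apply: sub_sigma_algebra; right; exists u, B. Qed.

Lemma coord_sigma_preimage (X : Type) (A : set (set X)) I J
  (k : X -> (node -> S) * (node -> E)) : sigma_algebra setT A ->
  (forall u (B : set S), I u -> A [set x | B ((k x).1 u)]) ->
  (forall u (B : set E), J u -> measurable B -> A [set x | B ((k x).2 u)]) ->
  forall C, coord_sigma I J C -> A (k @^-1` C).
Proof.
move=> As kI kJ C; apply: (smallest_sub (X := [set C | A (k @^-1` C)])).
  exact: preimage_salg.
by move=> _ [[u [B [Iu ->]]]|[u [B [Ju mB ->]]]]; [exact: kI|exact: kJ].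
Qed.

Lemma tree_sigma_preimage (X : Type) (A : set (set X)) I J (k : X -> tree_space M) :
  sigma_algebra setT A ->
  (forall u (B : set S), I u -> A [set x | B (xi (k x) u)]) ->
  (forall u (B : set E), J u -> measurable B -> A [set x | B (eps (k x) u)]) ->
  forall C, tree_sigma M I J C -> A (k @^-1` C).
Proof.
move=> As kI kJ _ [C CC <-]; rewrite setTI -comp_preimage.
exact: (coord_sigma_preimage (k := coords \o k) As kI kJ).
Qed.

Lemma tree_sigma_xi I J u (B : set S) : I u -> tree_sigma M I J [set w | B (xi w u)].
Proof.
by move=> Iu; exists [set p | B (p.1 u)]; rewrite ?setTI//; exact: coord_sigma_xi.
Qed.

Lemma tree_sigma_eps I J u (B : set E) : J u -> measurable B ->
  tree_sigma M I J [set w | B (eps w u)].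
Proof.
by move=> Ju mB; exists [set p | B (p.2 u)]; rewrite ?setTI//; exact: coord_sigma_eps.
Qed.

Lemma measurable_xi u (B : set S) : measurable [set w : tree_space M | B (xi w u)].
Proof. exact: tree_sigma_xi. Qed.

Lemma measurable_eps u (B : set E) : measurable B ->
  measurable [set w : tree_space M | B (eps w u)].
Proof. exact: tree_sigma_eps. Qed.

Lemma tree_sigma_measurable I J C : tree_sigma M I J C -> measurable C.
Proof.
have := @tree_sigma_preimage _ measurable I J id; apply.
- exact: sigma_algebra_measurable.
- by move=> u B _; exact: measurable_xi.
- by move=> u B _; exact: measurable_eps.
Qed.

(** Stated for an arbitrary sigma-algebra on the source, so that it serves for [ret], [chg] and
    [kill] on the tree space, with full or restricted coordinate sigma-algebras, and for [build]
    itself on the product space. Since [S] is finite, each recursive step is a finite union over the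
    values at a vertex and its daughters. *)
Lemma build_measurable (X : Type) (A : set (set X)) n (s : X -> node -> S)
    (e : X -> node -> E) : sigma_algebra setT A ->
  (forall v (B : set S), size v = n -> A [set x | B (s x v)]) ->
  (forall v (B : set E), (size v < n)%N -> measurable B -> A [set x | B (e x v)]) ->
  forall C, measurable C -> A ((fun x => build M n (s x) (e x)) @^-1` C).
Proof.
move=> As sA eA.
have evA k v (B : set S) : (k + size v = n)%N -> A [set x | B (eval_tree M (s x) (e x) k v)].
  elim: k v B => [|k IH] v B kv; first exact: sA.
  have -> : [set x | B (eval_tree M (s x) (e x) k.+1 v)] =
      [set x | exists abc : S * S * S,
        ((eval_tree M (s x) (e x) k (rcons v false) = abc.1.1 /\
          eval_tree M (s x) (e x) k (rcons v true) = abc.1.2) /\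
         (phi M abc.1.1 abc.1.2 (e x v) = abc.2 /\ B abc.2))].
    apply/seteqP; split=> x /=.
      by move=> Bx; eexists (_, _, _) => /=; split; split; [reflexivity..|exact: Bx].
    by move=> [[[a b] c]] /= [[-> ->] [-> Bc]].
  apply: salg_ex => // -[[a b] c] /=.
  apply: salgI => //; first apply: salgI => //.
  - by apply: (IH _ [set a]); rewrite size_rcons addnS.
  - by apply: (IH _ [set b]); rewrite size_rcons addnS.
  suff : A [set x | phi M a b (e x v) = c /\ B c] by [].
  have [Bc|nBc] := pselect (B c).
    have -> : [set x | phi M a b (e x v) = c /\ B c] =
        [set x | [set z | phi M a b z = c] (e x v)].
      by apply/seteqP; split=> x /=; [case|].
    apply: eA; last exact: phi_measurable.
    by rewrite -kv addSn ltnS leq_addl.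
  have -> : [set x | phi M a b (e x v) = c /\ B c] = set0.
    by rewrite -subset0 => x /= [].
  exact: salg0.
have xA v (B : set S) : A [set x | B (build_xi M n (s x) (e x) v)].
  rewrite /build_xi; have [vn|nv] := ltnP (size v) n.
    by apply: evA; rewrite subnK// ltnW.
  by apply: (sA _ [set y | B (foldl (branch M) y (drop n v))]); rewrite size_takel.
apply: (@tree_sigma_preimage X A setT setT) => // u B _; first exact: xA.
move=> mB; rewrite /= /build_eps; have [un|nu] := ltnP (size u) n; first exact: eA.
exact: (xA u [set y | B (phi_preim M y).2]).
Qed.

(** [f] equals [f \o ret n], and [ret n] reads only coordinates of level [n]. Membership in [Hn n]
    thereby splits into plain measurability and an invariance. *)
Lemma measurable_level (f : tree_space M -> R) n : measurable_fun setT f -> level n f ->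
  forall B, measurable B ->
    tree_sigma M [set u | size u = n] [set u | (size u < n)%N] (f @^-1` B).
Proof.
move=> mf fn B mB.
have -> : f @^-1` B = ret n @^-1` (f @^-1` B).
  by apply/seteqP; split=> w /=; rewrite fn.
apply: build_measurable.
- exact: tree_sigma_algebra.
- by move=> v C vn; exact: tree_sigma_xi.
- by move=> v C vn mC; exact: tree_sigma_eps.
- by rewrite -[X in measurable X]setTI; exact: mf.
Qed.

Lemma coord_sigma_invariant I J C p p' : @coord_sigma S d E I J C ->
  (forall v, I v -> p.1 v = p'.1 v) -> (forall v, J v -> p.2 v = p'.2 v) ->
  C p -> C p'.
Proof.
move=> CC pI pJ; suff : C p <-> C p' by case.
apply: (smallest_sub (X := [set C | C p <-> C p']) _ _ CC).
  split=> //= [B [BB BB']|F FF]; first by split=> -[_ H]; split => // Bp; apply: H; auto.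
  by split=> -[i _ Fi]; exists i => //; apply/FF.
move=> _ [[u [B [Iu ->]]]|[u [B [Ju mB ->]]]] /=; first by rewrite pI.
by rewrite pJ.
Qed.

Lemma coord_fun_invariant I J (F : (node -> S) * (node -> E) -> R) p p' :
  (forall B, measurable B -> coord_sigma I J (F @^-1` B)) ->
  (forall v, I v -> p.1 v = p'.1 v) -> (forall v, J v -> p.2 v = p'.2 v) ->
  F p = F p'.
Proof.
move=> mF pI pJ; apply/esym.
exact: (coord_sigma_invariant (mF [set F p] (measurable_set1 _)) pI pJ erefl).
Qed.

Lemma tree_fun_level (f : tree_space M -> R) n :
  (forall B, measurable B ->
    tree_sigma M [set u | size u = n] [set u | (size u < n)%N] (f @^-1` B)) ->
  measurable_fun setT f /\ level n f.
Proof.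
move=> mf; split.
  by move=> _ B mB; rewrite setTI; exact: tree_sigma_measurable (mf _ mB).
apply/levelP => w w' [ww ee]; apply/esym.
have [C CC] := mf [set f w] (measurable_set1 _); rewrite setTI => Cf.
have H := coord_sigma_invariant (p := coords w) (p' := coords w') CC ww ee.
have : C (coords w') by apply: H; rewrite -[C _]/((coords @^-1` C) w) Cf.
by rewrite -[C _]/((coords @^-1` C) w') Cf.
Qed.

Lemma measurable_chg n u y : measurable_fun setT (@chg R S d E M n u y).
Proof.
move=> _ B mB; rewrite setTI; apply: build_measurable => //.
- exact: sigma_algebra_measurable.
- move=> v C vn; case: eqP => _; last exact: measurable_xi.
  exact: (salg_cst (sigma_algebra_measurable _) (C y)).
- by move=> v C vn; exact: measurable_eps.
Qed.

End tree_measurability.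

(** * Independence *)

Section independence.
Context d (T : measurableType d) (R : realType) (P : {measure set T -> \bar R}).

Lemma ge0_integral_mrestr (D : set T) (mD : measurable D) (g : T -> \bar R) :
  measurable_fun setT g -> (forall x, (0 <= g x)%E) ->
  (\int[mrestr P mD]_x g x = \int[P]_(x in D) g x)%E.
Proof.
move=> mg g0.
have D0 : mrestr P mD (~` D) = 0%E by rewrite /mrestr setICl measure0.
rewrite (ge0_negligible_integral (measurableC mD) measurableT mg _ D0)//.
rewrite setTD setCK; apply: eq_measure_integral => A mA AD.
by rewrite /= /mrestr setIidl.
Qed.

Variables (D : set T) (c : R) (k : T -> T).
Hypotheses (mD : measurable D) (mk : measurable_fun setT k) (c0 : 0 <= c).
Hypothesis Dk : forall A, measurable A -> (P (D `&` k @^-1` A) = c%:E * P (k @^-1` A))%E.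

(** [Dk] says that [D] is independent of [k], and [g = g \o k] that [g] is a function of [k]. Pushed
    forward by [k], the restriction of [P] to [D] is [c] times the push-forward of [P]. *)
Lemma ge0_indep_integral (g : T -> \bar R) : measurable_fun setT g ->
  (forall x, (0 <= g x)%E) -> (forall x, g (k x) = g x) ->
  (\int[P]_(x in D) g x = c%:E * \int[P]_x g x)%E.
Proof.
move=> mg g0 gk; rewrite -(ge0_integral_mrestr mD)//.
have push (Q : {measure set T -> \bar R}) :
    (\int[Q]_x g x = \int[pushforward Q k]_x g x)%E.
  rewrite (ge0_integral_pushforward mk)// preimage_setT.
  by apply: eq_integral => x _ /=; rewrite gk.
rewrite (push P) (push (mrestr P mD)) -(@ge0_integral_mscale _ _ _ _ _ _ (NngNum c0))//.
apply: eq_measure_integral => A mA _.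
by rewrite /= /pushforward /mscale /= /mrestr setIC Dk.
Qed.

Lemma indep_integral (G : T -> R) : P.-integrable setT (EFin \o G) ->
  (forall x, G (k x) = G x) ->
  \int[P]_(x in D) G x = c * \int[P]_x G x.
Proof.
move=> Gi Gk; have mG := measurable_int _ Gi.
rewrite /Rintegral integralE [in RHS]integralE.
have pk x : ((EFin \o G)^\+ (k x) = (EFin \o G)^\+ x)%E by rewrite !funeposE /= Gk.
have nk x : ((EFin \o G)^\- (k x) = (EFin \o G)^\- x)%E by rewrite !funenegE /= Gk.
have pf : (\int[P]_x ((EFin \o G)^\+ x) \is a fin_num)%E.
  by apply: integrable_fin_num => //; exact: integrable_funepos.
have qf : (\int[P]_x ((EFin \o G)^\- x) \is a fin_num)%E.
  by apply: integrable_fin_num => //; exact: integrable_funeneg.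
rewrite !ge0_indep_integral//; first last.
- exact: measurable_funepos.
- exact: measurable_funeneg.
by rewrite -(fineK pf) -(fineK qf) -!EFinM -!EFinB/= mulrBr.
Qed.

End independence.

Section finite_valued.
Context d (T : measurableType d) (R : realType) (P : {measure set T -> \bar R}).

Lemma Rintegral_sum (I : Type) (r : seq I) (F : I -> T -> R) :
  (forall i, P.-integrable setT (EFin \o F i)) ->
  P.-integrable setT (EFin \o (fun x => \sum_(i <- r) F i x)) /\
  \int[P]_x (\sum_(i <- r) F i x) = \sum_(i <- r) \int[P]_x F i x.
Proof.
move=> Fi; elim: r => [|i r [IH1 IH2]].
  rewrite big_nil (_ : (fun x => _) = cst 0); last by apply/funext => x; rewrite big_nil.
  split; first by rewrite /comp; exact: integrable0.
  by rewrite /Rintegral integral0.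
split.
  have := integrableD measurableT (Fi i) IH1.
  by apply: eq_integrable => // x _ /=; rewrite big_cons EFinD.
rewrite big_cons -IH2 -RintegralD//.
by apply: eq_Rintegral => x _; rewrite big_cons.
Qed.

Context (I : finType) (Y : T -> I) (p : I -> R) (k : T -> T).
Hypothesis mY : forall i, measurable [set x | Y x = i].
Hypothesis mk : measurable_fun setT k.
Hypothesis p0 : forall i, 0 <= p i.
Hypothesis Yk : forall i A, measurable A ->
  (P ([set x | Y x = i] `&` k @^-1` A) = (p i)%:E * P (k @^-1` A))%E.

Lemma finite_indep_integral (V : I -> R) (G : T -> R) :
  P.-integrable setT (EFin \o G) -> (forall x, G (k x) = G x) ->
  \int[P]_x (V (Y x) * G x) = (\sum_i p i * V i) * \int[P]_x G x.
Proof.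
move=> Gi Gk.
have E i x : (G \_ [set x | Y x = i]) x = (Y x == i)%:R * G x.
  rewrite /patch; case: ifPn => [/set_mem /= ->|]; first by rewrite eqxx mul1r.
  by rewrite notin_setE/= => /eqP/negbTE ->; rewrite mul0r.
have Ri i : P.-integrable setT (EFin \o (fun x => (Y x == i)%:R * G x)).
  have := (integrable_mkcond _ (mY i)).1 (integrableS measurableT (mY i) (@subsetT _ _) Gi).
  apply: eq_integrable => // x _ /=; rewrite -E /patch /=.
  by case: ifP.
have -> : \int[P]_x (V (Y x) * G x) = \int[P]_x (\sum_i V i * ((Y x == i)%:R * G x)).
  apply: eq_Rintegral => x _; rewrite (bigD1 (Y x))//= eqxx mul1r big1 ?addr0// => i iY.
  by rewrite eq_sym (negbTE iY) mul0r mulr0.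
have Vi i : P.-integrable setT (EFin \o (fun x => V i * ((Y x == i)%:R * G x))).
  have := integrableZl measurableT (V i) (Ri i).
  by apply: eq_integrable => // x _ /=; rewrite EFinM.
rewrite (Rintegral_sum _ Vi).2 big_distrl; apply: eq_bigr => i _ /=.
rewrite RintegralZl// mulrAC [RHS]mulrC; congr (_ * _).
under eq_Rintegral do rewrite -E.
rewrite -Rintegral_mkcond (indep_integral (c := p i) _ mk)//.
by move=> A; exact: Yk.
Qed.

End finite_valued.

(** * Independence of the coordinates of one level *)

Section tree_independence.
Context {R : realType} {S : finType} {d : measure_display}
  {E : measurableType d} (M : setting R S E).
Variable m : probability (tree_space M) R.
Hypothesis hm : tree_law m.
Implicit Types (n : nat) (v u : node) (w : tree_space M) (A : node -> {set S}) (B : node -> set E).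

Definition rect n (A : node -> {set S}) (B : node -> set E) : set (tree_space M) :=
  [set w | (forall u, size u = n -> xi w u \in A u) /\
           (forall u, (size u < n)%N -> B u (eps w u))].

Definition rect_weight n (A : node -> {set S}) (B : node -> set E) : R :=
  (\prod_(u : n.-tuple bool) \sum_(x in A u) mu M x) *
  \prod_(k < n) \prod_(u : k.-tuple bool) fine (nu M (B u)).

Lemma rect_weight_ge0 n A B : 0 <= rect_weight n A B.
Proof.
rewrite mulr_ge0// !prodr_ge0// => u _.
  by rewrite sumr_ge0// => x _; rewrite ltW// mu_gt0.
by rewrite prodr_ge0// => v _; rewrite fine_ge0.
Qed.

Lemma rect_salg (X : set (set (tree_space M))) n A B : sigma_algebra setT X ->
  (forall u, size u = n -> X [set w | xi w u \in A u]) ->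
  (forall u, (size u < n)%N -> X [set w | B u (eps w u)]) -> X (rect n A B).
Proof.
move=> Xs XA XB.
have -> : rect n A B =
    ~` [set w | exists u : n.-tuple bool, xi w u \notin A u] `&`
    ~` [set w | exists k : 'I_n, exists u : k.-tuple bool, ~ B u (eps w u)].
  apply/seteqP; split=> [w [wA wB]|w [/forallNP wA /forallNP wB]]; split.
  - by move=> [u]; rewrite wA// size_tuple.
  - by move=> [k [u]]; apply; apply: wB; rewrite size_tuple.
  - by move=> u un; have /negP := wA (Tuple (introT eqP un)); rewrite negbK.
  - move=> u un; have /forallNP /(_ (in_tuple u)) := wB (Ordinal un).
    exact: contrapT.
apply: (salgI Xs); apply: (salgC Xs); apply: (salg_ex Xs).
  move=> u; have := salgC Xs (XA u (size_tuple u)); congr X.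
  by apply/seteqP; split=> w /= /negP.
move=> k; apply: (salg_ex Xs) => u; apply: (salgC Xs).
by apply: XB; rewrite size_tuple.
Qed.

Lemma measurable_rect n A B : (forall u, measurable (B u)) -> measurable (rect n A B).
Proof.
move=> mB; apply: rect_salg.
- exact: sigma_algebra_measurable.
- by move=> u _; exact: (measurable_xi M u [set x | x \in A u]).
- by move=> u _; exact: measurable_eps.
Qed.

Lemma rectI n A B A' B' : rect n A B `&` rect n A' B' =
  rect n (fun u => A u :&: A' u) (fun u => B u `&` B' u).
Proof.
apply/seteqP; split=> w /=.
  move=> [[wA wB] [wA' wB']]; split=> u un; first by rewrite inE wA// wA'.
  by split; [exact: wB|exact: wB'].
move=> [wA wB]; split; split=> u un.
- by have := wA u un; rewrite inE => /andP[].
- by case: (wB u un).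
- by have := wA u un; rewrite inE => /andP[].
- by case: (wB u un).
Qed.

Lemma rect_weightI n A B A' B' :
  (forall u, size u = n -> A u = finset.setT \/ A' u = finset.setT) ->
  (forall u, (size u < n)%N -> B u = setT \/ B' u = setT) ->
  rect_weight n (fun u => A u :&: A' u) (fun u => B u `&` B' u) =
  rect_weight n A B * rect_weight n A' B'.
Proof.
move=> AA BB; rewrite /rect_weight mulrACA -big_split -big_split /=.
have s1 : \sum_(x in (finset.setT : {set S})) mu M x = 1.
  by rewrite -[RHS](mu_sum1 M); apply: eq_bigl => x; rewrite inE.
congr (_ * _); apply: eq_bigr => u _.
  by case: (AA u (size_tuple u)) => ->;
    rewrite ?finset.setTI ?finset.setIT s1 ?mulr1 ?mul1r.
rewrite -big_split/=; apply: eq_bigr => v _.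
have [->|->] : B v = setT \/ B' v = setT by apply: BB; rewrite size_tuple.
  by rewrite setTI probability_setT mul1r.
by rewrite setIT probability_setT mulr1.
Qed.

Lemma rect_law n A B : (forall u, measurable (B u)) ->
  m (rect n A B) = (rect_weight n A B)%:E.
Proof. exact: hm. Qed.

(** Both sides are finite measures in [C]. They agree on the rectangles that constrain only
    coordinates left free by [A] and [B], where [rect_weight] is multiplicative; these are stable
    under intersection and generate the sigma-algebra of the free coordinates. *)
Lemma rect_indep n A B C : (forall u, measurable (B u)) ->
  tree_sigma M [set u | size u = n /\ A u = finset.setT]
               [set u | (size u < n)%N /\ B u = setT] C ->
  (m (rect n A B `&` C) = (rect_weight n A B)%:E * m C)%E.
Proof.
move=> mB; set I := [set u | _]; set J := [set u | _] => CC.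
pose PP := [set D | exists A' B', [/\ forall u, measurable (B' u),
  forall u, size u = n -> A u = finset.setT \/ A' u = finset.setT,
  forall u, (size u < n)%N -> B u = setT \/ B' u = setT & D = rect n A' B']].
pose m1 := mrestr m (measurable_rect n A mB).
pose m2 := mscale (NngNum (rect_weight_ge0 n A B)) m.
suff : m1 C = m2 C by rewrite /m1 /m2 /mrestr /mscale setIC.
have PT : PP setT.
  exists (fun=> finset.setT), (fun=> setT); split => //; [by right|by right|].
  by apply/seteqP; split => // w _; split => // u _; rewrite inE.
apply: (@g_sigma_algebra_measure_unique _ _ _ PP _ (fun=> setT)).
- by move=> _ [A' [B' [mB' _ _ ->]]]; exact: measurable_rect.
- by [].
- by apply/seteqP; split=> // w _; exists 0%N.
- move=> _ _ [A1 [B1 [mB1 AA1 BB1 ->]]] [A2 [B2 [mB2 AA2 BB2 ->]]].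
  exists (fun u => A1 u :&: A2 u), (fun u => B1 u `&` B2 u); split.
  + by move=> u; exact: measurableI.
  + move=> u un; case: (AA1 u un) => [|->]; first by left.
    by case: (AA2 u un) => [|->]; [left|right; rewrite finset.setTI].
  + move=> u un; case: (BB1 u un) => [|->]; first by left.
    by case: (BB2 u un) => [|->]; [left|right; rewrite setTI].
  + exact: rectI.
- move=> _ [A' [B' [mB' AA' BB' ->]]].
  rewrite /m1 /m2 /= /mscale /mrestr setIC rectI.
  rewrite !rect_law//; last by move=> u; exact: measurableI.
  rewrite rect_weightI// EFinM; congr (_ * _)%E; exact/esym/rect_law.
- by move=> k; rewrite /m1 /= /mrestr; apply: le_lt_trans (probability_le1 _ _) (ltry _);
    apply: measurableI => //; exact: measurable_rect.
have Ps : sigma_algebra setT <<s PP >> by exact: smallest_sigma_algebra.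
move: CC; apply: (@tree_sigma_preimage _ _ _ _ _ _ _ _ _ id Ps).
- move=> u D [un Au]; apply: sub_sigma_algebra.
  exists (fun v => if v == u then [set x | `[< D x >]]%SET else finset.setT), (fun=> setT); split => //.
  + by move=> v vn; case: eqP => [->|]; [left|right].
  + by right.
  apply/seteqP; split=> w /= => [Dw|[/(_ u un)]].
    by split=> // v vn; case: eqP => [->|]; rewrite inE//; exact/asboolP.
  by rewrite eqxx inE => /asboolP.
- move=> u D [un Bu] mD; apply: sub_sigma_algebra.
  exists (fun=> finset.setT), (fun v => if v == u then D else setT); split => //.
  + by move=> v; case: eqP.
  + by right.
  + by move=> v vn; case: eqP => [->|]; [left|right].
  apply/seteqP; split=> w /= => [Dw|[_ /(_ u un)]]; last by rewrite eqxx.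
  by split=> v vn; rewrite ?inE//; case: eqP => // ->.
Qed.

End tree_independence.

(** * The data at a vertex and its daughters *)

Lemma sum_fibers d (T : measurableType d) (R : realType) (P : probability T R)
    (I : finType) (Y : T -> I) (Q : pred I) :
  (forall i, measurable [set x | Y x = i]) ->
  \sum_(i | Q i) fine (P [set x | Y x = i]) = fine (P [set x | Q (Y x)]).
Proof.
move=> mY.
have mQ (B : pred I) : measurable [set x | B (Y x)].
  have -> : [set x | B (Y x)] = [set x | exists i, Y x = i /\ B i].
    by apply/seteqP; split=> x /= => [Bx|[i [->]]//]; exists (Y x).
  apply: salg_ex => [|i]; first exact: sigma_algebra_measurable.
  have [Bi|nBi] := boolP (B i).
    by have := mY i; congr measurable; apply/seteqP; split=> x //= [].
  by have := @measurable0 _ T; congr measurable; apply/seteqP; split=> x //= -[].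
suff H r : uniq r -> \sum_(i <- r | Q i) fine (P [set x | Y x = i]) =
    fine (P [set x | Q (Y x) && (Y x \in r)]).
  rewrite H ?index_enum_uniq//; congr (fine (P _)).
  by apply/seteqP; split=> x /=; rewrite mem_index_enum andbT.
elim: r => [_|i r IH /= /andP[ir ur]].
  rewrite big_nil (_ : [set x | _] = set0) ?measure0//.
  by rewrite -subset0 => x /=; rewrite in_nil andbF.
rewrite big_cons IH//; case: ifPn => Qi; last first.
  congr (fine (P _)); apply/seteqP; split=> x /=; rewrite in_cons.
    by move=> /andP[-> ->]; rewrite orbT.
  by move=> /andP[Qx /orP[/eqP Yi|->]]; [rewrite -Yi Qx in Qi|rewrite Qx].
have -> : [set x | Q (Y x) && (Y x \in i :: r)] =
    [set x | Y x = i] `|` [set x | Q (Y x) && (Y x \in r)].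
  apply/seteqP; split=> x /=; rewrite in_cons.
    by move=> /andP[Qx /orP[/eqP|->]]; [left|right; rewrite Qx].
  by move=> [->|/andP[-> ->]]; rewrite ?eqxx ?Qi// orbT.
rewrite measureU//.
- by rewrite fineD// fin_num_measure//; exact: (mQ (fun j => Q j && (j \in r))).
- exact: (mQ (fun j => Q j && (j \in r))).
- by rewrite -subset0 => x /= [-> /andP[_]]; rewrite (negbTE ir).
Qed.

Section daughters.
Context {R : realType} {S : finType} {d : measure_display}
  {E : measurableType d} (M : setting R S E).
Variable m : probability (tree_space M) R.
Hypothesis hm : tree_law m.
Implicit Types (n : nat) (v u : node) (w : tree_space M).

(* The map phi(., ., eps_u) has finitely many possible values, unlike eps_u: the
   data at u and its daughters form a random variable in a finite type. *)
Definition table (z : E) : {ffun S * S -> S} := [ffun p => phi M p.1 p.2 z].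

Definition dtype : finType := (S * S * {ffun S * S -> S})%type.

Definition daughters u w : dtype :=
  (xi w (rcons u false), xi w (rcons u true), table (eps w u)).

Definition parent (t : dtype) : S := t.2 (t.1.1, t.1.2).

(** The law of [daughters u] under [m], the same for every vertex [u]; see [daughters_indep]. *)
Definition dlaw (t : dtype) : R :=
  mu M t.1.1 * mu M t.1.2 * fine (nu M [set z | table z = t.2]).

Lemma parent_daughters u w : parent (daughters u w) = xi w u.
Proof. by rewrite /parent /= ffunE -xi_phi. Qed.

Lemma dlaw_ge0 t : 0 <= dlaw t.
Proof. by rewrite !mulr_ge0 ?fine_ge0// ltW// mu_gt0. Qed.

Lemma measurable_table tau : measurable [set z | table z = tau].
Proof.
have -> : [set z | table z = tau] =
    ~` [set z | exists p, phi M p.1 p.2 z <> tau p].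
  apply/seteqP; split=> z /= => [<- [p]|H]; first by rewrite ffunE.
  apply/ffunP => p; rewrite ffunE; apply: contrapT => ne.
  by apply: H; exists p.
apply: measurableC; apply: salg_ex; first exact: sigma_algebra_measurable.
move=> p; apply: (@measurableC _ _ [set z | phi M p.1 p.2 z = tau p]).
exact: phi_measurable.
Qed.

Lemma sum_table (Q : pred {ffun S * S -> S}) :
  \sum_(tau | Q tau) fine (nu M [set z | table z = tau]) =
  fine (nu M [set z | Q (table z)]).
Proof. by apply: sum_fibers; exact: measurable_table. Qed.

Lemma sum_dlaw (h : S -> S -> {ffun S * S -> S} -> R) :
  \sum_t dlaw t * h t.1.1 t.1.2 t.2 =
  \sum_a \sum_b \sum_tau
    mu M a * mu M b * fine (nu M [set z | table z = tau]) * h a b tau.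
Proof.
rewrite pair_big pair_big /=.
by apply: eq_bigr => -[[a b] tau].
Qed.

Lemma dlaw_parent (g : S -> R) : \sum_t dlaw t * g (parent t) = \sum_x mu M x * g x.
Proof.
etransitivity; first exact: (sum_dlaw (fun a b tau => g (tau (a, b)))).
have E1 a b : \sum_tau mu M a * mu M b * fine (nu M [set z | table z = tau]) * g (tau (a, b)) =
    \sum_x mu M a * mu M b * fine (nu M [set z | phi M a b z = x]) * g x.
  rewrite (partition_big (fun tau : {ffun S * S -> S} => tau (a, b)) predT)//=.
  apply: eq_bigr => x _.
  have -> : fine (nu M [set z | phi M a b z = x]) =
      \sum_(tau : {ffun S * S -> S} | tau (a, b) == x) fine (nu M [set z | table z = tau]).
    rewrite sum_table; congr (fine (nu M _)).
    by apply/seteqP; split=> z /=; rewrite ffunE => /eqP.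
  rewrite big_distrr big_distrl/=; apply: eq_bigr => tau /eqP <-.
  by [].
under eq_bigr do under eq_bigr do rewrite E1.
under eq_bigr do rewrite exchange_big.
rewrite exchange_big/=; apply: eq_bigr => x _.
rewrite -(phi_image M x) big_distrl; apply: eq_bigr => a _ /=.
by rewrite big_distrl.
Qed.

(** The point where [P2] enters: when one daughter changes from [a] to [x1] while the sibling and
    the table are shared, the pair of old and new values at the parent has law [P2 M (a, x1)].
    Symmetry of [phi] reduces [b = true] to the other case. *)
Lemma dlaw_pair (b : bool) (k : S -> S -> R) x y :
  \sum_t dlaw t * ((\sum_x1 k (if b then t.1.2 else t.1.1) x1 *
      (t.2 (x1, if b then t.1.1 else t.1.2) == y)%:R) * (parent t == x)%:R) =
  \sum_a \sum_x1 mu M a * k a x1 * P2 M (a, x1) (x, y).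
Proof.
have main (q : S -> S -> {ffun S * S -> S} -> bool) :
    (forall a b' z, q a b' (table z) = (phi M a b' z == x)) ->
    \sum_a \sum_b' \sum_tau mu M a * mu M b' * fine (nu M [set z | table z = tau]) *
    ((\sum_x1 k a x1 * (tau (x1, b') == y)%:R) * (q a b' tau)%:R) =
    \sum_a \sum_x1 mu M a * k a x1 * P2 M (a, x1) (x, y).
  move=> qE.
  have key a b' x1 : \sum_tau fine (nu M [set z | table z = tau]) *
      ((tau (x1, b') == y)%:R * (q a b' tau)%:R) =
      fine (nu M [set z | phi M a b' z = x /\ phi M x1 b' z = y]).
    rewrite (_ : [set z | _ /\ _] = [set z | q a b' (table z) && (table z (x1, b') == y)]).
      rewrite -(sum_table (fun tau => q a b' tau && (tau (x1, b') == y))).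
      rewrite [RHS]big_mkcond; apply: eq_bigr => tau _.
      by case: (q a b' tau); case: eqP => _; rewrite ?(mulr0, mul0r, mulr1, mul1r).
    apply/seteqP; split=> z /=; rewrite qE !ffunE/=.
      by move=> [-> ->]; rewrite !eqxx.
    by move=> /andP[/eqP -> /eqP ->].
  apply: eq_bigr => a _.
  transitivity (\sum_b' \sum_x1 \sum_tau mu M a * mu M b' * fine (nu M [set z | table z = tau]) *
    (k a x1 * (tau (x1, b') == y)%:R * (q a b' tau)%:R)).
    apply: eq_bigr => b' _; rewrite exchange_big/=; apply: eq_bigr => tau _.
    by rewrite big_distrl big_distrr.
  rewrite exchange_big/=; apply: eq_bigr => x1 _.
  rewrite /P2 big_distrr/=; apply: eq_bigr => b' _.
  rewrite -key !big_distrr/=; apply: eq_bigr => tau _; ring.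
case: b.
  rewrite -(main (fun a b tau => tau (b, a) == x)) => [|a b z]; last by rewrite ffunE phiC.
  rewrite exchange_big/=; etransitivity.
    exact: (sum_dlaw (fun a b tau => (\sum_x1 k b x1 *
      (tau (x1, a) == y)%:R) * (tau (a, b) == x)%:R)).
  apply: eq_bigr => a _; apply: eq_bigr => b _; apply: eq_bigr => tau _.
  by rewrite [mu M b * _]mulrC.
rewrite -(main (fun a b tau => tau (a, b) == x)) => [|a b z]; last by rewrite ffunE.
exact: (sum_dlaw (fun a b tau => (\sum_x1 k a x1 *
      (tau (x1, b) == y)%:R) * (tau (a, b) == x)%:R)).
Qed.

(** Positivity of [mu] in a usable form: each value at [u] is produced by some data of positive
    mass, which [sqint_chg] needs. *)
Lemma sum_dlaw_gt0 y : exists2 t, 0 < dlaw t & parent t = y.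
Proof.
apply: contrapT => /forall2NP H.
have := mu_gt0 M y.
have -> : mu M y = \sum_t dlaw t * (parent t == y)%:R.
  rewrite (dlaw_parent (fun x => (x == y)%:R)) (bigD1 y)//= eqxx mulr1 big1 ?addr0//.
  by move=> x /negbTE ->; rewrite mulr0.
rewrite big1 ?ltxx// => t _; have [/eqP py|] := eqP; last by rewrite mulr0.
case: (H t) => [/negP|//]; last by rewrite (eqP py).
by rewrite lt_neqAle dlaw_ge0 andbT negbK => /eqP <-; rewrite mul0r.
Qed.

(* Resets all the data recorded by daughters u: functions of kill u w are
   independent of daughters u w. *)
Definition kill u w : tree_space M := build M (size u).+1
  (fun v => if (v == rcons u false) || (v == rcons u true) then xi (point : tree_space M) v else xi w v)
  (fun v => if v == u then eps (point : tree_space M) v else eps w v).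

Lemma daughters_indep u t A : measurable A ->
  (m ([set w | daughters u w = t] `&` kill u @^-1` A) = (dlaw t)%:E * m (kill u @^-1` A))%E.
Proof.
move=> mA; case: t => -[a b] tau.
pose AA v : {set S} := if v == rcons u false then [set a]%SET
  else if v == rcons u true then [set b]%SET else finset.setT.
pose BB v : set E := if v == u then [set z | table z = tau] else setT.
have ft : (rcons u true == rcons u false) = false by rewrite eqseq_rcons eqxx.
have -> : [set w | daughters u w = (a, b, tau)] = rect (size u).+1 AA BB.
  apply/seteqP; split=> w /=.
    move=> [wa wb wt]; split=> v vn.
      rewrite /AA; case: eqP => [->|_]; first by rewrite inE wa.
      by case: eqP => [->|_]; rewrite inE// wb.
    by rewrite /BB; case: eqP => [->|].
  move=> [wA wB]; rewrite /daughters.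
  have := wA (rcons u false); rewrite size_rcons /AA eqxx inE => /(_ erefl) /eqP ->.
  have := wA (rcons u true); rewrite size_rcons /AA ft eqxx inE => /(_ erefl) /eqP ->.
  by have := wB u (leqnn _); rewrite /BB eqxx /= => ->.
have mB v : measurable (BB v).
  by rewrite /BB; case: eqP => // _; exact: measurable_table.
rewrite (rect_indep hm mB); last first.
  apply: build_measurable mA; first exact: tree_sigma_algebra.
  - move=> v C vn; have [_|/norP[v1 v2]] := boolP ((v == rcons u false) || (v == rcons u true)).
      exact: (salg_cst (tree_sigma_algebra _ _ _) (C _)).
    by apply: tree_sigma_xi; rewrite /AA /= (negbTE v1) (negbTE v2).
  - move=> v C vn mC; have [_|vu] := boolP (v == u).
      exact: (salg_cst (tree_sigma_algebra _ _ _) (C _)).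
    by apply: tree_sigma_eps => //; rewrite /BB /= (negbTE vu).
congr (_%:E * _)%E; rewrite /rect_weight /dlaw /=.
have sT : \sum_(x in (finset.setT : {set S})) mu M x = 1.
  by rewrite -[RHS](mu_sum1 M); apply: eq_bigl => x; rewrite inE.
congr (_ * _).
  pose u0 : (size u).+1.-tuple bool := Tuple (introT eqP (size_rcons u false)).
  pose u1 : (size u).+1.-tuple bool := Tuple (introT eqP (size_rcons u true)).
  rewrite (bigD1 u0)//= (bigD1 u1)/=; last by apply/eqP => /(congr1 val)/eqP; rewrite /= ft.
  rewrite /AA eqxx big_set1 ft eqxx big_set1 big1 ?mulr1// => v /andP[v1 v2].
  have -> : (tval v == rcons u false) = false by apply: contraNF v1 => /eqP vv; apply/eqP/val_inj.
  have -> : (tval v == rcons u true) = false by apply: contraNF v2 => /eqP vv; apply/eqP/val_inj.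
  exact: sT.
rewrite (bigD1 ord_max)//= (bigD1 (in_tuple u))//= [X in X * _ * _]/=.
rewrite {1}/BB eqxx !big1 ?mulr1// => [k kn|v vu].
  rewrite big1// => v _; rewrite /BB; case: eqP => [vu|_]; last by rewrite probability_setT.
  by case/eqP: kn; apply: val_inj; have := congr1 size vu; rewrite size_tuple.
rewrite /BB; case: eqP => [vv|_]; last by rewrite probability_setT.
by case/eqP: vu; apply: val_inj.
Qed.

Lemma measurable_kill u : measurable_fun setT (kill u).
Proof.
move=> _ B mB; rewrite setTI; apply: build_measurable => //.
- exact: sigma_algebra_measurable.
- move=> v C vn; case: ((v == rcons u false) || (v == rcons u true)); last exact: measurable_xi.
  exact: (salg_cst (sigma_algebra_measurable _) (C _)).
- move=> v C vn mC; case: (v == u); last exact: measurable_eps.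
  exact: (salg_cst (sigma_algebra_measurable _) (C _)).
Qed.

Lemma measurable_daughters u t : measurable [set w : tree_space M | daughters u w = t].
Proof.
have -> : [set w | daughters u w = t] =
  [set w | [set t.1.1] (xi w (rcons u false))] `&`
  [set w | [set t.1.2] (xi w (rcons u true))] `&`
  [set w | [set z | table z = t.2] (eps w u)].
  by apply/seteqP; split=> w /=; [move=> <-|case: t => -[a b] tau /= [[<- <-] <-]].
apply: measurableI; first by apply: measurableI; exact: measurable_xi.
by apply: measurable_eps; exact: measurable_table.
Qed.

Lemma daughters_expect u (V : dtype -> R) (G : tree_space M -> R) :
  m.-integrable setT (EFin \o G) -> (forall w, G (kill u w) = G w) ->
  \int[m]_w (V (daughters u w) * G w) = (\sum_t dlaw t * V t) * \int[m]_w G w.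
Proof.
move=> Gi Gk; apply: (finite_indep_integral (k := kill u)) => //.
- exact: measurable_daughters.
- exact: measurable_kill.
- exact: dlaw_ge0.
- by move=> t A mA; exact: daughters_indep.
Qed.

End daughters.

(** * Second moments of finite kernels acting at a vertex *)

Lemma sqr_sum_le (R : realType) (I : finType) (a b : I -> R) (B : R) :
  0 <= B -> (forall i, `|a i| <= B) ->
  (\sum_i a i * b i) ^+ 2 <= #|I|%:R * B ^+ 2 * \sum_i b i ^+ 2.
Proof.
move=> B0 aB.
have CS : (\sum_i a i * b i) ^+ 2 <= (\sum_i a i ^+ 2) * (\sum_i b i ^+ 2).
  apply: quadratic_ge0; first by apply: sumr_ge0 => i _; exact: sqr_ge0.
  move=> t; rewrite -mulrnAr -sumrMnl !big_distrr -!big_split /=.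
  apply: sumr_ge0 => i _; have := sqr_ge0 (a i + t * b i); lra.
apply: le_trans CS _; apply: ler_wpM2r; first by apply: sumr_ge0 => i _; exact: sqr_ge0.
have : \sum_i a i ^+ 2 <= \sum_(i : I) B ^+ 2.
  apply: ler_sum => i _; rewrite -[a i ^+ 2]real_normK ?num_real//.
  by rewrite ler_pXn2r ?nnegrE.
by move=> /le_trans; apply; rewrite sumr_const mulr_natl.
Qed.

Section site_operators.
Context {R : realType} {S : finType} {d : measure_display}
  {E : measurableType d} (M : setting R S E).
Variable m : probability (tree_space M) R.
Hypothesis hm : tree_law m.
Local Notation Om := (tree_space M).
Local Notation dt := (@dtype S).
Implicit Types (n : nat) (v u : node) (w : Om) (f g : Om -> R) (V W : dt -> S -> R).

(* The kernel may depend on the values at the daughters of u, so that operators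
   acting at u and operators acting at a daughter of u are both covered. *)
Definition site_op u V f w : R :=
  \sum_y V (daughters u w) y * f (chg (size u) u y w).

Lemma chg_kill n u y w : size u = n ->
  agree n (chg n u y (kill u w)) (chg n u y w).
Proof.
move=> un; split=> v vn; rewrite ?xi_chg ?eps_chg//.
  case: eqP => // /eqP vu; rewrite xi_phi [RHS]xi_phi.
  rewrite /kill !xi_build ?size_rcons ?vn ?un// eps_build ?vn ?un//.
  by rewrite !eqseq_rcons (negbTE vu).
rewrite /kill eps_build ?un ?(ltnW vn)//; first by case: eqP => // vu; rewrite vu un ltnn in vn.
by rewrite ltnS ltnW.
Qed.

Lemma level_chg_kill n u y f w : size u = n -> level n f ->
  f (chg n u y (kill u w)) = f (chg n u y w).
Proof. by move=> un /levelP; apply; exact: chg_kill. Qed.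

Lemma measurable_chg_fun n u y f : measurable_fun setT f ->
  measurable_fun setT (fun w => f (chg n u y w)).
Proof. by move=> mf; apply: measurableT_comp => //; exact: measurable_chg. Qed.

(** On the event [daughters u w = t] with [parent t = y], [chg] alters nothing that [f] sees, and
    this event is independent of the changed configuration. So [dlaw t] times the integral of the
    changed square is at most the integral of [f ^+ 2], and some such [t] has positive mass. *)
Lemma sqint_chg u y f : level (size u) f -> sqint m f ->
  sqint m (fun w => f (chg (size u) u y w)).
Proof.
move=> lf [mf fi]; have mc := measurable_chg_fun (size u) u y mf; split => //.
have [t t0 ty] := sum_dlaw_gt0 M y.
have msq g : measurable_fun setT g -> measurable_fun setT (fun w => (g w ^+ 2)%:E).
  by move=> mg; apply/measurable_EFinP; exact: measurable_funX.
have sq0 g w : (0 <= (g w ^+ 2)%:E)%E by rewrite lee_fin sqr_ge0.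
have E1 := ge0_indep_integral (measurable_daughters M u t) (@measurable_kill _ _ _ _ M u)
  (dlaw_ge0 M t) (fun A mA => daughters_indep hm u t mA) (msq _ mc) (sq0 _)
  (fun w => congr1 (fun x => (x ^+ 2)%:E) (level_chg_kill y w erefl lf)).
have : ((dlaw M t)%:E * \int[m]_w (f (chg (size u) u y w) ^+ 2)%:E < +oo)%E.
  rewrite -E1; apply: le_lt_trans fi.
  rewrite (eq_integral (fun w => (f w ^+ 2)%:E)).
    apply: ge0_subset_integral => //; [exact: measurable_daughters|exact: msq].
  move=> w; rewrite inE => /= Dw; congr ((_ ^+ 2)%:E).
  move/levelP : lf; apply; rewrite -{1}ty -Dw parent_daughters; exact: chg_id.
have i0 : (0 <= \int[m]_w (f (chg (size u) u y w) ^+ 2)%:E)%E by exact: integral_ge0.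
move: (\int[m]_w _)%E i0 => [x||]//= _ lt; first by rewrite ltry.
by move: lt; rewrite mulry gtr0_sg// mul1e.
Qed.

Lemma measurable_daughters_fun u (h : dt -> R) :
  measurable_fun setT (fun w => h (daughters u w)).
Proof.
move=> _ B mB; rewrite setTI.
have -> : (fun w => h (daughters u w)) @^-1` B =
    [set w | exists t, daughters u w = t /\ B (h t)].
  by apply/seteqP; split=> w /= => [Bw|[t [->]]//]; exists (daughters u w).
apply: salg_ex => [|t]; first exact: sigma_algebra_measurable.
apply: (salgI (sigma_algebra_measurable _)); first exact: measurable_daughters.
exact: (salg_cst (sigma_algebra_measurable _)).
Qed.

Lemma sqint_daughters u (h : dt -> R) f : sqint m f ->
  sqint m (fun w => h (daughters u w) * f w).
Proof.
move=> sf; pose B := \sum_t `|h t|.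
have B0 : 0 <= B by exact: sumr_ge0.
apply: (@sqint_le _ _ _ _ _ (fun w => B * f w)).
- by apply: measurable_funM; [exact: measurable_daughters_fun|exact: sf.1].
- exact: sqintZ.
move=> w; rewrite !exprMn ler_wpM2r ?sqr_ge0//.
rewrite -[X in X <= _]real_normK ?num_real// ler_pXn2r ?nnegrE//.
by rewrite /B (bigD1 (daughters u w))//= lerDl sumr_ge0.
Qed.

(** By independence the kernels enter an inner product only through their second moments under
    [dlaw]. All later orthogonality relations are statements about such finite sums. *)
Lemma sum_pair_expect u V W (f_ g_ : S -> Om -> R) :
  (forall y, sqint m (f_ y)) -> (forall y, sqint m (g_ y)) ->
  (forall y w, f_ y (kill u w) = f_ y w) -> (forall y w, g_ y (kill u w) = g_ y w) ->
  \int[m]_w ((\sum_y V (daughters u w) y * f_ y w) *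
             (\sum_x W (daughters u w) x * g_ x w)) =
  \sum_y \sum_x (\sum_t dlaw M t * (V t y * W t x)) * \int[m]_w (f_ y w * g_ x w).
Proof.
move=> sf sg fk gk.
have I2 y x : m.-integrable setT (EFin \o (fun w =>
    (V (daughters u w) y * W (daughters u w) x) * (f_ y w * g_ x w))).
  have := sqintM (sqint_daughters u (fun t => V t y * W t x) (sf y)) (sg x).
  by apply: eq_integrable => // w _; rewrite /= mulrA.
rewrite (eq_Rintegral m (g := fun w => \sum_y \sum_x
    (V (daughters u w) y * W (daughters u w) x) * (f_ y w * g_ x w))); last first.
  move=> w _; rewrite big_distrl; apply: eq_bigr => y _; rewrite big_distrr.
  by apply: eq_bigr => x _ /=; ring.
rewrite (Rintegral_sum _ (fun y => (Rintegral_sum _ (I2 y)).1)).2.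
apply: eq_bigr => y _; rewrite (Rintegral_sum _ (I2 y)).2; apply: eq_bigr => x _.
rewrite (daughters_expect hm (fun t => V t y * W t x))//.
  exact: sqintM.
by move=> w; rewrite fk gk.
Qed.

Lemma site_op_pair u V W f g : level (size u) f -> level (size u) g ->
  sqint m f -> sqint m g ->
  \int[m]_w (site_op u V f w * site_op u W g w) =
  \sum_y \sum_x (\sum_t dlaw M t * (V t y * W t x)) *
    \int[m]_w (f (chg (size u) u y w) * g (chg (size u) u x w)).
Proof.
move=> lf lg sf sg; apply: sum_pair_expect => [y|y|y w|y w].
- exact: sqint_chg.
- exact: sqint_chg.
- exact: level_chg_kill.
- exact: level_chg_kill.
Qed.

(** The kernel of the identity on functions of the level of [u]; it brings such a function into the
    form required by [site_op_pair]. *)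
Definition dirac_kernel (t : dt) (y : S) : R := (parent t == y)%:R.

Lemma site_op_dirac u f w : level (size u) f -> site_op u dirac_kernel f w = f w.
Proof.
move=> /levelP lf; rewrite /site_op (bigD1 (xi w u))//= big1 ?addr0.
  by rewrite /dirac_kernel parent_daughters eqxx mul1r; apply: lf; exact: chg_id.
by move=> y; rewrite /dirac_kernel parent_daughters eq_sym => /negbTE ->; rewrite mul0r.
Qed.

Lemma site_op_sqint u V f : level (size u) f -> sqint m f -> sqint m (site_op u V f).
Proof.
move=> lf sf; apply: sqint_sum => y; apply: (sqint_daughters u (fun t => V t y)).
exact: sqint_chg.
Qed.

Lemma site_op_level u V f : level (size u) f -> level (size u).+1 (site_op u V f).
Proof.
move=> lf; apply/levelP => w w' ww; apply: eq_bigr => y _.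
have -> : daughters u w = daughters u w'.
  by rewrite /daughters !ww.1 ?size_rcons// ww.2.
by congr (_ * _); move/levelP: lf; apply; apply: agree_chg; exact: agreeS.
Qed.

Lemma site_op_level_parent u (k : S -> S -> R) f : level (size u) f ->
  level (size u) (site_op u (fun t => k (parent t)) f).
Proof.
move=> lf; apply/levelP => w w' ww; apply: eq_bigr => y _.
rewrite !parent_daughters ww.1//; congr (_ * _).
by move/levelP: lf; apply; exact: agree_chg.
Qed.

(** The last hypothesis says that [V] has mean zero given [xi_u], while [site_op v W g] depends on
    the data at [u] and its daughters through [xi_u] alone. *)
Lemma site_op_orth u v V W f g : size v = size u -> u != v ->
  level (size u) f -> level (size u) g -> sqint m f -> sqint m g ->
  (forall x y, \sum_t dlaw M t * (V t y * dirac_kernel t x) = 0) ->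
  \int[m]_w (site_op u V f w * site_op v W g w) = 0.
Proof.
move=> vu uv lf lg sf sg V0; set n := size u in vu lf lg *.
(* Fixing the value at [u] to [x] leaves a function invariant under [kill u]; the Dirac kernel then
   restores the true value of [xi_u]. *)
pose g_ x w := \sum_z W (daughters v w) z * g (chg n v z (chg n u x w)).
have gE w : site_op v W g w = \sum_x dirac_kernel (daughters u w) x * g_ x w.
  rewrite (bigD1 (xi w u))//= big1 ?addr0 /dirac_kernel parent_daughters.
    rewrite eqxx mul1r /site_op vu; apply: eq_bigr => z _; congr (_ * _).
    move/levelP: lg => lg; apply: lg; apply: agree_chg.
    by have [a b] := chg_id n u w; split=> t tn; rewrite ?a ?b.
  by move=> y; rewrite eq_sym => /negbTE ->; rewrite mul0r.
rewrite (eq_Rintegral m (g := fun w => site_op u V f w *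
    \sum_x dirac_kernel (daughters u w) x * g_ x w)); last by move=> w _; rewrite gE.
rewrite sum_pair_expect.
- by rewrite big1// => y _; rewrite big1// => x _; rewrite V0 mul0r.
- by move=> y; exact: sqint_chg.
- move=> x; apply: sqint_sum => z; apply: (sqint_daughters v (fun t => W t z)).
  apply: (@sqint_chg u x (fun w => g (chg n v z w))); first exact: level_chg.
  by rewrite -vu; apply: sqint_chg => //; rewrite vu.
- by move=> y w; exact: level_chg_kill.
move=> x w; apply: eq_bigr => z _; congr (_ * _).
  have dk : daughters v (kill u w) = daughters v w.
    rewrite /daughters /kill !xi_build ?size_rcons ?vu// eps_build ?vu//.
    by rewrite !eqseq_rcons eq_sym (negbTE uv).
  by rewrite dk.
by move/levelP: lg; apply; apply: agree_chg; exact: chg_kill.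
Qed.

Lemma site_op_daughter u (b : bool) (k : S -> S -> R) f w : level (size u) f ->
  site_op (rcons u b) (fun t => k (parent t)) f w =
  site_op u (fun t y => \sum_x1 k (if b then t.1.2 else t.1.1) x1 *
      (t.2 (x1, if b then t.1.1 else t.1.2) == y)%:R) f w.
Proof.
move=> lf; rewrite /site_op size_rcons.
under [RHS]eq_bigr do rewrite big_distrl.
rewrite exchange_big/=; apply: eq_bigr => x1 _.
rewrite parent_daughters.
set z := table M (eps w u) _.
rewrite (bigD1 z)//= eqxx mulr1 big1 ?addr0; last first.
  by move=> y; rewrite eq_sym => /negbTE ->; rewrite mulr0 mul0r.
have -> : (if b then xi w (rcons u true) else xi w (rcons u false)) = xi w (rcons u b).
  by case: (b).
congr (_ * _); move/levelP: lf => lf; rewrite (lf _ _ (chg_daughter u b x1 w)).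
by rewrite /z ffunE /=; case: (b).
Qed.

Lemma expect_sites u f g : level (size u) f -> level (size u) g ->
  sqint m f -> sqint m g -> \int[m]_w (f w * g w) =
  \sum_y mu M y * \int[m]_w (f (chg (size u) u y w) * g (chg (size u) u y w)).
Proof.
move=> lf lg sf sg.
rewrite (eq_Rintegral m (g := fun w => site_op u dirac_kernel f w * site_op u dirac_kernel g w)).
  rewrite site_op_pair//; apply: eq_bigr => y _.
  rewrite (bigD1 y)//= [X in _ + X]big1 ?addr0 => [|x xy].
    congr (_ * _); under eq_bigr do rewrite -natrM mulnb andbb.
    rewrite (dlaw_parent M (fun x => (x == y)%:R)) (bigD1 y)//= eqxx mulr1 big1 ?addr0//.
    by move=> x /negbTE ->; rewrite mulr0.
  rewrite big1 ?mul0r// => t _; rewrite -natrM mulnb.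
  by case: eqP => [->|_]; rewrite /= ?mulr0// eq_sym (negbTE xy) mulr0.
by move=> w _; rewrite !site_op_dirac.
Qed.

Lemma Rintegral_sqr_ge0 f : 0 <= \int[m]_w (f w * f w).
Proof. by apply: Rintegral_ge0 => w _; rewrite -expr2 sqr_ge0. Qed.

Lemma expect_site_le u y f : level (size u) f -> sqint m f ->
  \int[m]_w (f (chg (size u) u y w) * f (chg (size u) u y w)) <=
  (mu M y)^-1 * \int[m]_w (f w * f w).
Proof.
move=> lf sf; rewrite -ler_pdivrMl ?invr_gt0 ?mu_gt0// invrK (expect_sites lf lf)//.
rewrite (bigD1 y)//= lerDl; apply: sumr_ge0 => z _.
by rewrite mulr_ge0 ?(ltW (mu_gt0 _ _))// Rintegral_sqr_ge0.
Qed.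

(** The family [f_] need not be [f] evaluated along [chg]: for kernels that annihilate constants it
    will be differences of such values, so that the bound is by energy instead of norm. *)
Lemma site_op_le u V (f_ : S -> Om -> R) f (B : R) : 0 <= B ->
  (forall t y, `|V t y| <= B) -> (forall y, sqint m (f_ y)) -> sqint m (site_op u V f) ->
  (forall w, site_op u V f w = \sum_y V (daughters u w) y * f_ y w) ->
  \int[m]_w (site_op u V f w * site_op u V f w) <=
  #|S|%:R * B ^+ 2 * \sum_y \int[m]_w (f_ y w * f_ y w).
Proof.
move=> B0 VB sf sV VE.
have I1 y : m.-integrable setT (EFin \o (fun w => f_ y w * f_ y w)) by exact: sqintM.
rewrite -(Rintegral_sum _ I1).2 -RintegralZl//; last exact: (Rintegral_sum _ I1).1.
apply: le_Rintegral => //.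
- exact: sqintM.
- have := integrableZl measurableT (#|S|%:R * B ^+ 2) (Rintegral_sum (index_enum S) I1).1.
  by apply: eq_integrable => // w _; rewrite /= EFinM.
move=> w _; rewrite -expr2 VE.
apply: le_trans (sqr_sum_le _ B0 (VB (daughters u w))) _.
by under [X in _ * X]eq_bigr do rewrite expr2.
Qed.

End site_operators.

(** * Operators acting at a vertex *)

Section energy_kernels.
Context {R : realType} {S : finType} {d : measure_display}
  {E : measurableType d} (M : setting R S E).
Variable m : probability (tree_space M) R.
Hypothesis hm : tree_law m.
Local Notation Om := (tree_space M).
Local Notation dt := (@dtype S).
Implicit Types (n : nat) (v u : node) (w : Om) (f g : Om -> R) (V W : dt -> S -> R).
Implicit Types (a : offdiag S -> R).

Definition grad (x : S) (q : S * S) : R := (q.1 == x)%:R - (q.2 == x)%:R.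

Definition energy_matrix a (x y : S) : R :=
  2^-1 * \sum_p a p * (grad x (val p) * grad y (val p)).

(** Row [x] is divided by [mu x] because the inner product of L2(S, mu) carries that weight: this is
    the kernel of the operator K_a. *)
Definition energy_kernel a (x y : S) : R := energy_matrix a x y / mu M x.

Definition parent_kernel a (t : dt) (y : S) : R := energy_kernel a (parent t) y.

Lemma sum_grad (h : S -> R) q : \sum_x grad x q * h x = h q.1 - h q.2.
Proof.
have E1 z : \sum_x (z == x)%:R * h x = h z.
  by rewrite (bigD1 z)//= eqxx mul1r big1 ?addr0// => x; rewrite eq_sym => /negbTE ->; rewrite mul0r.
by under eq_bigr do rewrite mulrBl; rewrite sumrB !E1.
Qed.

Lemma sum_energy_matrix a (c : S -> S -> R) :
  \sum_x \sum_y energy_matrix a x y * c x y =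
  2^-1 * \sum_p a p * (c (val p).1 (val p).1 - c (val p).1 (val p).2 -
                       (c (val p).2 (val p).1 - c (val p).2 (val p).2)).
Proof.
transitivity (2^-1 * \sum_p a p * \sum_x grad x (val p) * \sum_y grad y (val p) * c x y).
  rewrite big_distrr/=.
  under eq_bigr do under eq_bigr do rewrite /energy_matrix -mulrA big_distrl big_distrr/=.
  under eq_bigr do rewrite exchange_big/=.
  rewrite exchange_big/=; apply: eq_bigr => p _.
  rewrite mulrA !big_distrr/=; apply: eq_bigr => x _.
  rewrite mulrA big_distrr/=; apply: eq_bigr => y _; ring.
congr (_ * _); apply: eq_bigr => p _; congr (_ * _).
by under eq_bigr do rewrite sum_grad; rewrite sum_grad.
Qed.

Lemma energy_kernel_apply a (g : S -> R) x : \sum_y energy_kernel a x y * g y =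
  (mu M x)^-1 * (2^-1 * \sum_p a p * (grad x (val p) * (g (val p).1 - g (val p).2))).
Proof.
under eq_bigr do rewrite /energy_kernel mulrAC mulrC; rewrite -big_distrr/=; congr (_ * _).
under eq_bigr do rewrite /energy_matrix -mulrA big_distrl/= .
rewrite -big_distrr/=; congr (_ * _); rewrite exchange_big/=; apply: eq_bigr => p _.
rewrite -sum_grad !big_distrr/=; apply: eq_bigr => y _; ring.
Qed.

Lemma mu_energy_kernel a x y : mu M x * energy_kernel a x y = energy_matrix a x y.
Proof. by rewrite mulrC divfK// gt_eqF// mu_gt0. Qed.

Lemma energy_kernel_sum0 a x : \sum_y energy_kernel a x y = 0.
Proof.
have := energy_kernel_apply a (fun=> 1) x; under eq_bigr do rewrite mulr1.
by move=> ->; rewrite big1 ?mulr0// => p _; rewrite subrr !mulr0.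
Qed.

Lemma site_op_energy u a f g : level (size u) f -> level (size u) g ->
  sqint m f -> sqint m g ->
  \int[m]_w (f w * site_op u (parent_kernel a) g w) =
  2^-1 * \sum_p a p * \int[m]_w
    ((f (chg (size u) u (val p).1 w) - f (chg (size u) u (val p).2 w)) *
     (g (chg (size u) u (val p).1 w) - g (chg (size u) u (val p).2 w))).
Proof.
move=> lf lg sf sg.
rewrite (eq_Rintegral m (g := fun w => site_op u (@dirac_kernel R S) f w *
    site_op u (parent_kernel a) g w)); last by move=> w _; rewrite site_op_dirac.
rewrite site_op_pair//.
pose c x y := \int[m]_w (f (chg (size u) u x w) * g (chg (size u) u y w)).
transitivity (\sum_x \sum_y energy_matrix a x y * c x y).
  apply: eq_bigr => x _; apply: eq_bigr => y _; congr (_ * _).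
  rewrite (dlaw_parent M (fun z => (z == x)%:R * energy_kernel a z y)).
  rewrite (bigD1 x)//= eqxx mul1r big1 ?addr0 ?mu_energy_kernel//.
  by move=> z /negbTE ->; rewrite mul0r mulr0.
rewrite sum_energy_matrix; congr (_ * _); apply: eq_bigr => p _; congr (_ * _).
have sF x := sqint_chg hm x lf sf; have sG x := sqint_chg hm x lg sg.
have I1 x y := sqintM (sF x) (sG y).
have I2 x y z : m.-integrable setT (EFin \o (fun w =>
    f (chg (size u) u x w) * g (chg (size u) u y w) -
    f (chg (size u) u x w) * g (chg (size u) u z w))).
  have := integrableB measurableT (I1 x y) (I1 x z).
  by apply: eq_integrable => // w _; rewrite /= EFinB.
pose G x y w := f (chg (size u) u x w) * g (chg (size u) u y w).
have E2 x y z : \int[m]_w (G x y w - G x z w) = c x y - c x z.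
  exact: (RintegralB measurableT (I1 x y) (I1 x z)).
rewrite -!E2 -(RintegralB measurableT (I2 _ _ _) (I2 _ _ _)).
by apply: eq_Rintegral => w _; rewrite /G; ring.
Qed.

(** The map a |-> a' of the overview. Mass that reaches the diagonal is dropped, so this is the
    action of P^(-) on row vectors, divided by [rho]. *)
Definition push_weight (rho : R) a : offdiag S -> R :=
  fun q => rho^-1 * \sum_p a p * P2 M (val p) (val q).

Lemma sum_P2 p (h : S * S -> R) : \sum_q P2 M p q * h q =
  \sum_x1 \sum_tau mu M x1 * fine (nu M [set z | table M z = tau]) *
    h (tau (p.1, x1), tau (p.2, x1)).
Proof.
have E1 q x1 : fine (nu M [set z | phi M p.1 x1 z = q.1 /\ phi M p.2 x1 z = q.2]) =
    \sum_tau fine (nu M [set z | table M z = tau]) *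
      (((tau (p.1, x1), tau (p.2, x1)) == q)%:R).
  transitivity (\sum_(tau : {ffun S * S -> S} | (tau (p.1, x1), tau (p.2, x1)) == q)
      fine (nu M [set z | table M z = tau])).
    rewrite (sum_table M (fun tau => (tau (p.1, x1), tau (p.2, x1)) == q)).
    congr (fine (nu M _)); apply/seteqP; split=> z /=; rewrite !ffunE/=.
      by move=> [-> ->]; case: (q) => ? ?; rewrite eqxx.
    by move=> /eqP <-.
  rewrite big_mkcond; apply: eq_bigr => tau _.
  by case: eqP; rewrite ?mulr1 ?mulr0.
under eq_bigr do rewrite /P2 big_distrl/=.
rewrite exchange_big/=; apply: eq_bigr => x1 _.
under eq_bigr do rewrite E1 big_distrr big_distrl/=.
rewrite exchange_big/=; apply: eq_bigr => tau _.
set q0 := (_, _); rewrite (bigD1 q0)//= eqxx mulr1 big1 ?addr0// => q.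
by rewrite eq_sym => /negbTE ->; rewrite !mulr0 mul0r.
Qed.

Lemma sum_offdiag (F : S * S -> R) : (forall x, F (x, x) = 0) ->
  \sum_(q : offdiag S) F (val q) = \sum_q F q.
Proof.
move=> F0; rewrite [RHS](bigID (fun q : S * S => q.1 != q.2))/= [X in _ = _ + X]big1 ?addr0.
  exact: (esym (big_sub [pred q : S * S | q.1 != q.2] F)).
by move=> [x y] /=; rewrite negbK => /eqP ->.
Qed.

Lemma push_matrix (rho : R) a x y : rho != 0 ->
  \sum_z \sum_x1 mu M z * energy_kernel a z x1 * P2 M (z, x1) (x, y) =
  rho * energy_matrix (push_weight rho a) x y.
Proof.
move=> rho0.
under eq_bigr do under eq_bigr do rewrite mu_energy_kernel.
rewrite (sum_energy_matrix a (fun z x1 => P2 M (z, x1) (x, y))).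
rewrite /energy_matrix mulrCA; congr (_ * _).
have P2E z z' : P2 M (z, z') (x, y) = \sum_x1 \sum_tau mu M x1 *
    fine (nu M [set z0 | table M z0 = tau]) *
    (((tau (z, x1), tau (z', x1)) == (x, y))%:R).
  rewrite -(sum_P2 (z, z') (fun q => (q == (x, y))%:R)) (bigD1 (x, y))//= eqxx mulr1.
  by rewrite big1 ?addr0// => q /negbTE ->; rewrite mulr0.
(* For a fixed sibling [x1] and table [tau] both sides are the same second difference of the
   indicator of [(x, y)], taken at the images of [p.1] and [p.2]; coinciding images contribute 0. *)
have E1 (p : offdiag S) :
    P2 M ((val p).1, (val p).1) (x, y) - P2 M ((val p).1, (val p).2) (x, y) -
    (P2 M ((val p).2, (val p).1) (x, y) - P2 M ((val p).2, (val p).2) (x, y)) =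
    \sum_(q : offdiag S) P2 M (val p) (val q) * (grad x (val q) * grad y (val q)).
  rewrite (sum_offdiag (F := fun q => P2 M (val p) q * (grad x q * grad y q))); last first.
    by move=> z; rewrite /grad subrr mul0r mulr0.
  rewrite sum_P2 !P2E -!sumrB; apply: eq_bigr => x1 _; rewrite -!sumrB.
  apply: eq_bigr => tau _; rewrite -!mulrBr; congr (_ * _).
  by rewrite /grad /= !xpair_eqE; do 4! case: (_ == _); rewrite /=; ring.
under eq_bigr do rewrite E1 big_distrr/=.
rewrite exchange_big/= big_distrr/=; apply: eq_bigr => q _.
rewrite /push_weight -[X in rho * X]mulrA mulVKf// big_distrl/=.
by apply: eq_bigr => p _; ring.
Qed.

(* Changing the value at one daughter of u to x1 changes the value at u to
   phi(x1, the value at the other daughter, eps_u). *)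
Definition daughter_kernel (b : bool) a (t : dt) (y : S) : R :=
  \sum_x1 energy_kernel a (if b then t.1.2 else t.1.1) x1 *
    (t.2 (x1, if b then t.1.1 else t.1.2) == y)%:R.

Lemma daughter_kernel_law b (rho : R) a x y : rho != 0 ->
  \sum_t dlaw M t * (daughter_kernel b a t y * dirac_kernel t x) =
  rho * energy_matrix (push_weight rho a) x y.
Proof. by move=> rho0; rewrite -push_matrix//; exact: (dlaw_pair M b). Qed.

Lemma parent_kernel_law a x y :
  \sum_t dlaw M t * (parent_kernel a t y * dirac_kernel t x) = energy_matrix a x y.
Proof.
rewrite (dlaw_parent M (fun z => energy_kernel a z y * (z == x)%:R)).
rewrite (bigD1 x)//= eqxx mulr1 big1 ?addr0 ?mu_energy_kernel//.
by move=> z /negbTE ->; rewrite !mulr0.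
Qed.

(** Up to the factor [(2 * rho) ^- n], the contribution of a vertex [u] of generation [n] to
    B_(n+1)(a) - B_n(a'), its two daughters being grouped with it. *)
Definition step_kernel (rho : R) a (t : dt) (y : S) : R :=
  (2 * rho)^-1 * (daughter_kernel false a t y + daughter_kernel true a t y) -
  parent_kernel (push_weight rho a) t y.

(** Each daughter contributes [(2 * rho)^-1 * rho], that is one half, of the matrix of
    [push_weight rho a], and the parent term cancels the two halves. So the kernel has mean zero
    given [xi_u], which is what singles out the scaling by [2 * rho]. *)
Lemma step_kernel_law (rho : R) a x y : rho != 0 ->
  \sum_t dlaw M t * (step_kernel rho a t y * dirac_kernel t x) = 0.
Proof.
move=> rho0.
rewrite (eq_bigr (fun t => (2 * rho)^-1 * (dlaw M t * (daughter_kernel false a t y * dirac_kernel t x)) +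
  (2 * rho)^-1 * (dlaw M t * (daughter_kernel true a t y * dirac_kernel t x)) -
  dlaw M t * (parent_kernel (push_weight rho a) t y * dirac_kernel t x))); last first.
  by move=> t _; rewrite /step_kernel; ring.
rewrite sumrB big_split/= -!big_distrr/= !(daughter_kernel_law _ _ _ _ rho0) parent_kernel_law.
by field.
Qed.

(** A kernel that annihilates constants sees only differences between states at [u], and these are
    controlled by the energy; see [hop_sum0_le]. *)
Lemma step_kernel_sum0 (rho : R) a t : \sum_y step_kernel rho a t y = 0.
Proof.
rewrite /step_kernel sumrB -big_distrr big_split/= energy_kernel_sum0 subr0.
have D0 b : \sum_y daughter_kernel b a t y = 0.
  rewrite exchange_big/= -[RHS](energy_kernel_sum0 a (if b then t.1.2 else t.1.1)).
  apply: eq_bigr => x1 _; rewrite -big_distrr/=.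
  set z := t.2 _; rewrite (bigD1 z)//= eqxx big1 ?addr0 ?mulr1// => y.
  by rewrite eq_sym => /negbTE ->.
by rewrite !D0 addr0 mulr0.
Qed.

Definition kernel_const : R := #|offdiag S|%:R * \sum_x (mu M x)^-1.

Lemma energy_kernel_le a (A : R) x y : (forall p, `|a p| <= A) ->
  `|energy_kernel a x y| <= kernel_const * A.
Proof.
move=> aA; have mux := mu_gt0 M x.
rewrite /energy_kernel normrM [X in _ * X]ger0_norm ?invr_ge0 ?(ltW mux)//.
have h1 : `|energy_matrix a x y| <= #|offdiag S|%:R * A.
  rewrite normrM ger0_norm//.
  have : `|\sum_p a p * (grad x (val p) * grad y (val p))| <= \sum_(p : offdiag S) A.
    apply: le_trans (ler_norm_sum _ _ _) _; apply: ler_sum => p _.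
    rewrite normrM; apply: le_trans (aA p); apply: ler_piMr => //.
    have g1 z q : `|grad z q| <= 1.
      by rewrite /grad; do 2! case: (_ == _); rewrite /= ?(subrr, subr0, sub0r, normrN, normr0, normr1).
    by rewrite normrM -[1]mulr1 ler_pM.
  rewrite sumr_const -[A *+ _]mulr_natl; set b := `|_|; have : 0 <= b by exact: normr_ge0.
  move=> b0 bA; apply: le_trans bA; rewrite ler_piMl//; lra.
have h0 : 0 <= #|offdiag S|%:R * A by apply: le_trans h1.
rewrite /kernel_const mulrAC; apply: ler_pM => //; first by rewrite invr_ge0 ltW.
rewrite (bigD1 x)//= lerDl; apply: sumr_ge0 => z _.
by rewrite invr_ge0 ltW// mu_gt0.
Qed.

Lemma kernel_const_ge0 : 0 <= kernel_const.
Proof. by rewrite mulr_ge0// sumr_ge0// => x _; rewrite invr_ge0 ltW// mu_gt0. Qed.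

(** Two daughter kernels, each a sum over [S], and one parent kernel; the factor [(2 * rho)^-1] is
    at most 1. *)
Definition step_const : R := (2 * #|S|%:R + 1) * kernel_const.

Lemma step_const_ge0 : 0 <= step_const.
Proof. by rewrite mulr_ge0 ?kernel_const_ge0// addr_ge0// mulr_ge0. Qed.

Lemma step_kernel_le (rho : R) a (A : R) t y : 1 < 2 * rho ->
  (forall p, `|a p| <= A) -> (forall p, `|push_weight rho a p| <= A) ->
  `|step_kernel rho a t y| <= step_const * A.
Proof.
move=> rho1 aA pA; have rho0 : 0 < 2 * rho by apply: lt_trans rho1.
have DA b : `|daughter_kernel b a t y| <= #|S|%:R * (kernel_const * A).
  apply: le_trans (ler_norm_sum _ _ _) _.
  apply: (@le_trans _ _ (\sum_(x : S) kernel_const * A)).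
    apply: ler_sum => x1 _; rewrite normrM.
    apply: le_trans (energy_kernel_le (if b then t.1.2 else t.1.1) x1 aA).
    by rewrite ler_piMr//; case: (_ == _); rewrite /= ?normr0 ?normr1.
  by rewrite sumr_const mulr_natl.
apply: le_trans (ler_normB _ _) _.
have PA := energy_kernel_le (parent t) y pA.
rewrite /step_const; have -> : (2 * #|S|%:R + 1) * kernel_const * A =
  (#|S|%:R * (kernel_const * A) + #|S|%:R * (kernel_const * A)) + kernel_const * A by ring.
apply: lerD PA; rewrite normrM ger0_norm ?invr_ge0 ?(ltW rho0)//.
apply: (@le_trans _ _ `|daughter_kernel false a t y + daughter_kernel true a t y|).
  by rewrite ler_piMl// invf_le1// ltW.
by apply: le_trans (ler_normD _ _) _; exact: lerD.
Qed.

End energy_kernels.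

Section L2_operators.
Context {R : realType} {S : finType} {d : measure_display}
  {E : measurableType d} (M : setting R S E).
Variable m : probability (tree_space M) R.
Hypothesis hm : tree_law m.
Local Notation Om := (tree_space M).
Local Notation dt := (@dtype S).
Local Notation H := (L2 m).
Local Notation Hm := (@Hn R S d E M m).
Local Notation ip := (L2_ip m).
Let F : sform setT ip := L2_ip_sform m.
Implicit Types (n : nat) (v u : node) (w : Om) (f g : Om -> R) (V W : dt -> S -> R).
Implicit Types (a : offdiag S -> R) (h k : H).

Definition level_repr n f h : Prop :=
  [/\ measurable_fun setT f, level n f & represents f h].

Lemma HnP n h : Hm n h <-> exists f, level_repr n f h.
Proof.
split=> [[f [fh mf]]|[f [mf lf fh]]].
  by exists f; have [] := tree_fun_level mf; split.
by exists f; split => // B mB; exact: measurable_level.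
Qed.

Lemma level_repr_sqint n f h : level_repr n f h -> sqint m f.
Proof. by move=> [mf _ fh]; exact: represents_sqint fh. Qed.

Lemma level_reprD n f g h k : level_repr n f h -> level_repr n g k ->
  level_repr n (fun w => f w + g w) (h + k).
Proof.
move=> [mf lf fh] [mg lg gk]; split; [exact: measurable_funD| |exact: representsD].
by move=> w; rewrite lf lg.
Qed.

Lemma level_reprZ n (a : R) f h : level_repr n f h ->
  level_repr n (fun w => a * f w) (a *: h).
Proof.
move=> [mf lf fh]; split; [exact: measurable_funM| |exact: representsZ].
by move=> w; rewrite lf.
Qed.

Lemma level_reprB n f g h k : level_repr n f h -> level_repr n g k ->
  level_repr n (fun w => f w - g w) (h - k).
Proof.
move=> [mf lf fh] [mg lg gk]; split; [exact: measurable_funB| |exact: representsB].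
by move=> w; rewrite lf lg.
Qed.

Lemma level_repr_ip n n' f g h k : level_repr n f h -> level_repr n' g k ->
  ip h k = \int[m]_w (f w * g w).
Proof. by move=> [mf _ fh] [mg _ gk]; exact: L2_ipE. Qed.

Lemma Hn_incr n : Hm n `<=` Hm n.+1.
Proof.
move=> h /HnP[f [mf lf fh]]; apply/HnP; exists f; split => //; exact: levelS.
Qed.

Lemma Hn_sub n : [/\ Hm n 0, forall h k, Hm n h -> Hm n k -> Hm n (h + k) &
  forall (b : R) h, Hm n h -> Hm n (b *: h)].
Proof.
split.
- by apply/HnP; exists (fun=> 0); split; [exact: measurable_cst|by []|exact: represents0].
- by move=> h k /HnP[f fh] /HnP[g gk]; apply/HnP; eexists; exact: level_reprD fh gk.
- by move=> a h /HnP[f fh]; apply/HnP; eexists; exact: level_reprZ fh.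
Qed.

Lemma Hn0 n : Hm n 0. Proof. by have [] := Hn_sub n. Qed.
Lemma HnD n h k : Hm n h -> Hm n k -> Hm n (h + k).
Proof. by have [_ + _] := Hn_sub n; exact. Qed.
Lemma HnZ n (a : R) h : Hm n h -> Hm n (a *: h).
Proof. by have [_ _] := Hn_sub n; exact. Qed.
Lemma HnB n h k : Hm n h -> Hm n k -> Hm n (h - k).
Proof. by move=> hh kk; rewrite -scaleN1r; apply: HnD => //; exact: HnZ. Qed.

Lemma Hn_sum n (I : Type) (r : seq I) (G : I -> H) : (forall i, Hm n (G i)) ->
  Hm n (\sum_(i <- r) G i).
Proof.
move=> GH; elim: r => [|i r IH]; first by rewrite big_nil; exact: Hn0.
by rewrite big_cons; exact: HnD.
Qed.

(** The limit functional [G] acts on the values at each point, so the limit has the same invariance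
    as the approximating functions, everywhere and not only almost everywhere. *)
Lemma Hn_closed n : closed_set ip (Hm n).
Proof.
move=> u h uH uh.
have [f fP] := choice (fun i => (HnP n (u i)).1 (uH i)).
have [|||G [h' [mG Gh' uh']]] := @riesz_fischer _ _ _ m f u.
- by move=> k; case: (fP k).
- by move=> k; case: (fP k).
- move=> e e0; have [N NP] := uh _ (divr_gt0 e0 (ltr0n _ 4)).
  exists N => k l Nk Nl.
  apply: le_lt_trans (sf_sqrB_le F (g := h) I I I) _.
  rewrite (sf_sym F (I : setT h) (I : setT (u l))).
  by have := NP _ Nk; have := NP _ Nl; lra.
rewrite (small_eq (L2_hilbert m) uh uh'); apply/HnP; eexists; split; [exact: mG| |exact: Gh'].
by move=> w /=; congr G; apply/funext => k; case: (fP k).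
Qed.

Definition site_const : R := #|S|%:R * \sum_y (mu M y)^-1.

Lemma site_const_ge0 : 0 <= site_const.
Proof. by rewrite mulr_ge0// sumr_ge0// => y _; rewrite invr_ge0 ltW// mu_gt0. Qed.

Lemma site_op_bound u V f (B : R) : 0 <= B -> (forall t y, `|V t y| <= B) ->
  level (size u) f -> sqint m f ->
  \int[m]_w (site_op u V f w * site_op u V f w) <=
  site_const * B ^+ 2 * \int[m]_w (f w * f w).
Proof.
move=> B0 VB lf sf.
apply: le_trans (site_op_le B0 VB (fun y => sqint_chg hm y lf sf) (site_op_sqint hm V lf sf) _) _.
  by [].
have -> : site_const * B ^+ 2 * \int[m]_w (f w * f w) =
    #|S|%:R * B ^+ 2 * \sum_y (mu M y)^-1 * \int[m]_w (f w * f w).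
  by rewrite /site_const -big_distrl /=; ring.
rewrite ler_wpM2l ?mulr_ge0 ?sqr_ge0//; apply: ler_sum => y _.
exact: expect_site_le.
Qed.

Lemma sqint_ae0 f : sqint m f -> \int[m]_w (f w * f w) = 0 -> represents f (0 : H).
Proof.
move=> sf f0; have [h fh] := represents_ex sf.
rewrite -(L2_ip_def (h := h)) //.
by rewrite (L2_ipE sf.1 sf.1 fh fh).
Qed.

(* The value is 0 when h is not in Hn (size u). *)
Definition hop u V h : H := xget 0
  [set k | exists f, level_repr (size u) f h /\ represents (site_op u V f) k].

Definition kernel_bound V : R := \sum_t \sum_y `|V t y|.

Lemma kernel_boundP V t y : `|V t y| <= kernel_bound V.
Proof.
rewrite /kernel_bound (bigD1 t)//= (bigD1 y)//= -addrA lerDl addr_ge0//.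
  exact: sumr_ge0.
by apply: sumr_ge0 => *; exact: sumr_ge0.
Qed.

Lemma kernel_bound_ge0 V : 0 <= kernel_bound V.
Proof. by apply: sumr_ge0 => t _; exact: sumr_ge0. Qed.

Lemma site_opB u V f g w : site_op u V (fun w => f w - g w) w =
  site_op u V f w - site_op u V g w.
Proof. by rewrite -sumrB; apply: eq_bigr => y _; rewrite mulrBr. Qed.

(** It is not visible that [chg] respects null sets. Linearity and the bound [site_op_bound] show
    that a representative of 0 is sent to a null function. *)
Lemma site_op_unique u V f g h : level_repr (size u) f h -> level_repr (size u) g h ->
  site_op u V f = site_op u V g %[ae m].
Proof.
move=> fh gh; have fg := level_reprB fh gh; rewrite subrr in fg.
have sfg := level_repr_sqint fg; have [mfg lfg fg0] := fg.
have : represents (site_op u V (fun w => f w - g w)) (0 : H).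
  apply: sqint_ae0; first exact: site_op_sqint.
  apply/eqP; rewrite eq_le Rintegral_sqr_ge0 andbT.
  apply: le_trans (site_op_bound (kernel_bound_ge0 V) (kernel_boundP V) lfg sfg) _.
  by rewrite -(L2_ipE mfg mfg fg0 fg0) (sf0l F)// mulr0.
move=> Z; have := represents0 m; apply: filterS2 Z => w /(_ I) Z /(_ I) Z0 _.
by apply/eqP; rewrite -subr_eq0 -site_opB Z -Z0.
Qed.

Lemma hopP u V f h : level_repr (size u) f h -> represents (site_op u V f) (hop u V h).
Proof.
move=> fh; have [_ lf _] := fh; have sf := level_repr_sqint fh.
have [k0 k0P] := represents_ex (site_op_sqint hm V lf sf).
have [g [gh gk]] : exists g, level_repr (size u) g h /\ represents (site_op u V g) (hop u V h).
  by apply: (@xgetPex _ 0 [set k | exists f, level_repr (size u) f h /\ represents (site_op u V f) k]); exists k0, f.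
apply: filterS2 (site_op_unique V fh gh) gk => w /(_ I) -> /(_ I) -> _ //.
Qed.

Lemma hop_repr u V f h : level_repr (size u) f h ->
  level_repr (size u).+1 (site_op u V f) (hop u V h).
Proof.
move=> fh; have [_ lf _] := fh; split; last exact: hopP.
  exact: (site_op_sqint hm V lf (level_repr_sqint fh)).1.
exact: site_op_level.
Qed.

Lemma hop_parent_repr u (k : S -> S -> R) f h : level_repr (size u) f h ->
  level_repr (size u) (site_op u (fun t => k (parent t)) f) (hop u (fun t => k (parent t)) h).
Proof.
move=> fh; have [_ lf _] := fh; split; last exact: hopP.
  exact: (site_op_sqint hm _ lf (level_repr_sqint fh)).1.
exact: site_op_level_parent.
Qed.

Lemma hop_eq u V f h k : level_repr (size u) f h ->
  represents (site_op u V f) k -> hop u V h = k.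
Proof. by move=> fh fk; apply: (represents_eq (hopP V fh) fk). Qed.

Lemma hop_parent_Hn u (k : S -> S -> R) h : Hm (size u) h ->
  Hm (size u) (hop u (fun t => k (parent t)) h).
Proof. by move=> /HnP[f fh]; apply/HnP; eexists; exact: hop_parent_repr fh. Qed.

Lemma hop_lincomb u (b c : R) V W h : Hm (size u) h ->
  hop u (fun t y => b * V t y + c * W t y) h = b *: hop u V h + c *: hop u W h.
Proof.
move=> /HnP[f fh]; apply: (hop_eq fh).
have := representsD (representsZ b (hopP V fh)) (representsZ c (hopP W fh)).
congr represents; apply/funext => w.
by rewrite /site_op !big_distrr -big_split/=; apply: eq_bigr => y _; ring.
Qed.

Lemma hop_bound u V h (B : R) : 0 <= B -> (forall t y, `|V t y| <= B) -> Hm (size u) h ->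
  ip (hop u V h) (hop u V h) <= site_const * B ^+ 2 * ip h h.
Proof.
move=> B0 VB /HnP[f fh]; have [_ lf _] := fh.
rewrite (level_repr_ip (hop_repr V fh) (hop_repr V fh)) (level_repr_ip fh fh).
by apply: site_op_bound => //; exact: level_repr_sqint fh.
Qed.

Lemma hop_orth u v V W h k : size v = size u -> u != v -> Hm (size u) h -> Hm (size u) k ->
  (forall x y, \sum_t dlaw M t * (V t y * dirac_kernel t x) = 0) ->
  ip (hop u V h) (hop v W k) = 0.
Proof.
move=> vu uv /HnP[f fh] /HnP[g gk] V0.
have gk' : level_repr (size v) g k by rewrite vu.
rewrite (level_repr_ip (hop_repr V fh) (hop_repr W gk')).
have [[_ lf _] [_ lg _]] := (fh, gk).
by apply: site_op_orth => //; [exact: level_repr_sqint fh|exact: level_repr_sqint gk].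
Qed.

Lemma hop_orth_Hn u V h k : Hm (size u) h -> Hm (size u) k ->
  (forall x y, \sum_t dlaw M t * (V t y * dirac_kernel t x) = 0) ->
  ip (hop u V h) k = 0.
Proof.
move=> /HnP[f fh] /HnP[g gk] V0; have [[_ lf _] [_ lg _]] := (fh, gk).
rewrite (level_repr_ip (hop_repr V fh) gk).
rewrite (eq_Rintegral m (g := fun w => site_op u V f w * site_op u (@dirac_kernel R S) g w)).
  rewrite site_op_pair//; [|exact: level_repr_sqint fh|exact: level_repr_sqint gk].
  by rewrite big1// => y _; rewrite big1// => x _; rewrite V0 mul0r.
by move=> w _; rewrite site_op_dirac.
Qed.

Lemma hop_daughter u b a h : Hm (size u) h ->
  hop (rcons u b) (parent_kernel M a) h = hop u (daughter_kernel M b a) h.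
Proof.
move=> /HnP[f fh]; have [mf lf fh'] := fh.
have fh1 : level_repr (size (rcons u b)) f h.
  by rewrite size_rcons; split => //; exact: levelS.
apply: (hop_eq fh1); have := hopP (daughter_kernel M b a) fh; congr represents.
by apply/funext => w; rewrite -(site_op_daughter b (energy_kernel M a) w lf).
Qed.

Definition site_diff u (p : S * S) h : H := hop u (fun _ z => (z == p.1)%:R - (z == p.2)%:R) h.

Lemma site_diff_repr u p f h : level_repr (size u) f h -> represents
  (fun w => f (chg (size u) u p.1 w) - f (chg (size u) u p.2 w)) (site_diff u p h).
Proof.
move=> fh; have := hopP (fun _ z => (z == p.1)%:R - (z == p.2)%:R) fh.
congr represents; apply/funext => w; rewrite /site_op.
have E1 y0 : \sum_(y : S) (y == y0)%:R * f (chg (size u) u y w) = f (chg (size u) u y0 w).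
  rewrite (bigD1 y0)//= eqxx mul1r big1 ?addr0// => y /negbTE ->; exact: mul0r.
by under eq_bigr do rewrite mulrBl; rewrite sumrB !E1.
Qed.

Lemma site_diff_ip u p f g h k : level_repr (size u) f h -> level_repr (size u) g k ->
  ip (site_diff u p h) (site_diff u p k) = \int[m]_w
    ((f (chg (size u) u p.1 w) - f (chg (size u) u p.2 w)) *
     (g (chg (size u) u p.1 w) - g (chg (size u) u p.2 w))).
Proof.
move=> fh gk; have [[mf _ _] [mg _ _]] := (fh, gk).
apply: L2_ipE (site_diff_repr p fh) (site_diff_repr p gk).
  by apply: measurable_funB; exact: measurable_chg_fun.
by apply: measurable_funB; exact: measurable_chg_fun.
Qed.

Lemma hop_energy u a h k : Hm (size u) h -> Hm (size u) k ->
  ip h (hop u (parent_kernel M a) k) =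
  2^-1 * \sum_p a p * ip (site_diff u (val p) h) (site_diff u (val p) k).
Proof.
move=> /HnP[f fh] /HnP[g gk]; have [[mf lf _] [mg lg _]] := (fh, gk).
rewrite (level_repr_ip fh (hop_repr _ gk)).
rewrite site_op_energy//; [|exact: level_repr_sqint fh|exact: level_repr_sqint gk].
by congr (_ * _); apply: eq_bigr => p _; rewrite (site_diff_ip _ fh gk).
Qed.

(** Since the rows of [V] sum to 0, the value of [f] at an arbitrary reference state [y0] can be
    subtracted; the pairs [(y, y0)] are then dominated by all off-diagonal pairs, [(y0, y0)]
    contributing 0. *)
Lemma hop_sum0_le u V h (B : R) : 0 <= B -> (forall t y, `|V t y| <= B) ->
  (forall t, \sum_y V t y = 0) -> Hm (size u) h ->
  ip (hop u V h) (hop u V h) <= #|S|%:R * B ^+ 2 *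
    \sum_(p : offdiag S) ip (site_diff u (val p) h) (site_diff u (val p) h).
Proof.
move=> B0 VB V0 /HnP[f fh]; have [mf lf _] := fh; have sf := level_repr_sqint fh.
rewrite (level_repr_ip (hop_repr V fh) (hop_repr V fh)).
pose y0 := xi (point : Om) [::].
pose f_ y w := f (chg (size u) u y w) - f (chg (size u) u y0 w).
have sf_ y : sqint m (f_ y).
  have := sqintD (sqint_chg hm y lf sf) (sqintZ (-1) (sqint_chg hm y0 lf sf)).
  by congr sqint; apply/funext => w; rewrite mulN1r.
apply: le_trans (site_op_le B0 VB sf_ (site_op_sqint hm V lf sf) _) _.
  move=> w; rewrite /f_; under [RHS]eq_bigr do rewrite mulrBr.
  by rewrite sumrB -[X in _ = _ - X]big_distrl/= V0 mul0r subr0.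
rewrite ler_wpM2l ?mulr_ge0 ?sqr_ge0//.
have D0 (p : S * S) : 0 <= ip (site_diff u p h) (site_diff u p h) by exact: (sf_ge0 F).
have -> : \sum_y \int[m]_w (f_ y w * f_ y w) =
    \sum_y ip (site_diff u (y, y0) h) (site_diff u (y, y0) h).
  by apply: eq_bigr => y _; rewrite (site_diff_ip _ fh fh).
have Dxx x : ip (site_diff u (x, x) h) (site_diff u (x, x) h) = 0.
  rewrite (site_diff_ip _ fh fh) /= /Rintegral (eq_integral (cst 0%E)) ?integral0//.
  by move=> w _; rewrite subrr mul0r.
rewrite (sum_offdiag (F := fun p => ip (site_diff u p h) (site_diff u p h)) Dxx).
rewrite -(pair_big predT predT (fun x y => ip (site_diff u (x, y) h) (site_diff u (x, y) h)))/=.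
apply: ler_sum => y _; rewrite (bigD1 y0)//= lerDl.
by apply: sumr_ge0 => z _.
Qed.

End L2_operators.

Lemma sum_tuple_rcons (V : nmodType) n (G : seq bool -> V) :
  \sum_(v : n.+1.-tuple bool) G v =
  \sum_(u : n.-tuple bool) (G (rcons u false) + G (rcons u true)).
Proof.
pose h (p : n.-tuple bool * bool) : n.+1.-tuple bool := [tuple of rcons p.1 p.2].
have hinj : injective h.
  move=> [u b] [v c] /(congr1 val)/= /rcons_inj[uv ->].
  by congr (_, _); exact: val_inj.
have hbij : bijective h.
  by apply: (inj_card_bij hinj); rewrite card_prod !card_tuple card_bool expnSr.
rewrite (reindex h) /=; last exact: onW_bij.
rewrite -(pair_big predT predT (fun (u : n.-tuple bool) (b : bool) => G (rcons u b)))/=.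
by apply: eq_bigr => u _; rewrite big_bool addrC.
Qed.

Lemma sum_orthogonal (R : realType) (V : lmodType R) (ip : V -> V -> R) (I : finType)
    (Z : I -> V) : sform setT ip -> (forall i j, i != j -> ip (Z i) (Z j) = 0) ->
  ip (\sum_i Z i) (\sum_i Z i) = \sum_i ip (Z i) (Z i).
Proof.
move=> F Z0.
have suml (r : seq I) (x : V) : ip (\sum_(i <- r) Z i) x = \sum_(i <- r) ip (Z i) x.
  by elim: r => [|i r IH]; rewrite ?big_nil ?(sf0l F)// !big_cons (sfDl F)// IH.
have sumr (r : seq I) (x : V) : ip x (\sum_(i <- r) Z i) = \sum_(i <- r) ip x (Z i).
  by rewrite (sfC F)// suml; apply: eq_bigr => i _; rewrite (sfC F).
rewrite suml; apply: eq_bigr => i _; rewrite sumr (bigD1 i)//= big1 ?addr0//.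
by move=> j ji; rewrite Z0// eq_sym.
Qed.

(** * The projection off the constants and the operator Q as energy kernels *)

Section site_kernels.
Context {R : realType} {S : finType} {d : measure_display}
  {E : measurableType d} (M : setting R S E).
Implicit Types (a : offdiag S -> R) (f g : S -> R).

Lemma S_ip_unique g h : (forall f, S_ip M f g = S_ip M f h) -> g = h.
Proof.
move=> gh; apply/funext => x; have := gh (fun y => (y == x)%:R); rewrite /S_ip.
have E1 k : \sum_y mu M y * ((y == x)%:R * k y) = mu M x * k x.
  by rewrite (bigD1 x)//= eqxx mul1r big1 ?addr0// => y /negbTE ->; rewrite mul0r mulr0.
by rewrite !E1 => /(mulfI (lt0r_neq0 (mu_gt0 M x))).
Qed.

Lemma S_ip_energy a f g : S_ip M f (fun x => \sum_y energy_kernel M a x y * g y) =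
  2^-1 * \sum_(p : offdiag S)
    (f (val p).2 - f (val p).1) * (g (val p).2 - g (val p).1) * a p.
Proof.
transitivity (\sum_x \sum_y energy_matrix a x y * (f x * g y)).
  apply: eq_bigr => x _; rewrite !big_distrr/=; apply: eq_bigr => y _.
  by rewrite -(mu_energy_kernel M); ring.
rewrite (sum_energy_matrix a (fun x y => f x * g y)); congr (_ * _).
by apply: eq_bigr => p _; ring.
Qed.

Lemma QopE kappa g x : Qop M kappa g x = \sum_y - energy_kernel M kappa x y * g y.
Proof.
rewrite /Qop; pose h x := \sum_y - energy_kernel M kappa x y * g y.
suff -> : xget (0 : S -> R) [set h | forall f, S_ip M f h =
    - (2^-1 * \sum_(p : offdiag S)
        (f (val p).2 - f (val p).1) * (g (val p).2 - g (val p).1) * kappa p)] = h by [].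
have hP f : S_ip M f h = - (2^-1 * \sum_(p : offdiag S)
        (f (val p).2 - f (val p).1) * (g (val p).2 - g (val p).1) * kappa p).
  rewrite -S_ip_energy /S_ip -sumrN; apply: eq_bigr => z _; rewrite /h.
  by under eq_bigr do rewrite mulNr; rewrite sumrN !mulrN.
apply: xget_unique => // h' h'P; apply: S_ip_unique => f; rewrite h'P hP//.
Qed.

Definition mu_weight (p : offdiag S) : R := mu M (val p).1 * mu M (val p).2.

(** The operator form of 1/2 E (g(X) - g(X'))^2 = Var g(X) for independent X, X' of law [mu]: the
    weight mu x mu gives the projection off the constants. *)
Lemma mu_weight_apply g x : \sum_y energy_kernel M mu_weight x y * g y =
  g x - \sum_y mu M y * g y.
Proof.
rewrite energy_kernel_apply.
rewrite (sum_offdiag (F := fun p => mu M p.1 * mu M p.2 * (grad x p * (g p.1 - g p.2)))); last first.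
  by move=> z; rewrite subrr !mulr0.
rewrite -(pair_big predT predT (fun y z => mu M y * mu M z * (grad x (y, z) * (g y - g z))))/=.
set mean := \sum_y mu M y * g y.
have E1 (c : S -> R) : \sum_y mu M y * ((y == x)%:R * c y) = mu M x * c x.
  by rewrite (bigD1 x)//= eqxx mul1r big1 ?addr0// => y /negbTE ->; rewrite mul0r mulr0.
have E2 y : \sum_z mu M y * mu M z * (grad x (y, z) * (g y - g z)) =
    mu M y * ((y == x)%:R * (g y - mean)) - mu M x * (mu M y * (g y - g x)).
  transitivity (mu M y * (y == x)%:R * (\sum_z mu M z * g y - \sum_z mu M z * g z) -
      \sum_z mu M z * ((z == x)%:R * (mu M y * (g y - g z)))).
    by rewrite -sumrB big_distrr -sumrB; apply: eq_bigr => z _; rewrite /grad /=; ring.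
  by rewrite E1 -big_distrl/= mu_sum1 mul1r -/mean; ring.
under eq_bigr do rewrite E2.
rewrite sumrB E1 -big_distrr/=.
have -> : \sum_y mu M y * (g y - g x) = mean - g x.
  by under eq_bigr do rewrite mulrBr; rewrite sumrB -big_distrl/= mu_sum1 mul1r.
have := mu_gt0 M x => mx.
by field; rewrite gt_eqF.
Qed.

Lemma P1perpE g x : P1perp M g x = \sum_y energy_kernel M mu_weight x y * g y.
Proof.
rewrite mu_weight_apply /P1perp /oproj; set mean := \sum_y _.
pose p y := g y - mean.
have SD f h k : S_ip M (f - h) k = S_ip M f k - S_ip M h k.
  by rewrite /S_ip -sumrB; apply: eq_bigr => y _; rewrite !fctE; ring.
have SC f h : S_ip M f h = S_ip M h f.
  by apply: eq_bigr => y _; ring.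
have pP : orthogonal_compl (S_ip M) [set f | exists c, f = cst c] p.
  move=> _ [c ->]; rewrite /S_ip /p /=.
  transitivity (c * (\sum_y mu M y * g y - \sum_y mu M y * mean)).
    by rewrite -sumrB big_distrr; apply: eq_bigr => y _ /=; ring.
  by rewrite -big_distrl/= mu_sum1 mul1r subrr mulr0.
suff -> : xget (0 : S -> R) [set q | orthogonal_compl (S_ip M) [set f | exists c, f = cst c] q /\
    orthogonal_compl (S_ip M) (orthogonal_compl (S_ip M) [set f | exists c, f = cst c]) (g - q)] = p by [].
have gp : g - p = cst mean by apply/funext => y; rewrite !fctE /p opprB addrC subrK.
apply: xget_unique => [|q [q1 q2]].
  split => // h hP; rewrite gp SC; apply: hP; by exists mean.
apply: S_ip_unique => f.
have qp : orthogonal_compl (S_ip M) [set f | exists c, f = cst c] (q - p).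
  by move=> c cP; rewrite SD q1// pP// subrr.
(* [q - p] is orthogonal to the constant [g - p] and, by the second property of [q], to [g - q];
   hence to itself. *)
have z : S_ip M (q - p) (q - p) = 0.
  have -> : S_ip M (q - p) (q - p) = S_ip M (g - p) (q - p) - S_ip M (g - q) (q - p).
    by rewrite -SD; congr (S_ip M _ _); apply/funext => y; rewrite !fctE; ring.
  by rewrite q2// gp SC qp ?subrr//; exists mean.
have qpy y : q y = p y.
  move: z; rewrite /S_ip => /eqP; rewrite psumr_eq0 => [/allP/(_ y)|t _]; last first.
    by rewrite mulr_ge0 ?(ltW (mu_gt0 _ _))// -expr2 sqr_ge0.
  rewrite mem_index_enum => /(_ isT); rewrite /= mulf_eq0 gt_eqF ?mu_gt0//=.
  by rewrite -expr2 sqrf_eq0 !fctE subr_eq0 => /eqP.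
by congr S_ip; apply/funext.
Qed.

End site_kernels.

(** * Operators acting on a generation *)

Section level_operators.
Context {R : realType} {S : finType} {d : measure_display}
  {E : measurableType d} (M : setting R S E).
Variable m : probability (tree_space M) R.
Hypothesis hm : tree_law m.
Local Notation Om := (tree_space M).
Local Notation dt := (@dtype S).
Local Notation H := (L2 m).
Local Notation ip := (L2_ip m).
Local Notation Hm := (@Hn R S d E M m).
Let F : sform setT ip := L2_ip_sform m.
Implicit Types (n : nat) (v u : node) (w : Om).
Implicit Types (a : offdiag S -> R) (h k : H).

(** Any [F] admissible in [lift_op] becomes a level [n] function on the tree space, for which
    freezing all coordinates but [xi_u] is [chg]. Hence all choices lead to the same class. *)
Lemma lift_opE n (L : (S -> R) -> (S -> R)) (k : S -> S -> R) u h : size u = n ->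
  (forall g x, L g x = \sum_y k x y * g y) -> Hm n h ->
  lift_op n L u h = hop u (fun t => k (parent t)) h.
Proof.
move=> un LE hh.
have liftE (G : (node -> S) * (node -> E) -> R) :
    (forall B, measurable B ->
       coord_sigma [set v | size v = n] [set v | (size v < n)%N] (G @^-1` B)) ->
    level n (G \o @coords R S d E M) /\
    forall w, (lift_fun L u G \o @coords R S d E M) w =
      site_op u (fun t => k (parent t)) (G \o @coords R S d E M) w.
  move=> mG; split.
    by apply/levelP => w w' [ww ee]; apply: (coord_fun_invariant mG).
  move=> w; rewrite /= /lift_fun LE /site_op parent_daughters un.
  apply: eq_bigr => y _; congr (_ * _); apply: (coord_fun_invariant mG) => v vn.
    exact/esym/xi_chg.
  exact/esym/eps_chg.
have mG_meas (G : (node -> S) * (node -> E) -> R) :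
    (forall B, measurable B ->
       coord_sigma [set v | size v = n] [set v | (size v < n)%N] (G @^-1` B)) ->
    measurable_fun setT (G \o @coords R S d E M).
  move=> mG _ B mB; rewrite setTI.
  apply: (@tree_sigma_measurable _ _ _ _ M [set v | size v = n] [set v | (size v < n)%N]).
  by exists (G @^-1` B); [exact: mG|rewrite setTI].
have [f [mf lf fh]] := (HnP n h).1 hh.
(* [f] lives on the tree space only; [build n] extends it to arbitrary coordinate families and so
   provides an admissible [F]. *)
pose G0 (p : (node -> S) * (node -> E)) := f (build M n p.1 p.2).
have mG0 B : measurable B ->
    coord_sigma [set v | size v = n] [set v | (size v < n)%N] (G0 @^-1` B).
  move=> mB; apply: (@build_measurable _ _ _ _ M _ _ n fst snd _ _ _ (f @^-1` B)).
  - exact: coord_sigma_salg.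
  - by move=> v C vn; exact: coord_sigma_xi.
  - by move=> v C vn mC; exact: coord_sigma_eps.
  - by rewrite -[X in measurable X]setTI; exact: mf.
have G0f : G0 \o @coords R S d E M = f by apply/funext => w; exact: lf.
have G0h : represents (G0 \o @coords R S d E M) h by rewrite G0f.
have key G g : (forall B, measurable B ->
       coord_sigma [set v | size v = n] [set v | (size v < n)%N] (G @^-1` B)) ->
    represents (G \o @coords R S d E M) h ->
    represents (lift_fun L u G \o @coords R S d E M) g ->
    g = hop u (fun t => k (parent t)) h.
  move=> mG Gh Lg; have [lG LG] := liftE _ mG.
  apply/esym; apply: (hop_eq hm (f := G \o @coords R S d E M)).
    by rewrite un; split => //; exact: mG_meas.
  by move: Lg; congr represents; apply/funext.
apply: xget_unique => [|g [G [mG Gh Lg]]]; last exact: key mG Gh Lg.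
exists G0; split => //.
have [lG LG] := liftE _ mG0.
have := hopP hm (fun t => k (parent t)) (f := G0 \o @coords R S d E M) (h := h) (u := u).
rewrite un => /(_ (And3 (mG_meas _ mG0) lG G0h)).
by congr represents; apply/funext.
Qed.

Variable rho : R.
Hypothesis rho1 : 1 < 2 * rho.

Let rho2 : 0 < 2 * rho. Proof. exact: lt_trans rho1. Qed.
Let rho0 : 0 < rho. Proof. by move: rho2; lra. Qed.
Let rhoN : rho != 0. Proof. by rewrite gt_eqF. Qed.

(** The operator B_n(a) of the overview. *)
Definition level_op n a h : H :=
  (2 * rho) ^- n *: \sum_(u : n.-tuple bool) hop u (parent_kernel M a) h.

Lemma tuple_Hn n (u : n.-tuple bool) h : Hm n h -> Hm (size u) h.
Proof. by rewrite size_tuple. Qed.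

Lemma level_op_Hn n a h : Hm n h -> Hm n (level_op n a h).
Proof.
move=> hh; apply: HnZ; apply: Hn_sum => u.
have := hop_parent_Hn hm (energy_kernel M a) (tuple_Hn u hh).
by rewrite size_tuple.
Qed.

Lemma scaled_AnE n h : Hm n h -> (2 * rho) ^- n *: An n h = level_op n (mu_weight M) h.
Proof.
move=> hh; congr (_ *: _); apply: eq_bigr => u _.
by rewrite (lift_opE (k := energy_kernel M (mu_weight M)))// ?size_tuple//; exact: P1perpE.
Qed.

Lemma hopN u a h : Hm (size u) h ->
  hop u (fun t y => - parent_kernel M a t y) h = - hop u (parent_kernel M a) h.
Proof.
move=> hh; rewrite -[RHS]addr0 -[X in _ + X](scale0r (hop u (parent_kernel M a) h)) -scaleN1r.
rewrite -(hop_lincomb hm)//; congr (hop u _ h).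
by apply/funext => t; apply/funext => y; rewrite mulN1r mul0r addr0.
Qed.

Lemma QnE n kappa h : Hm n h -> Qn kappa rho n h = - level_op n kappa h.
Proof.
move=> hh; rewrite /Qn -scalerN -sumrN; congr (_ *: _); apply: eq_bigr => u _.
rewrite (lift_opE (k := fun x y => - energy_kernel M kappa x y))// ?size_tuple//.
  exact: (hopN _ (tuple_Hn u hh)).
exact: QopE.
Qed.

Lemma ip_suml (I : finType) (Z : I -> H) k : ip (\sum_i Z i) k = \sum_i ip (Z i) k.
Proof.
elim: index_enum => [|i r IH]; first by rewrite !big_nil (sf0l F).
by rewrite !big_cons (sfDl F)// IH.
Qed.

Lemma ip_sumr (I : finType) (Z : I -> H) k : ip k (\sum_i Z i) = \sum_i ip k (Z i).
Proof. by rewrite (sfC F)// ip_suml; apply: eq_bigr => i _; rewrite (sfC F). Qed.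

Lemma level_op_energy n a h k : Hm n h -> Hm n k ->
  ip h (level_op n a k) = (2 * rho) ^- n * \sum_(u : n.-tuple bool)
    (2^-1 * \sum_(p : offdiag S) a p * ip (site_diff u (val p) h) (site_diff u (val p) k)).
Proof.
move=> hh kk; rewrite (sfZr F)// ip_sumr; congr (_ * _); apply: eq_bigr => u _.
by rewrite (hop_energy hm)// size_tuple.
Qed.

Lemma level_op_sform n a : (forall p, 0 <= a p) ->
  sform (Hm n) (fun h k => ip h (level_op n a k)).
Proof.
move=> a0; split.
- exact: Hn0.
- by move=> *; exact: HnD.
- by move=> *; exact: HnZ.
- move=> h k hh kk; rewrite (level_op_energy a hh kk) (level_op_energy a kk hh); congr (_ * _).
  apply: eq_bigr => u _; congr (_ * _); apply: eq_bigr => p _.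
  by rewrite (sfC F).
- by move=> h k l _ _ _; rewrite (sfDl F).
- by move=> b h k _ _; rewrite (sfZl F).
- move=> h hh; rewrite (level_op_energy a hh hh) mulr_ge0 ?invr_ge0 ?exprn_ge0 ?(ltW rho2)//.
  apply: sumr_ge0 => u _; rewrite mulr_ge0// sumr_ge0// => p _.
  by rewrite mulr_ge0// (sf_ge0 F).
Qed.

Definition step n a h : H := level_op n.+1 a h - level_op n (push_weight M rho a) h.

Lemma stepE n a h : Hm n h -> step n a h =
  (2 * rho) ^- n *: \sum_(u : n.-tuple bool) hop u (step_kernel M rho a) h.
Proof.
move=> hh; rewrite /step /level_op (sum_tuple_rcons _ (fun v => hop v (parent_kernel M a) h)).
have -> : (2 * rho) ^- n.+1 = (2 * rho) ^- n * (2 * rho)^-1 by rewrite exprSr invfM mulrC.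
rewrite -scalerA -scalerBr; congr (_ *: _); rewrite scaler_sumr -sumrB.
apply: eq_bigr => u _; have hu := tuple_Hn u hh.
rewrite !(hop_daughter hm)//.
have e1 : step_kernel M rho a = (fun t y => (2 * rho)^-1 *
    (1 * daughter_kernel M false a t y + 1 * daughter_kernel M true a t y) +
    -1 * parent_kernel M (push_weight M rho a) t y).
  by apply/funext => t; apply/funext => y; rewrite /step_kernel; ring.
rewrite e1 (hop_lincomb hm _ _ (fun t y => 1 * daughter_kernel M false a t y +
  1 * daughter_kernel M true a t y))// (hop_lincomb hm)// !scale1r scaleN1r.
by [].
Qed.

Lemma step_orth n a h k : Hm n h -> Hm n k -> ip (step n a h) k = 0.
Proof.
move=> hh kk; rewrite stepE// (sfZl F)// ip_suml big1 ?mulr0// => u _.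
apply: (hop_orth_Hn hm); [exact: tuple_Hn|exact: tuple_Hn|].
by move=> x y; exact: step_kernel_law.
Qed.

(** The increment is orthogonal to [Hn n]. For a weight fixed by [push_weight rho], such as [kappa],
    this is the consistency of the forms on successive levels. *)
Lemma level_op_consistent n a h k : Hm n h -> Hm n k ->
  ip k (level_op n.+1 a h) = ip k (level_op n (push_weight M rho a) h).
Proof.
move=> hh kk; apply/eqP; rewrite -subr_eq0 -(sfBr F)// (sfC F)//.
by rewrite -/(step n a h) step_orth.
Qed.

Variable kappa : offdiag S -> R.
Hypothesis kappa_gt0 : forall p, 0 < kappa p.
Hypothesis kappa_push : push_weight M rho kappa = kappa.

Definition energy n h : R := ip h (level_op n kappa h).

Lemma energyS n h : Hm n h -> energy n.+1 h = energy n h.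
Proof. by move=> hh; rewrite /energy (level_op_consistent kappa hh hh) kappa_push. Qed.

Lemma Hn_le n j h : Hm n h -> Hm (n + j)%N h.
Proof.
move=> hh; elim: j => [|j IH]; first by rewrite addn0.
by rewrite addnS; exact: Hn_incr.
Qed.

Lemma energy_add n j h : Hm n h -> energy (n + j)%N h = energy n h.
Proof.
move=> hh; elim: j => [|j IH]; first by rewrite addn0.
by rewrite addnS energyS//; exact: Hn_le.
Qed.

Lemma energy_ge0 n h : Hm n h -> 0 <= energy n h.
Proof. by move=> hh; apply: (sf_ge0 (level_op_sform n (fun p => ltW (kappa_gt0 p)))). Qed.

(** The last factor compares the unweighted sum of squared differences with the energy: [kappa p]
    times the sum of all inverses is at least 1, and the 2 cancels the one half in the energy. *)
Definition step_bound : R :=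
  #|S|%:R * step_const M ^+ 2 * (2 * \sum_(p : offdiag S) (kappa p)^-1).

Lemma kappa_inv_ge0 : 0 <= \sum_(p : offdiag S) (kappa p)^-1.
Proof. by apply: sumr_ge0 => p _; rewrite invr_ge0 ltW. Qed.

Lemma step_bound_ge0 : 0 <= step_bound.
Proof.
rewrite /step_bound; apply: mulr_ge0; first by rewrite mulr_ge0// sqr_ge0.
by apply: mulr_ge0 => //; exact: kappa_inv_ge0.
Qed.

(** Contributions of different vertices are orthogonal, so the squared norm is the square of
    [(2 * rho) ^- n] times a sum over vertices. One factor is absorbed by [energy n h]; the other
    survives and makes the increments summable. *)
Lemma step_le n a (A : R) h : 0 <= A -> (forall p, `|a p| <= A) ->
  (forall p, `|push_weight M rho a p| <= A) -> Hm n h ->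
  ip (step n a h) (step n a h) <= step_bound * A ^+ 2 * (2 * rho) ^- n * energy n h.
Proof.
move=> A0 aA pA hh.
have q0 : 0 < (2 * rho) ^- n by rewrite invr_gt0 exprn_gt0.
rewrite stepE// (sf_sqrZ F)// sum_orthogonal//; last first.
  move=> u v uv; apply: (hop_orth hm).
  - by rewrite !size_tuple.
  - by apply: contra uv => /eqP uv; apply/eqP/val_inj.
  - exact: tuple_Hn.
  - exact: tuple_Hn.
  - by move=> x y; exact: step_kernel_law.
have B0 : 0 <= step_const M * A by rewrite mulr_ge0// step_const_ge0.
have D0 u p : 0 <= ip (site_diff u p h) (site_diff u p h) by exact: (sf_ge0 F).
have K0 := kappa_inv_ge0.
have site (u : n.-tuple bool) :
    ip (hop u (step_kernel M rho a) h) (hop u (step_kernel M rho a) h) <=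
    step_bound * A ^+ 2 * (2^-1 * \sum_(p : offdiag S) kappa p *
      ip (site_diff u (val p) h) (site_diff u (val p) h)).
  apply: le_trans (hop_sum0_le hm B0 _ _ (tuple_Hn u hh)) _.
  - by move=> t y; exact: step_kernel_le.
  - by move=> t; exact: step_kernel_sum0.
  have -> : step_bound * A ^+ 2 * (2^-1 * \sum_(p : offdiag S) kappa p *
      ip (site_diff u (val p) h) (site_diff u (val p) h)) =
    #|S|%:R * (step_const M * A) ^+ 2 * \sum_(p : offdiag S)
     ((\sum_(p : offdiag S) (kappa p)^-1) * kappa p) *
      ip (site_diff u (val p) h) (site_diff u (val p) h).
    under [in RHS]eq_bigr do rewrite -mulrA; rewrite -big_distrr/= /step_bound.
    by field.
  have K2 : 0 <= #|S|%:R * (step_const M * A) ^+ 2 by rewrite mulr_ge0// sqr_ge0.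
  apply: ler_wpM2l => //; apply: ler_sum => p _.
  rewrite ler_peMl//.
  rewrite (bigD1 p)//= mulrDl mulVf ?gt_eqF// lerDl mulr_ge0 ?(ltW (kappa_gt0 _))//.
  by apply: sumr_ge0 => q _; rewrite invr_ge0 ltW.
rewrite /energy (level_op_energy kappa hh hh).
have le_sites : \sum_(u : n.-tuple bool)
      ip (hop u (step_kernel M rho a) h) (hop u (step_kernel M rho a) h) <=
    \sum_(u : n.-tuple bool) step_bound * A ^+ 2 * (2^-1 * \sum_(p : offdiag S) kappa p *
      ip (site_diff u (val p) h) (site_diff u (val p) h)).
  by apply: ler_sum => u _; exact: site.
apply: le_trans (ler_wpM2l (sqr_ge0 _) le_sites) _.
rewrite -big_distrr/= expr2; set X := \sum_(u : _) _.
by rewrite le_eqVlt; apply/orP; left; apply/eqP; ring.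
Qed.

End level_operators.

(** * Convergence to the Perron-Frobenius eigenvector *)

Section perron_frobenius.
Context {R : realType} (I : finType) (P : I -> I -> R) (theta kappa : I -> R).
Hypothesis P0 : forall p q, 0 <= P p q.
Hypothesis theta_gt0 : forall p, 0 < theta p.
Hypothesis kappa_gt0 : forall p, 0 < kappa p.
Hypothesis P_theta : forall p, \sum_q P p q * theta q = theta p.
Hypothesis kappa_P : forall q, \sum_p kappa p * P p q = kappa q.
Hypothesis theta_kappa : \sum_p theta p * kappa p = 1.
Implicit Types (a w : I -> R).

Definition push a : I -> R := fun q => \sum_p a p * P p q.

Fixpoint Ppow n (p q : I) : R :=
  if n is n'.+1 then \sum_r Ppow n' p r * P r q else (p == q)%:R.

Hypothesis primP : exists n, forall p q, 0 < Ppow n p q.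

Lemma iter_push n a q : iter n push a q = \sum_p a p * Ppow n p q.
Proof.
elim: n q => [|n IH] q /=.
  by rewrite (bigD1 q)//= eqxx mulr1 big1 ?addr0// => p /negbTE ->; rewrite mulr0.
transitivity (\sum_r iter n push a r * P r q); first by [].
transitivity (\sum_r \sum_p a p * Ppow n p r * P r q).
  by apply: eq_bigr => r _; rewrite IH big_distrl.
rewrite exchange_big/=; apply: eq_bigr => p _; rewrite big_distrr/=.
by apply: eq_bigr => r _; rewrite mulrA.
Qed.

Lemma Ppow_theta n p : \sum_q Ppow n p q * theta q = theta p.
Proof.
elim: n => [|n IH] /=.
  by rewrite (bigD1 p)//= eqxx mul1r big1 ?addr0// => q; rewrite eq_sym => /negbTE ->; rewrite mul0r.
under eq_bigr do rewrite big_distrl/=.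
rewrite exchange_big/= -[RHS]IH; apply: eq_bigr => r _.
by under eq_bigr do rewrite -mulrA; rewrite -big_distrr/= P_theta.
Qed.

Lemma push_theta a : \sum_q push a q * theta q = \sum_p a p * theta p.
Proof.
rewrite /push; under eq_bigr do rewrite big_distrl/=.
rewrite exchange_big/=; apply: eq_bigr => p _.
by under eq_bigr do rewrite -mulrA; rewrite -big_distrr/= P_theta.
Qed.

(** The weights [theta] make [push] a contraction in this norm, because [P theta = theta] and the
    entries of [P] are non-negative. *)
Definition theta_norm w : R := \sum_p `|w p| * theta p.

Lemma theta_norm_ge0 w : 0 <= theta_norm w.
Proof. by apply: sumr_ge0 => p _; rewrite mulr_ge0// ltW. Qed.

Lemma theta_norm_push w : theta_norm (push w) <= theta_norm w.
Proof.
rewrite /theta_norm; apply: (@le_trans _ _ (\sum_q (push (fun p => `|w p|)) q * theta q)).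
  apply: ler_sum => q _; rewrite ler_wpM2r ?(ltW (theta_gt0 _))//.
  apply: le_trans (ler_norm_sum _ _ _) _; apply: ler_sum => p _.
  by rewrite normrM (ger0_norm (P0 _ _)).
by rewrite push_theta.
Qed.

Lemma theta_norm_iter n w : theta_norm (iter n push w) <= theta_norm w.
Proof. by elim: n => //= n IH; apply: le_trans (theta_norm_push _) IH. Qed.

(* Doeblin's condition: some power of P dominates a positive multiple of the
   rank-one matrix theta kappa. *)
Lemma doeblin : exists n, exists2 delta, 0 < delta <= 1 &
  forall w, \sum_p w p * theta p = 0 ->
    theta_norm (iter n push w) <= (1 - delta) * theta_norm w.
Proof.
have [n Pn] := primP.
(* [s] dominates every ratio [theta p * kappa q / Ppow n p q], so [delta = (s + 1)^-1] gives the
   entrywise domination [dP]; the added 1 ensures a positive denominator and [delta <= 1]. *)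
pose s := \sum_p \sum_q theta p * kappa q / Ppow n p q.
have t0 p q : 0 <= theta p * kappa q / Ppow n p q.
  by rewrite divr_ge0 ?mulr_ge0// ltW.
have s0 : 0 <= s by apply: sumr_ge0 => p _; exact: sumr_ge0.
pose delta := (s + 1)^-1.
have s1 : 0 < s + 1 by rewrite ltr_wpDl.
have dP p q : delta * (theta p * kappa q) <= Ppow n p q.
  rewrite -ler_pdivlMl ?invr_gt0// invrK -ler_pdivrMr//.
  apply: (@le_trans _ _ s); last by rewrite lerDl.
  rewrite /s (bigD1 p)//= (bigD1 q)//= -addrA lerDl addr_ge0//; first exact: sumr_ge0.
  by apply: sumr_ge0 => r _; exact: sumr_ge0.
exists n, delta.
  by rewrite invr_gt0 s1 invf_le1// lerDr.
move=> w w0.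
(* Subtracting the rank-one matrix changes nothing on [w], as [w] is orthogonal to [theta], yet
   lowers the row masses against [theta] by the factor [1 - delta]. *)
have E1 q : iter n push w q = \sum_p w p * (Ppow n p q - delta * (theta p * kappa q)).
  rewrite iter_push; under [RHS]eq_bigr do rewrite mulrBr; rewrite sumrB.
  rewrite [X in _ = _ - X](_ : _ = delta * kappa q * \sum_p w p * theta p).
    by rewrite w0 mulr0 subr0.
  by rewrite big_distrr/=; apply: eq_bigr => p _; ring.
rewrite /theta_norm; apply: (@le_trans _ _ (\sum_q (\sum_p `|w p| *
    (Ppow n p q - delta * (theta p * kappa q))) * theta q)).
  apply: ler_sum => q _; rewrite ler_wpM2r ?(ltW (theta_gt0 _))// E1.
  apply: le_trans (ler_norm_sum _ _ _) _; apply: ler_sum => p _.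
  by rewrite normrM [X in _ * X <= _]ger0_norm// subr_ge0.
under eq_bigr do rewrite big_distrl/=.
rewrite exchange_big/= big_distrr/=; apply: ler_sum => p _.
under eq_bigr do rewrite -mulrA; rewrite -big_distrr/= mulrCA ler_wpM2l//.
under eq_bigr do rewrite mulrBl; rewrite sumrB Ppow_theta mulrBl mul1r lerD2l lerN2.
rewrite (eq_bigr (fun q => delta * theta p * (theta q * kappa q))).
  by rewrite -big_distrr/= theta_kappa mulr1.
by move=> q _; ring.
Qed.

Lemma push_cvg a : \sum_p a p * theta p = 1 ->
  forall eps, 0 < eps -> exists J, forall j, (J <= j)%N ->
    theta_norm (fun p => iter j push a p - kappa p) < eps.
Proof.
move=> a1 eps e0; pose w p := a p - kappa p.
have kappa_iter j : iter j push kappa = kappa.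
  by elim: j => //= j ->; apply/funext.
have wE j : (fun p => iter j push a p - kappa p) = iter j push w.
  apply/funext => p; rewrite -(kappa_iter j) !iter_push -sumrB.
  by apply: eq_bigr => q _; rewrite mulrBl.
have w0 : \sum_p w p * theta p = 0.
  under eq_bigr do rewrite mulrBl; rewrite sumrB a1.
  by under eq_bigr do rewrite mulrC; rewrite theta_kappa subrr.
have wj0 j : \sum_p iter j push w p * theta p = 0.
  by elim: j => //= j IH; rewrite push_theta.
have [n [delta /andP[d0 d1] dP]] := doeblin.
have geo i : theta_norm (iter (i * n) push w) <= (1 - delta) ^+ i * theta_norm w.
  elim: i => [|i IH]; first by rewrite mul0n expr0 mul1r.
  rewrite mulSn iterD; apply: le_trans (dP _ (wj0 _)) _.
  by rewrite exprS -mulrA ler_wpM2l// subr_ge0.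
have : (fun i => theta_norm w * (1 - delta) ^+ i) @ \oo --> theta_norm w * 0.
  apply: cvgMr; apply: cvg_expr; rewrite ger0_norm ?subr_ge0//.
  by rewrite ltrBlDr ltrDl.
rewrite mulr0 => /cvgr0Pnorm_lt /(_ _ e0)[i _ iP].
exists (i * n)%N => j ij; rewrite wE -(subnK ij) iterD.
apply: le_lt_trans (theta_norm_iter _ _) _; apply: le_lt_trans (geo i) _.
have := iP i (leqnn _); rewrite /= ger0_norm; first by rewrite mulrC.
by rewrite mulr_ge0 ?theta_norm_ge0// exprn_ge0// subr_ge0.
Qed.

Lemma push_bounded a : exists2 A, 0 <= A & forall j p, `|iter j push a p| <= A.
Proof.
exists (\sum_p theta_norm a / theta p).
  by apply: sumr_ge0 => p _; rewrite divr_ge0 ?theta_norm_ge0// ltW.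
move=> j p; rewrite (bigD1 p)//=; apply: (@le_trans _ _ (theta_norm a / theta p)).
  rewrite ler_pdivlMr//; apply: le_trans (theta_norm_iter j a).
  rewrite /theta_norm (bigD1 p)//= lerDl; apply: sumr_ge0 => q _.
  by rewrite mulr_ge0// ltW.
rewrite lerDl; apply: sumr_ge0 => q _.
by rewrite divr_ge0 ?theta_norm_ge0// ltW.
Qed.

End perron_frobenius.

(** * Convergence of the scaled operators *)

Section telescoping.
Context {R : realType} {S : finType} {d : measure_display}
  {E : measurableType d} (M : setting R S E).
Variable m : probability (tree_space M) R.
Hypothesis hm : tree_law m.
Local Notation H := (L2 m).
Local Notation ip := (L2_ip m).
Local Notation Hm := (@Hn R S d E M m).
Let F : sform setT ip := L2_ip_sform m.
Implicit Types (a b : offdiag S -> R) (h k : H).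

(** Exponential in the number of terms, but applied at a fixed level only, where any finite constant
    is enough. *)
Lemma ip_sum_le (J : finType) (Z : J -> H) (B : R) : 0 <= B ->
  (forall i, ip (Z i) (Z i) <= B) -> ip (\sum_i Z i) (\sum_i Z i) <= 4 ^+ #|J| * B.
Proof.
move=> B0 ZB; rewrite cardT -big_enum.
elim: (enum J) => [|i r IH]; first by rewrite big_nil (sf0l F)// mul1r.
rewrite big_cons; apply: le_trans (sf_sqrD_le F I I) _.
rewrite /= exprS; have := ZB i.
have : B <= 4 ^+ size r * B by rewrite ler_peMl// exprn_ege1// ler1n.
by move: IH; rewrite -mulrA; lra.
Qed.

Variable rho : R.
Hypothesis rho1 : 1 < 2 * rho.
Let rho2 : 0 < 2 * rho. Proof. exact: lt_trans rho1. Qed.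
Let rho0 : 0 < rho. Proof. by move: rho2; lra. Qed.

Lemma parent_kernelB a b : parent_kernel M (fun p => a p - b p) =
  fun t y => 1 * parent_kernel M a t y + -1 * parent_kernel M b t y.
Proof.
apply/funext => t; apply/funext => y.
rewrite /parent_kernel /energy_kernel /energy_matrix.
under eq_bigr do rewrite mulrBl; by rewrite sumrB mulrBr mulrBl mul1r mulN1r.
Qed.

Lemma level_opB n a b h : Hm n h ->
  level_op rho n a h - level_op rho n b h = level_op rho n (fun p => a p - b p) h.
Proof.
move=> hh; rewrite /level_op -scalerBr -sumrB; congr (_ *: _).
apply: eq_bigr => u _.
by rewrite parent_kernelB (hop_lincomb hm)// ?scale1r ?scaleN1r// size_tuple.
Qed.

Definition level_bound n : R := ((2 * rho) ^- n) ^+ 2 *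
  (4 ^+ #|{: n.-tuple bool}| * (site_const M * kernel_const M ^+ 2)).

Lemma level_bound_ge0 n : 0 <= level_bound n.
Proof.
by rewrite /level_bound mulr_ge0 ?sqr_ge0// mulr_ge0 ?exprn_ge0// mulr_ge0 ?site_const_ge0 ?sqr_ge0.
Qed.

Lemma level_op_le n a (A : R) h : 0 <= A -> (forall p, `|a p| <= A) -> Hm n h ->
  ip (level_op rho n a h) (level_op rho n a h) <= level_bound n * A ^+ 2 * ip h h.
Proof.
move=> A0 aA hh; rewrite (sf_sqrZ F)//.
have -> : level_bound n * A ^+ 2 * ip h h = ((2 * rho) ^- n) ^+ 2 *
    (4 ^+ #|{: n.-tuple bool}| * (site_const M * (kernel_const M * A) ^+ 2 * ip h h)).
  by rewrite /level_bound; ring.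
apply: ler_wpM2l; first exact: sqr_ge0.
have K0 := kernel_const_ge0 M; have h0 : 0 <= ip h h := sf_ge0 F I.
apply: ip_sum_le => [|u].
  by rewrite mulr_ge0// mulr_ge0 ?site_const_ge0 ?sqr_ge0.
apply: (hop_bound hm); first exact: mulr_ge0.
  by move=> t y; exact: energy_kernel_le.
by rewrite size_tuple.
Qed.

Lemma level_op_energy_le n a : exists c, forall h, Hm n h ->
  ip h (level_op rho n a h) <= c * ip h h.
Proof.
pose A := \sum_p `|a p|.
have aA p : `|a p| <= A by rewrite /A (bigD1 p)//= lerDl sumr_ge0.
have A0 : 0 <= A by apply: sumr_ge0.
exists ((1 + level_bound n * A ^+ 2) / 2) => h hh.
have := sf_ge0 F (I : setT (h - level_op rho n a h)); rewrite (sf_sqrB F)//.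
have := level_op_le A0 aA hh.
move: (level_bound n * A ^+ 2) (ip h (level_op rho n a h)) => K x; lra.
Qed.

Variables theta kappa : offdiag S -> R.
Hypothesis hprim : primitive (Pminus M).
Hypothesis theta_gt0 : forall p, 0 < theta p.
Hypothesis theta_right : Pminus M *m (\col_i theta (enum_val i)) =
       rho *: (\col_i theta (enum_val i)).
Hypothesis kappa_gt0 : forall p, 0 < kappa p.
Hypothesis kappa_left : (\row_i kappa (enum_val i)) *m Pminus M =
       rho *: (\row_i kappa (enum_val i)).
Hypothesis theta_kappa : \sum_(p : offdiag S) theta p * kappa p = 1.
Hypothesis theta_mu :
  \sum_(p : offdiag S) theta p * (mu M (val p).1 * mu M (val p).2) = 1.

Definition Pnormal (p q : offdiag S) : R := rho^-1 * P2 M (val p) (val q).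

Lemma push_weightE a : push_weight M rho a = push Pnormal a.
Proof.
apply/funext => q; rewrite /push_weight /push /Pnormal big_distrr/=.
by apply: eq_bigr => p _; ring.
Qed.

Lemma sum_enum_val (G : offdiag S -> R) : \sum_(i < #|offdiag S|) G (enum_val i) = \sum_p G p.
Proof.
rewrite [RHS](reindex (@enum_val _ (offdiag S)))//.
by exists enum_rank => i _; [exact: enum_valK|exact: enum_rankK].
Qed.

Lemma Pnormal_theta p : \sum_q Pnormal p q * theta q = theta p.
Proof.
have /matrixP/(_ (enum_rank p) 0) := theta_right; rewrite !mxE.
under eq_bigr do rewrite !mxE enum_rankK.
rewrite (sum_enum_val (fun q => P2 M (val p) (val q) * theta q)) enum_rankK => e.
apply: (mulfI (lt0r_neq0 rho0)); rewrite -e big_distrr/=; apply: eq_bigr => q _.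
by rewrite /Pnormal -mulrA mulVKf// gt_eqF.
Qed.

Lemma kappa_Pnormal q : \sum_p kappa p * Pnormal p q = kappa q.
Proof.
have /matrixP/(_ 0 (enum_rank q)) := kappa_left; rewrite !mxE.
under eq_bigr do rewrite !mxE enum_rankK.
rewrite (sum_enum_val (fun p => kappa p * P2 M (val p) (val q))) enum_rankK => e.
apply: (mulfI (lt0r_neq0 rho0)); rewrite -e big_distrr/=; apply: eq_bigr => p _.
by rewrite /Pnormal mulrCA mulVKf// gt_eqF.
Qed.

Lemma kappa_push : push_weight M rho kappa = kappa.
Proof. by rewrite push_weightE; apply/funext => q; exact: kappa_Pnormal. Qed.

Lemma Pnormal_ge0 p q : 0 <= Pnormal p q.
Proof.
have [/(_ (enum_rank p) (enum_rank q)) + _] := hprim.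
by rewrite mxE !enum_rankK => P0; rewrite /Pnormal mulr_ge0// invr_ge0 ltW.
Qed.

Lemma Ppow_Pminus n p q :
  Ppow Pnormal n p q = rho ^- n * (Pminus M ^+ n) (enum_rank p) (enum_rank q).
Proof.
elim: n q => [|n IH] q.
  by rewrite /= expr0 invr1 mul1r expr0 mxE (inj_eq enum_rank_inj).
rewrite [Pminus M ^+ _]exprSr -[_ * Pminus M]/(_ *m _) mxE /= -(sum_enum_val (fun r => Ppow Pnormal n p r * Pnormal r q)) big_distrr/=.
apply: eq_bigr => i _; rewrite IH mxE enum_valK enum_rankK /Pnormal exprSr invfM.
ring.
Qed.

Lemma Pnormal_primitive : exists n, forall p q, 0 < Ppow Pnormal n p q.
Proof.
have [_ [n _ Pn]] := hprim; exists n => p q.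
by rewrite Ppow_Pminus mulr_gt0// invr_gt0 exprn_gt0.
Qed.

Local Notation weight j := (iter j (push_weight M rho) (mu_weight M)).
Local Notation q := ((2 * rho)^-1).

Lemma weight_bounded : exists2 A, 0 <= A & forall j p, `|weight j p| <= A.
Proof.
have -> : push_weight M rho = push Pnormal by apply/funext; exact: push_weightE.
exact: push_bounded Pnormal_ge0 theta_gt0 Pnormal_theta _.
Qed.

(** The pairing with [theta] is preserved by [push], and [theta_mu] and [theta_kappa] give it the
    same value at mu x mu and at [kappa]: this identifies the limit as [kappa] itself and not a
    multiple. *)
Lemma weight_cvg (eps : R) : 0 < eps -> exists J, forall j, (J <= j)%N ->
  forall p, `|weight j p - kappa p| <= eps.
Proof.
move=> e0; have -> : push_weight M rho = push Pnormal by apply/funext; exact: push_weightE.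
have K0 : 0 <= \sum_p (theta p)^-1 by apply: sumr_ge0 => p _; rewrite invr_ge0 ltW.
have K1 : 0 < \sum_p (theta p)^-1 + 1 by rewrite ltr_wpDl.
have mu1 : \sum_p mu_weight M p * theta p = 1.
  by rewrite -theta_mu; apply: eq_bigr => p _; rewrite mulrC.
have [J JP] := push_cvg Pnormal_ge0 theta_gt0 kappa_gt0 Pnormal_theta kappa_Pnormal
  theta_kappa Pnormal_primitive mu1 (divr_gt0 e0 K1).
exists J => j /JP/ltW; rewrite ler_pdivlMr// => jP p; apply: le_trans jP.
set w := (fun _ => _ - _).
have wp : `|w p| * theta p <= theta_norm theta w.
  rewrite /theta_norm (bigD1 p)//= lerDl; apply: sumr_ge0 => r _.
  by rewrite mulr_ge0// ltW.
rewrite -[leLHS](mulfK (lt0r_neq0 (theta_gt0 p))).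
apply: ler_pM => //; first by rewrite mulr_ge0// ltW.
  by rewrite invr_ge0 ltW.
rewrite (bigD1 p)//= -addrA lerDl addr_ge0//; apply: sumr_ge0 => r _.
by rewrite invr_ge0 ltW.
Qed.

(** Peel off the top generation: the increment is orthogonal to [Hn (n + j)], where the remaining
    difference [Y] lies, and the energy of [h] is the same at every level. The last factor is a
    partial geometric sum of [q]; the offset [i] counts the pushes already made. *)
Lemma level_op_telescope n i j (A : R) h : 0 <= A -> (forall l p, `|weight l p| <= A) ->
  Hm n h ->
  let Z := level_op rho (n + j)%N (weight i) h - level_op rho n (weight (i + j)%N) h in
  ip Z Z <= step_bound M kappa * A ^+ 2 * q ^+ n * energy rho kappa n h * ((1 - q ^+ j) / (1 - q)).
Proof.
move=> A0 wA hh; elim: j i => [|j IH] i.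
  by rewrite /= !addn0 subrr (sf0l F)// expr0 subrr mul0r mulr0.
rewrite /= addnS.
have hj := Hn_le j hh.
set Y := level_op rho (n + j)%N (weight i.+1) h - level_op rho n (weight (i.+1 + j)%N) h.
have -> : level_op rho (n + j).+1 (weight i) h - level_op rho n (weight (i + j.+1)%N) h =
    step rho (n + j) (weight i) h + Y.
  by rewrite /step /Y addnS addSn /= addrA subrK.
have YH : Hm (n + j)%N Y.
  by apply: HnB; [exact: level_op_Hn|apply: Hn_le; exact: level_op_Hn].
rewrite (sf_sqrD F)// (step_orth hm rho1 (weight i) hj YH) mul0rn addr0.
have := step_le hm rho1 kappa_gt0 A0 (wA i) (wA i.+1) hj.
rewrite (energy_add hm rho1 kappa_push j hh) -exprVn.
have := IH i.+1; rewrite /= -/Y.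
move=> e1 e2; apply: le_trans (lerD e2 e1) _.
rewrite exprD [q ^+ j.+1]exprS; have q1 : q != 1 by rewrite lt_eqF// invf_lt1.
move: q1; move: q (step_bound _ _) (energy _ _ _ _) => x B En x1.
rewrite le_eqVlt; apply/orP; left; apply/eqP; field.
by rewrite subr_eq0 eq_sym.
Qed.

(** With [N = n + j], telescoping leads from weight mu x mu at level [N] to [weight j] at level [n],
    at a cost uniform in [j]. Replacing [weight j] by [kappa] takes place at the fixed level [n],
    and its cost vanishes as [j] grows. *)
Lemma scaled_An_approx : exists2 C, 0 <= C & forall n h, Hm n h -> forall eps : R, 0 < eps ->
  exists N0, forall N, (N0 <= N)%N ->
    let Z := (2 * rho) ^- N *: An N (oproj ip (Hm N) h) - level_op rho n kappa h in
    ip Z Z <= C * q ^+ n * energy rho kappa n h + eps.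
Proof.
have [A A0 wA] := weight_bounded.
have q0 : 0 < q by rewrite invr_gt0.
have q1 : q < 1 by rewrite invf_lt1.
have B0 := step_bound_ge0 M kappa_gt0.
exists (2 * (step_bound M kappa * A ^+ 2 / (1 - q))).
  apply: mulr_ge0 => //; apply: divr_ge0; last by rewrite subr_ge0 ltW.
  by apply: mulr_ge0 => //; exact: sqr_ge0.
move=> n h hh eps e0.
have h0 : 0 <= ip h h := sf_ge0 F I.
have b0 := level_bound_ge0 n.
(* With [del ^+ 2 = eps / K], the cost of replacing the weight is at most
   [(K - 1) * (eps / K) <= eps]; the added 1 keeps [K] positive. *)
pose K := 2 * (level_bound n * ip h h) + 1.
have K0 : 0 < K by rewrite ltr_wpDl// mulr_ge0// mulr_ge0.
pose del := Num.sqrt (eps / K).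
have [J JP] := weight_cvg (eps := del) ltac:(by rewrite sqrtr_gt0 divr_gt0).
exists (n + J)%N => N nN.
have {nN} [j Jj ->] : exists2 j, (J <= j)%N & N = (n + j)%N.
  by exists (N - n)%N; [rewrite leq_subRL ?(leq_trans _ nN)// leq_addr|
    rewrite subnKC// (leq_trans _ nN)// leq_addr].
have hj := Hn_le j hh.
have Ph : oproj ip (Hm (n + j)%N) h = h.
  have [PH PO] := oprojP (L2_hilbert m) h (level_op_sform hm rho1 (n + j) (fun p => ltW (kappa_gt0 p)))
    (@Hn_closed _ _ _ _ _ _ (n + j)).
  apply/esym/eqP; rewrite -subr_eq0; apply/eqP/(hil_def (L2_hilbert m))/PO.
  exact: HnB.
rewrite Ph scaled_AnE//=.
apply: le_trans (sf_sqrB_le F (g := level_op rho n (weight j) h) I I I) _.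
have T1 := level_op_telescope 0 j A0 wA hh.
rewrite /= add0n in T1.
have T2 : ip (level_op rho n (weight j) h - level_op rho n kappa h)
    (level_op rho n (weight j) h - level_op rho n kappa h) <= level_bound n * del ^+ 2 * ip h h.
  by rewrite level_opB//; apply: level_op_le => //; [exact: sqrtr_ge0|exact: JP].
have del2 : del ^+ 2 = eps / K by rewrite sqr_sqrtr// divr_ge0// ltW.
apply: lerD.
  have -> : 2 * (step_bound M kappa * A ^+ 2 / (1 - q)) * q ^+ n * energy rho kappa n h =
      2 * (step_bound M kappa * A ^+ 2 * q ^+ n * energy rho kappa n h * (1 - q)^-1).
    by move: (1 - q)^-1 => x; ring.
  apply: ler_wpM2l => //; apply: le_trans T1 _.
  apply: ler_wpM2l.
    rewrite mulr_ge0 ?(energy_ge0 hm rho1 kappa_gt0 hh)//.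
    by rewrite mulr_ge0 ?exprn_ge0 ?(ltW q0)// mulr_ge0 ?sqr_ge0.
  by rewrite ler_piMl ?invr_ge0 ?subr_ge0 ?(ltW q1)// gerBl exprn_ge0// ltW.
apply: le_trans (ler_wpM2l _ T2) _ => //; rewrite del2.
have -> : 2 * (level_bound n * (eps / K) * ip h h) = (K - 1) * (eps / K).
  by rewrite {2}/K addrK; move: (eps / K) => x; ring.
by rewrite mulrBl mul1r mulrCA divff ?mulr1 ?gerBl ?divr_ge0 ?(ltW e0) ?(ltW K0)// gt_eqF.
Qed.

End telescoping.

(** * Density of the union of the spaces [Hn n] *)

Section density.
Context {R : realType} {S : finType} {d : measure_display}
  {E : measurableType d} (M : setting R S E).
Variable m : probability (tree_space M) R.
Local Notation Om := (tree_space M).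
Local Notation H := (L2 m).
Local Notation ip := (L2_ip m).
Local Notation Hm := (@Hn R S d E M m).
Let F : sform setT ip := L2_ip_sform m.

Definition level_sets : set (set Om) :=
  [set A | measurable A /\ exists n, level n (A : Om -> Prop)].

Lemma level_le n k (T : Type) (f : Om -> T) : (n <= k)%N -> level n f -> level k f.
Proof. by move=> /subnK <-; elim: (k - n)%N => // j IH /IH; exact: levelS. Qed.

Lemma level_setsI : setI_closed level_sets.
Proof.
move=> A B [mA [n An]] [mB [k Bk]]; split; first exact: measurableI.
exists (maxn n k) => w.
have An' := level_le (leq_maxl n k) An; have Bk' := level_le (leq_maxr n k) Bk.
by rewrite /setI /mkset /= An' Bk'.
Qed.

Lemma level_sets_generate : @measurable _ Om = <<s level_sets >>.
Proof.
apply/seteqP; split; last first.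
  by apply: smallest_sub; [exact: sigma_algebra_measurable|move=> A []].
have As : sigma_algebra setT <<s level_sets >> by exact: smallest_sigma_algebra.
apply: (@tree_sigma_preimage _ _ _ _ _ _ _ _ _ id As) => u B.
  move=> _; apply: sub_sigma_algebra; split; first exact: measurable_xi.
  exists (size u) => w; rewrite /mkset.
  by congr B; exact: (@level_xi _ _ _ _ M (size u) u erefl).
move=> _ mB; apply: sub_sigma_algebra; split; first exact: measurable_eps.
exists (size u).+1; apply/levelP => w w' [_ ww].
by rewrite /mkset ww.
Qed.

(** A representative of [h] integrates to 0 over every event of finite level, whose indicator lies
    in some [Hn n]. These events form a generating pi-system, so the integral vanishes over all
    events. *)
Lemma orth_Hn_eq0 h : (forall n g, Hm n g -> ip h g = 0) -> h = 0.
Proof.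
move=> hH; pose f := L2_repr h.
have sf : sqint m f := sqint_repr h.
have s1 : sqint m (fun=> 1).
  split; first exact: measurable_cst.
  by under eq_integral do rewrite expr1n; rewrite integral_cst// mul1e fin_num_fun_lty.
have fi : m.-integrable setT (EFin \o f).
  by apply: eq_integrable (sqintM sf s1) => // w _ /=; rewrite mulr1.
have G0 A : level_sets A -> (\int[m]_(w in A) (f w)%:E = 0)%E.
  move=> [mA [n An]].
  have sA : sqint m (\1_A : Om -> R).
    apply: sqint_le s1 _ => [|w]; first exact: measurable_indic.
    by rewrite indicE expr1n; case: (_ \in _); rewrite ?expr1n// expr0n ler01.
  have [k Ak] := represents_ex sA.
  have := hH n k; rewrite (L2_ipE sf.1 sA.1 (represents_repr h) Ak) => fA.
  have {}fA : \int[m]_w (f w * \1_A w) = 0.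
    apply: fA; apply/HnP; exists \1_A; split => //.
    by move=> w; rewrite !indicE; congr (nat_of_bool _)%:R; apply/idP/idP;
      rewrite !inE; have := An w; rewrite /mkset => ->.
  rewrite integral_mkcond -[RHS]/(0%:E) -fA /Rintegral fineK.
    apply: eq_integral => w _; rewrite /patch indicE.
    by case: (_ \in _); rewrite ?mulr1 ?mulr0.
  by apply: integrable_fin_num => //; exact: sqintM.
have fE A : measurable A -> (\int[m]_(w in A) (f w)%:E = 0)%E.
  move=> mA; apply: (@dynkin_induction _ _ level_sets
    (fun A => \int[m]_(w in A) (f w)%:E = 0)%E level_sets_generate level_setsI).
  - by apply: G0; split => //; exists 0%N.
  - exact: G0.
  - move=> B mB B0.
    have BT : (\int[m]_w (f w)%:E = 0)%E by apply: G0; split => //; exists 0%N.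
    move: BT; rewrite -(setUv B) integral_setU//.
    + by rewrite B0 add0e.
    + exact: measurableC.
    + by rewrite setUv; exact: measurable_int fi.
    + by apply/disj_setPS; rewrite setICr.
  - move=> B mB tB B0; rewrite integral_bigcup//.
      by rewrite eseries0// => i _ _; exact: B0.
    by apply: integrableS fi => //; exact: bigcupT_measurable.
  - by rewrite -level_sets_generate.
have := integral_ae_eq measurableT fi (measurable_cst (0%E : \bar R)).
move=> /(_ _)[A _ mA|N [mN N0 fN]].
  by rewrite integral0 fE.
apply: (represents_unique (represents_repr h) (represents0 m)).
exists N; split => // w /= fw; apply: fN => /= f0; apply: fw => _.
by have /(_ I) [] := f0.
Qed.

(** The approximable vectors form a closed subspace [D] containing every [Hn n], so [h] minus its
    projection on [D] is orthogonal to all [Hn n], hence 0. *)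
Lemma Hn_dense h (e : R) : 0 < e -> exists n p, Hm n p /\ ip (h - p) (h - p) < e.
Proof.
pose D : set H := [set h | forall e : R, 0 < e -> exists n p, Hm n p /\ ip (h - p) (h - p) < e].
have HD n p : Hm n p -> D p.
  by move=> pn e' e0; exists n, p; rewrite subrr (sf0l F).
have DF : sform D ip.
  split.
  - by apply: (HD 0%N 0); exact: Hn0.
  - move=> f g Df Dg e' e0.
    have [n [p [pn fp]]] := Df _ (divr_gt0 e0 (ltr0n _ 4)).
    have [k [q [qk gq]]] := Dg _ (divr_gt0 e0 (ltr0n _ 4)).
    exists (n + k)%N, (p + q); split.
      by apply: HnD; [exact: Hn_le|rewrite addnC; exact: Hn_le].
    rewrite opprD addrACA; apply: le_lt_trans (sf_sqrD_le F I I) _.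
    by move: fp gq; lra.
  - move=> a f Df e' e0.
    have a1 : 0 < a ^+ 2 + 1 by rewrite ltr_wpDl// sqr_ge0.
    have [n [p [pn fp]]] := Df _ (divr_gt0 e0 a1).
    exists n, (a *: p); split; first exact: HnZ.
    rewrite -scalerBr (sf_sqrZ F)//; move: fp; rewrite ltr_pdivlMr//; apply: le_lt_trans.
    by rewrite mulrC ler_wpM2l ?(sf_ge0 F)// lerDl.
  - by move=> *; exact: (sfC F).
  - by move=> *; exact: (sfDl F).
  - by move=> *; exact: (sfZl F).
  - by move=> *; exact: (sf_ge0 F).
have cD : closed_set ip D.
  move=> u f uD uf e' e0.
  have [N /(_ N (leqnn N)) fN] := uf _ (divr_gt0 e0 (ltr0n _ 4)).
  have [n [p [pn up]]] := uD N _ (divr_gt0 e0 (ltr0n _ 4)).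
  exists n, p; split => //; apply: le_lt_trans (sf_sqrB_le F (g := u N) I I I) _.
  by rewrite (sf_sym F (I : setT f) (I : setT (u N))); lra.
have [PD PO] := oprojP (L2_hilbert m) h DF cD.
have : h - oproj ip D h = 0 by apply: orth_Hn_eq0 => n g /HD/PO.
by move=> /eqP; rewrite subr_eq0 => /eqP hP; move: e; rewrite hP.
Qed.

End density.

(** * Verification of the hypotheses of the Galerkin theorem *)

Section level_forms.
Context {R : realType} {S : finType} {d : measure_display}
  {E : measurableType d} (M : setting R S E).
Variable m : probability (tree_space M) R.
Hypothesis hm : tree_law m.
Local Notation H := (L2 m).
Local Notation ip := (L2_ip m).
Local Notation Hm := (@Hn R S d E M m).
Let F : sform setT ip := L2_ip_sform m.
Variables (rho : R) (kappa : offdiag S -> R).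
Hypothesis rho1 : 1 < 2 * rho.
Hypothesis kappa_gt0 : forall p, 0 < kappa p.
Hypothesis kappa_push : push_weight M rho kappa = kappa.
Implicit Types (f g h : H).

Let muw0 p : 0 <= mu_weight M p.
Proof. by rewrite mulr_ge0// ltW// mu_gt0. Qed.

Let LF n : sform (Hm n) (fun f g => ip f (level_op rho n kappa g)) :=
  level_op_sform hm rho1 n (fun p => ltW (kappa_gt0 p)).
Let muF n : sform (Hm n) (fun f g => ip f (level_op rho n (mu_weight M) g)) :=
  level_op_sform hm rho1 n muw0.

(** All levels admissible in [tree_form] give the same value, because [kappa] is fixed by
    [push_weight rho]. *)
Lemma tree_form_val n f g : Hm n f -> Hm n g ->
  fval (tree_form m kappa rho) f g = ip f (level_op rho n kappa g).
Proof.
have consistent k j f' g' : Hm k f' -> Hm k g' ->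
    ip f' (level_op rho (k + j) kappa g') = ip f' (level_op rho k kappa g').
  move=> ff gg; elim: j => [|j IH]; first by rewrite addn0.
  rewrite addnS (level_op_consistent hm rho1 kappa (Hn_le j gg) (Hn_le j ff)).
  by rewrite kappa_push IH.
move=> nf ng; apply: xget_unique => [|v [k [kf kg ->]]].
  by exists n; split => //; rewrite QnE// (sfNr F)// opprK.
rewrite QnE// (sfNr F)// opprK -(consistent k n)// -(consistent n k)//.
by rewrite addnC.
Qed.

Definition scaled_An_op n f : H := (2 * rho) ^- n *: An n (oproj ip (Hm n) f).

Let oproj_HnP n f :=
  oprojP (L2_hilbert m) f (LF n) (@Hn_closed _ _ _ _ _ _ n).

(** The operator takes values in [Hn n], so the left argument may be projected as well; symmetry and
    positivity on the whole space then reduce to those of [level_op] on [Hn n]. *)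
Lemma scaled_An_opE n f g : ip f (scaled_An_op n g) =
  ip (oproj ip (Hm n) f) (level_op rho n (mu_weight M) (oproj ip (Hm n) g)).
Proof.
have [Pf Of] := oproj_HnP n f; have [Pg _] := oproj_HnP n g.
rewrite /scaled_An_op scaled_AnE//; apply/eqP; rewrite -subr_eq0 -(sfBl F)//.
by rewrite Of//; exact: level_op_Hn.
Qed.

Lemma scaled_An_op_sform n : sform setT (fun f g => ip f (scaled_An_op n g)).
Proof.
split.
- by [].
- by [].
- by [].
- move=> f g _ _; rewrite !scaled_An_opE.
  exact: (sfC (muF n) (oproj_HnP n f).1 (oproj_HnP n g).1).
- by move=> f g h _ _ _; exact: (sfDl F).
- by move=> a f h _ _; exact: (sfZl F).
- by move=> f _; rewrite scaled_An_opE; exact: (sf_ge0 (muF n) (oproj_HnP n f).1).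
Qed.

Lemma scaled_An_op_bounded n : exists c, forall f, ip f (scaled_An_op n f) <= c * ip f f.
Proof.
have [c cP] := level_op_energy_le hm rho n (mu_weight M).
exists `|c| => f; have [Pf Of] := oproj_HnP n f.
rewrite scaled_An_opE; apply: le_trans (cP _ Pf) _.
apply: (@le_trans _ _ (`|c| * ip (oproj ip (Hm n) f) (oproj ip (Hm n) f))).
  by rewrite ler_wpM2r ?(sf_ge0 F)// ler_norm.
rewrite ler_wpM2l//.
have := sf_sqrD F (I : setT (f - oproj ip (Hm n) f)) (I : setT (oproj ip (Hm n) f)).
by rewrite subrK (Of _ Pf) mul0rn addr0 => ->; rewrite lerDr (sf_ge0 F).
Qed.

Lemma opp_opK (T : set (H * H)) : opp_op (opp_op T) = T.
Proof. by apply/seteqP; split=> -[f h]; rewrite /opp_op/= opprK. Qed.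

End level_forms.

Theorem theorem2 (R : realType) (S : finType) (d : measure_display)
    (E : measurableType d) (M : setting R S E)
    (m : probability (tree_space M) R) (hm : tree_law m)
    (rho : R) (hrho : largest_eigenvalue (Pminus M) rho)
    (theta kappa : offdiag S -> R)
    (hprim : primitive (Pminus M)) (h2rho : 1 < 2 * rho)
    (theta_gt0 : forall p, 0 < theta p)
    (theta_right : Pminus M *m (\col_i theta (enum_val i)) =
       rho *: (\col_i theta (enum_val i)))
    (kappa_gt0 : forall p, 0 < kappa p)
    (kappa_left : (\row_i kappa (enum_val i)) *m Pminus M =
       rho *: (\row_i kappa (enum_val i)))
    (theta_kappa : \sum_(p : offdiag S) theta p * kappa p = 1)
    (theta_mu : \sum_(p : offdiag S) theta p * (mu M (val p).1 * mu M (val p).2) = 1) :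
  strong_resolvent_cvg (L2_ip m) (scaled_An m rho)
    (opp_op (Qinf m kappa rho)).
Proof.
have kp := kappa_push h2rho kappa_left.
rewrite /Qinf opp_opK.
have [C C0 CP] := scaled_An_approx hm h2rho hprim theta_gt0 theta_right kappa_gt0
  kappa_left theta_kappa theta_mu.
have r0 : 0 < 2 * rho by exact: lt_trans h2rho.
have q1 : (2 * rho)^-1 < 1 by rewrite invf_lt1.
have q0 : 0 <= (2 * rho)^-1 by rewrite invr_ge0 ltW.
refine (@galerkin_strong_resolvent _ _ _ (L2_hilbert m) (Hn (m := m))
  (fun n => level_op rho n kappa) (@scaled_An_op _ _ _ _ M m rho) C (2 * rho)^-1
  (Hn_incr (m := m)) (fun n => @Hn_closed _ _ _ _ _ m n) _ _ _ _ _ C0 q0 q1 _ _ (tree_form m kappa rho) erefl _).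
- by move=> n f; exact: level_op_Hn.
- by move=> n; apply: level_op_sform => // p; exact: ltW.
- by move=> n; exact: level_op_energy_le.
- exact: scaled_An_op_sform hm rho kappa h2rho kappa_gt0.
- exact: scaled_An_op_bounded hm rho kappa h2rho kappa_gt0.
- by move=> n f nf eps e0; exact: CP.
- exact: Hn_dense.
- by move=> n f g nf ng; exact: tree_form_val.
Qed.
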